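(* Let $W$ be an $8$-dimensional real Hilbert space equipped with a positive triple cross product, let $\Phi\in\Lambda^4W^*$ be its Cayley calibration, orient $W$ so that $\Phi\wedge\Phi>0$, and let $*$ be the associated Hodge operator. There are orthogonal splittings $$\Lambda^2W^*=\Lambda^2_7\oplus\Lambda^2_{21},\qquad\Lambda^3W^*=\Lambda^3_8\oplus\Lambda^3_{48},\qquad\Lambda^4W^*=\Lambda^4_1\oplus\Lambda^4_7\oplus\Lambda^4_{27}\oplus\Lambda^4_{35},$$ where $\dim\Lambda^k_d=d$ and \begin{align*} \Lambda^2_7&:=\{\omega\in\Lambda^2W^*: *(\Phi\wedge\omega)=3\omega\}=\{u^*\wedge v^*-\iota(u)\iota(v)\Phi: u,v\in W\},\\ \Lambda^2_{21}&:=\{\omega_\xi:\xi\in\mathfrak{g}\}=\{\omega\in\Lambda^2W^*: *(\Phi\wedge\omega)=-\omega\}\\ &\;=\{\omega\in\Lambda^2W^*:\langle\omega,\iota(u)\iota(v)\Phi\rangle=\omega(u,v)\ \forall u,v\in W\},\\ \Lambda^3_8&:=\{\iota(u)\Phi: u\in W\},\\ \Lambda^3_{48}&:=\{\omega\in\Lambda^3W^*:\Phi\wedge\omega=0\},\\ \Lambda^4_1&:=\langle\Phi\rangle,\\ \Lambda^4_7&:=\{\mathcal{L}_\xi\Phi:\xi\in\mathfrak{so}(W)\},\\ \Lambda^4_{27}&:=\{\omega\in\Lambda^4W^*: *\omega=\omega,\ \omega\wedge\Phi=0,\ \omega\wedge\mathcal{L}_\xi\Phi=0\ \forall\xi\in\mathfrak{so}(W)\},\\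 \Lambda^4_{35}&:=\{\omega\in\Lambda^4W^*: *\omega=-\omega\}. \end{align*} Here $\mathfrak{g}:=\mathrm{Lie}(\mathrm{G}(W,\Phi))$ and, for $\xi\in\mathfrak{so}(W)$, the $4$-form $\mathcal{L}_\xi\Phi\in\Lambda^4W^*$ and the $2$-form $\omega_\xi\in\Lambda^2W^*$ are defined by $\mathcal{L}_\xi\Phi:=\frac{d}{dt}\big|_{t=0}\exp(t\xi)^*\Phi$ and $\omega_\xi:=\langle\cdot,\xi\cdot\rangle$. Each of the spaces $\Lambda^k_d$ is an irreducible representation of $\mathrm{G}(W,\Phi)$.
   Context: A triple cross product on a real Hilbert space $W$ is an alternating multi-linear map $W^3\to W$, $(u,v,w)\mapsto u\times v\times w$, such that $u\times v\times w$ is orthogonal to $u,v,w$ and $|u\times v\times w|=|u\wedge v\wedge w|$ for all $u,v,w$ (where $|u\wedge v\wedge w|^2$ is the Gram determinant of $u,v,w$). When $\dim W=8$ there is a number $\varepsilon\in\{\pm1\}$ such that $e\times u\times(e\times v\times w)=\varepsilon|e|^2\,u\times v\times w$ whenever $e,u,v\in W$ are pairwise orthogonal and $w\in W$ is orthogonal to $e,u,v$ and $e\times u\times v$; the triple cross product is positive if $\varepsilon=1$. Its Cayley calibration is the alternating $4$-form $\Phi(x,u,v,w):=\langle x,u\times v\times w\rangle$; it satisfies $\Phi\wedge\Phi\neq0$. $\mathrm{G}(W,\Phi):=\{g\in\mathrm{GL}(W): g^*\Phi=\Phi\}$, which is contained in $\mathrm{SO}(W)$ and acts naturally on forms. $\iota(u)$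 denotes interior product, $u^*:=\langle u,\cdot\rangle$, and forms carry the inner product induced from $W$, for which $u_1^*\wedge\dots\wedge u_k^*$ satisfies $\langle u_1^*\wedge\dots\wedge u_k^*,\alpha\rangle=\alpha(u_1,\dots,u_k)$. *)

(* Defs.v *)
From HB Require Import structures.
From mathcomp Require Import all_boot all_order all_fingroup all_algebra.
From mathcomp Require Import all_classical all_reals all_analysis.

Set Implicit Arguments.
Unset Strict Implicit.
Unset Printing Implicit Defensive.

Import Order.TTheory GRing.Theory Num.Theory.
Import numFieldNormedType.Exports.

Local Open Scope classical_set_scope.
Local Open Scope ring_scope.

Definition tset (T : Type) k (t : k.-tuple T) (i : 'I_k) (x : T) : k.-tuple T :=
  [tuple if j == i then x else tnth t j | j < k].

Lemma tnth_tset (T : Type) k (t : k.-tuple T) i x j :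
  tnth (tset t i x) j = if j == i then x else tnth t j.
Proof. exact: tnth_mktuple. Qed.

Section AlternatingMaps.
Context {R : realType} {W : vectType R} {V : lmodType R} {k : nat}.
Implicit Type f : k.-tuple W -> V.

Definition multilinear f := forall (i : 'I_k) (t : k.-tuple W) a x y,
  f (tset t i (a *: x + y)) = a *: f (tset t i x) + f (tset t i y).

Definition alternating f := forall (i j : 'I_k) (t : k.-tuple W),
  i != j -> tnth t i = tnth t j -> f t = 0.

End AlternatingMaps.

Record altform (R : realType) (W : vectType R) (k : nat) := Form {
  form_fun :> k.-tuple W -> R;
  form_multilinear : multilinear form_fun;
  form_alternating : alternating form_fun }.

HB.instance Definition _ R W k := gen_eqMixin (@altform R W k).
HB.instance Definition _ R W k := gen_choiceMixin (@altform R W k).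

Lemma form_linear (R : realType) (W : vectType R) k (f : altform W k) i t a x y :
  f (tset t i (a *: x + y)) = a * f (tset t i x) + f (tset t i y).
Proof. exact: form_multilinear. Qed.

Section FormLmodule.
Variables (R : realType) (W : vectType R) (k : nat).
Local Notation F := (altform W k).
Implicit Types f g : F.

Lemma formP f g : f =1 g -> f = g.
Proof.
move=> /funext; case: f g => f fm fa [g gm ga] /= fg.
move: fm fa gm ga; rewrite fg => fm fa gm ga.
by congr Form; exact: Prop_irrelevance.
Qed.

Fact form0_multilinear : multilinear (fun _ : k.-tuple W => 0 : R).
Proof. by move=> i t a x y; rewrite scaler0 addr0. Qed.
Fact form0_alternating : alternating (fun _ : k.-tuple W => 0 : R).
Proof. by []. Qed.
Definition form0 := Form form0_multilinear form0_alternating.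

Fact formD_multilinear f g : multilinear (fun t => f t + g t).
Proof.
by move=> i t a x y; rewrite !form_multilinear scalerDr addrACA.
Qed.
Fact formD_alternating f g : alternating (fun t => f t + g t).
Proof.
by move=> i j t ij tij; rewrite !(form_alternating _ ij tij) addr0.
Qed.
Definition formD f g := Form (formD_multilinear f g) (formD_alternating f g).

Fact formZ_multilinear (c : R) f : multilinear (fun t => c * f t).
Proof.
by move=> i t a x y; rewrite form_multilinear mulrDr; congr (_ + _); exact: mulrCA.
Qed.
Fact formZ_alternating (c : R) f : alternating (fun t => c * f t).
Proof.
by move=> i j t ij tij; rewrite (form_alternating _ ij tij) mulr0.
Qed.
Definition formZ c f := Form (formZ_multilinear c f) (formZ_alternating c f).

Fact formDA : associative formD.
Proof. by move=> f g h; apply/formP => t /=; rewrite addrA. Qed.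
Fact formDC : commutative formD.
Proof. by move=> f g; apply/formP => t /=; rewrite addrC. Qed.
Fact form0D : left_id form0 formD.
Proof. by move=> f; apply/formP => t /=; rewrite add0r. Qed.
Fact formND : left_inverse form0 (formZ (-1)) formD.
Proof. by move=> f; apply/formP => t /=; rewrite mulN1r addNr. Qed.
HB.instance Definition _ := GRing.isZmodule.Build F formDA formDC form0D formND.

Fact formZA a b f : formZ a (formZ b f) = formZ (a * b) f.
Proof. by apply/formP => t /=; rewrite mulrA. Qed.
Fact formZ1 : left_id 1 formZ.
Proof. by move=> f; apply/formP => t /=; rewrite mul1r. Qed.
Fact formZDr : right_distributive formZ +%R.
Proof. by move=> a f g; apply/formP => t /=; rewrite mulrDr. Qed.
Fact formZDl f : {morph formZ^~ f : a b / a + b}.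
Proof. by move=> a b; apply/formP => t /=; rewrite mulrDl. Qed.
HB.instance Definition _ :=
  GRing.Zmodule_isLmodule.Build R F formZA formZ1 formZDr formZDl.

Lemma form0E t : (0 : F) t = 0. Proof. by []. Qed.
Lemma formDE f g t : (f + g) t = f t + g t. Proof. by []. Qed.
Lemma formZE a f t : (a *: f) t = a * f t. Proof. by []. Qed.
Lemma formNE f t : (- f) t = - f t. Proof. exact: mulN1r. Qed.

End FormLmodule.

Section SubFinDim.
Variables (R : realType) (E : vectType R).

Lemma closed_vspace (S : set E) : S 0 ->
  (forall a x y, S x -> S y -> S (a *: x + y)) ->
  exists U : {vspace E}, forall x, x \in U <-> S x.
Proof.
move=> S0 SD.
pose p d := `[< exists2 U : {vspace E}, \dim U = d & {subset U <= [pred x | `[< S x >]]} >].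
have p0 : exists d, p d.
  exists 0%N; apply/asboolP; exists 0%VS; first exact: dimv0.
  by move=> x; rewrite memv0 => /eqP ->; apply/asboolP.
have pM d : p d -> (d <= \dim {:E})%N.
  by move=> /asboolP[U <- _]; rewrite dimvS ?subvf.
case: (ex_maxnP p0 pM) => d /asboolP[U dU US] dmax; exists U => x; split.
  by move=> /US/asboolP.
move=> Sx; have /dmax : p (\dim (U + <[x]>)).
  apply/asboolP; exists (U + <[x]>)%VS => // y /memv_addP[u uU [v]].
  move=> /vlineP[a ->] ->; apply/asboolP; rewrite addrC; apply: SD => //.
  exact/asboolP/US.
rewrite -dU => le_dim; have /eqP -> : U == (U + <[x]>)%VS.
  by rewrite eqEdim addvSl.
by apply: subvP (addvSr _ _) _ _; exact: memv_line.
Qed.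

Lemma inj_findim (V : lmodType R) (ev : V -> E) : linear ev -> injective ev ->
  {d & Vector.axiom d V}.
Proof.
move=> evl evi; pose S := [set x | exists v, ev v = x].
have ev0 : ev 0 = 0.
  by have := evl (-1) 0 0; rewrite scaler0 addr0 scaleN1r addNr.
have /cid[U US] : exists U : {vspace E}, forall x, x \in U <-> S x.
  apply: closed_vspace; first by exists 0.
  by move=> a _ _ [x <-] [y <-]; exists (a *: x + y); rewrite evl.
have evU v : ev v \in U by apply/US; exists v.
exists (\dim U), (fun v => \row_i coord (vbasis U) i (ev v)).
  by move=> a x y; apply/rowP => i; rewrite !mxE evl linearP.
have inv (r : 'rV[R]_(\dim U)) :
    {v | ev v = \sum_i r 0 i *: (vbasis U)`_i}.
  apply: cid; apply/US; apply: rpred_sum => i _.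
  by rewrite rpredZ ?vbasis_mem ?memt_nth.
exists (fun r => sval (inv r)) => [v|r].
  case: (inv _) => u /= evu; apply: evi; rewrite evu.
  by rewrite [RHS](coord_vbasis (evU v)); apply: eq_bigr => i _; rewrite mxE.
case: (inv _) => u /= evu; apply/rowP => i.
by rewrite mxE evu coord_sum_free ?(basis_free (vbasisP U)).
Qed.

End SubFinDim.

Section FormVector.
Variables (R : realType) (W : vectType R) (k : nat).
Local Notation n := (\dim {:W}).
Local Notation b := (vbasis {:W}).

Let ev (f : altform W k) : {ffun {ffun 'I_k -> 'I_n} -> R^o} :=
  [ffun s : {ffun 'I_k -> 'I_n} => f [tuple tnth b (s i) | i < k]].

Let ev_linear : linear ev.
Proof. by move=> a f g; apply/ffunP => s; rewrite !ffunE. Qed.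

Let ev_inj : injective ev.
Proof.
move=> f g fg; apply/formP => t.
have [m] := ubnP #|[pred i | tnth t i \notin b]|; elim: m => // m IH in t *.
case: (pickP [pred i | tnth t i \notin b]) => [i0 i0P|tb _]; last first.
  have tbi i : tnth t i \in b by have := tb i; rewrite inE => /negbFE.
  have idx i : (index (tnth t i) b < n)%N.
    by rewrite -[X in (_ < X)%N](size_tuple b) index_mem.
  have := congr1 (fun h : {ffun _ -> _} => h [ffun i => Ordinal (idx i)]) fg.
  rewrite !ffunE; set t' := mktuple _.
  suff -> : t' = t by [].
  by apply: eq_from_tnth => i; rewrite tnth_mktuple ffunE (tnth_nth 0) nth_index.
move=> tm.
have tE : t = tset t i0 (\sum_(j < n) coord b j (tnth t i0) *: b`_j).
  rewrite -coord_vbasis ?memvf//; apply: eq_from_tnth => i.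
  by rewrite tnth_tset; case: eqP => // ->.
have lin (h : altform W k) (c : 'I_n -> R) (r : seq 'I_n) :
    h (tset t i0 (\sum_(j <- r) c j *: b`_j)) =
    \sum_(j <- r) c j * h (tset t i0 b`_j).
  elim: r => [|j r IHr]; last by rewrite !big_cons form_multilinear IHr.
  rewrite !big_nil; have := form_multilinear h i0 t (-1) 0 0.
  by rewrite scaler0 addr0 scaleN1r addNr.
rewrite tE !lin; apply: eq_bigr => j _; congr (_ * _); apply: IH.
rewrite ltnS in tm; apply: leq_trans tm; apply: proper_card.
apply/properP; split.
  apply/fintype.subsetP => i; rewrite !inE tnth_tset.
  by case: eqP => // _; rewrite mem_nth ?size_tuple.
exists i0 => //; rewrite inE tnth_tset eqxx negbK.
by rewrite mem_nth ?size_tuple.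
Qed.

HB.instance Definition _ := Lmodule_hasFinDim.Build R (altform W k)
  (projT2 (inj_findim ev_linear ev_inj)).

End FormVector.

Section Operations.
Variables (R : realType) (W : vectType R).

Section Wedge.
Variables (k m : nat) (f : altform W k) (g : altform W m).

Let lpart (s : 'S_(k + m)) (t : (k + m).-tuple W) : k.-tuple W :=
  [tuple tnth t (s (lshift m i)) | i < k].
Let rpart (s : 'S_(k + m)) (t : (k + m).-tuple W) : m.-tuple W :=
  [tuple tnth t (s (rshift k j)) | j < m].

(* Normalised so that [u_1^* ∧ ... ∧ u_k^*] evaluated at [(v_1, ..., v_k)] is
   the determinant of the matrix [⟨u_i, v_j⟩]. *)
Definition wedge_fun (t : (k + m).-tuple W) : R :=
  (k`! * m`!)%:R^-1 *
  \sum_(s : 'S_(k + m)) (-1) ^+ s *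
    (f [tuple tnth t (s (lshift m i)) | i < k] *
     g [tuple tnth t (s (rshift k j)) | j < m]).

Fact wedge_multilinear : multilinear wedge_fun.
Proof.
move=> i t a x y; rewrite /wedge_fun -[RHS]/(a * _ + _) [a * _]mulrCA -mulrDr; congr (_ * _).
rewrite mulr_sumr -big_split; apply: eq_bigr => s _ /=.
rewrite [a * _]mulrCA -mulrDr; congr (_ * _).
rewrite -/(lpart _ _) -/(lpart _ _) -/(lpart _ _) -/(rpart _ _) -/(rpart _ _) -/(rpart _ _).
rewrite -(permKV s i); case: (split_ordP (s^-1 i)%g) => j ->.
- have L z : lpart s (tset t (s (lshift m j)) z) = tset (lpart s t) j z.
    apply: eq_from_tnth => l; rewrite !(tnth_mktuple, tnth_tset).
    by rewrite (inj_eq perm_inj) (inj_eq (@lshift_inj _ _)).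
  have Q z : rpart s (tset t (s (lshift m j)) z) = rpart s t.
    apply: eq_from_tnth => l; rewrite !(tnth_mktuple, tnth_tset).
    by rewrite (inj_eq perm_inj) eq_rlshift.
  by rewrite !L !Q form_linear mulrDl mulrA.
- have L z : lpart s (tset t (s (rshift k j)) z) = lpart s t.
    apply: eq_from_tnth => l; rewrite !(tnth_mktuple, tnth_tset).
    by rewrite (inj_eq perm_inj) eq_lrshift.
  have Q z : rpart s (tset t (s (rshift k j)) z) = tset (rpart s t) j z.
    apply: eq_from_tnth => l; rewrite !(tnth_mktuple, tnth_tset).
    by rewrite (inj_eq perm_inj) (inj_eq (@rshift_inj _ _)).
  by rewrite !L !Q form_linear mulrDr mulrCA.
Qed.

Fact wedge_alternating : alternating wedge_fun.
Proof.
move=> i j t ij tij; rewrite /wedge_fun.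
set S := \sum_s _; suff -> : S = 0 by rewrite mulr0.
suff : S = - S by move/esym/eqP; rewrite eqNr => /eqP.
rewrite {1}/S (reindex_inj (mulIg (tperm i j))) /= -sumrN.
apply: eq_bigr => s _; rewrite odd_permM odd_tperm ij addbT signrN mulNr.
congr (- (_ * (f _ * g _))); apply: eq_from_tnth => l;
  by rewrite !tnth_mktuple permM; case: tpermP => // ->.
Qed.

Definition wedge : altform W (k + m) := Form wedge_multilinear wedge_alternating.

End Wedge.

Section InteriorProduct.
Variables (k : nat) (u : W) (f : altform W k.+1).

Definition interior_product_fun (t : k.-tuple W) : R := f [tuple of u :: t].

Let cons_tset (t : k.-tuple W) i x :
  [tuple of u :: tset t i x] = tset [tuple of u :: t] (lift ord0 i) x.
Proof.
apply: eq_from_tnth => j; rewrite tnth_tset.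
by case: (unliftP ord0 j) => [l|] ->; rewrite ?tnthS ?tnth0 // tnth_tset (inj_eq lift_inj).
Qed.

Fact interior_product_multilinear : multilinear interior_product_fun.
Proof. by move=> i t a x y; rewrite /interior_product_fun !cons_tset form_multilinear. Qed.

Fact interior_product_alternating : alternating interior_product_fun.
Proof.
move=> i j t ij tij; apply: (@form_alternating _ _ _ f (lift ord0 i) (lift ord0 j)).
  by rewrite (inj_eq lift_inj).
by rewrite !tnthS.
Qed.

(* [ι(u) f] *)
Definition interior_product : altform W k := Form interior_product_multilinear interior_product_alternating.

End InteriorProduct.

Section Pullback.
Variables (k : nat) (g : 'End(W)) (f : altform W k).

Definition pullback_fun (t : k.-tuple W) : R := f (map_tuple g t).

Fact pullback_multilinear : multilinear pullback_fun.
Proof.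
have ms t i x : map_tuple g (tset t i x) = tset (map_tuple g t) i (g x).
  apply: eq_from_tnth => j; rewrite tnth_map !tnth_tset.
  by case: eqP => //; rewrite tnth_map.
by move=> i t a x y; rewrite /pullback_fun !ms linearP form_multilinear.
Qed.

Fact pullback_alternating : alternating pullback_fun.
Proof.
by move=> i j t ij tij; apply: (form_alternating f ij); rewrite !tnth_map tij.
Qed.

Definition pullback : altform W k := Form pullback_multilinear pullback_alternating.

End Pullback.

End Operations.

Section InnerProduct.
Variables (R : realType) (W : vectType R) (ip : {dot W for idfun}).

Definition vnorm (u : W) : R := Num.sqrt (ip u u).

(* [|u_1 ∧ ... ∧ u_k|] *)
Definition wedge_norm k (t : k.-tuple W) : R :=
  Num.sqrt (\det (\matrix_(i < k, j < k) ip (tnth t i) (tnth t j))).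

Section Covector.
Variable u : W.
Definition covector_fun (t : 1.-tuple W) : R := ip u (tnth t ord0).

Fact covector_multilinear : multilinear covector_fun.
Proof.
by move=> i t a x y; rewrite /covector_fun !tnth_tset !(ord1 i) eqxx linearPr.
Qed.

Fact covector_alternating : alternating covector_fun.
Proof. by move=> i j; rewrite !ord1. Qed.

(* [u^* = ⟨u, .⟩] *)
Definition covector : altform W 1 := Form covector_multilinear covector_alternating.
End Covector.

Lemma orthonormal_basis_exists :
  exists e : (\dim {:W}).-tuple W, orthonormal ip e.
Proof.
have ipC u v : ip u v = ip v u by rewrite hermC expr0 mul1r.
suff H d : (d <= \dim {:W})%N -> exists e : d.-tuple W, orthonormal ip e.
  exact: H.
elim: d => [|d IH] dW; first by exists [tuple].
have [e eo] := IH (ltnW dW).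
have /subvPn[w _ we] : ~~ ({:W} <= <<e>>)%VS.
  apply/negP => /dimvS; apply/negP; rewrite -ltnNge.
  by apply: leq_ltn_trans (dim_span _) _; rewrite size_tuple.
move: eo => /andP[/allP e1 epo].
have eE i j : ip (tnth e i) (tnth e j) = (i == j)%:R.
  have epo' : forall (s : seq W) (a b : nat), pair_ortho_rec ip s ->
      (a < b < size s)%N -> ip s`_a s`_b = 0.
    elim=> [|x s IHs] [|a] [|b] //=; rewrite ?andbF ?ltn0 //.
    - by move=> /andP[+ _] bs; rewrite /ortho_rec /= andbT => /allP/(_ _ (mem_nth 0 bs))/eqP.
    - by move=> /andP[_ /IHs] /[apply].
  case: eqP => [->|/eqP ij].
    by have := e1 _ (mem_tnth j e) => /eqP.
  rewrite !(tnth_nth 0).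
  have [ij'|ij'] := ltnP i j.
    by rewrite (epo' _ _ _ epo) // ij' size_tuple ltn_ord.
  rewrite ipC (epo' _ _ _ epo) // size_tuple ltn_ord andbT ltn_neqAle ij' andbT.
  by apply: contraNneq ij => /ord_inj ->.
pose p := w - \sum_i ip w (tnth e i) *: tnth e i.
have p0 : p != 0.
  apply: contraNneq we => /eqP; rewrite subr_eq0 => /eqP ->.
  by apply: rpred_sum => i _; rewrite rpredZ // memv_span // mem_tnth.
have pe i : ip p (tnth e i) = 0.
  rewrite linearBl linear_sumlz (bigD1 i) //= big1 => [|j ji].
    by rewrite addr0 linearZl_LR /= eE eqxx mulr1 subrr.
  by rewrite linearZl_LR /= eE (negPf ji) mulr0.
have pp := neq0_dnorm_gt0 p p0 : 0 < ip p p.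
exists [tuple of (Num.sqrt (ip p p))^-1 *: p :: e].
rewrite /orthonormal /= epo andbT; apply/andP; split; [apply/andP; split|].
- rewrite linearZl_LR linearZr_LR /= mulrA -invfM -expr2 sqr_sqrtr ?ltW //.
  by rewrite mulVf // gt_eqF.
- exact/allP.
- rewrite /ortho_rec /= andbT; apply/allP => _ /tnthP[i ->] /=.
  by rewrite linearZl_LR /= pe mulr0.
Qed.

Definition orthonormal_basis : (\dim {:W}).-tuple W :=
  xchoose orthonormal_basis_exists.

Lemma orthonormal_basisP : orthonormal ip orthonormal_basis.
Proof. exact: (xchooseP orthonormal_basis_exists). Qed.

(* The inner product for which the [e_I^*], [I] an increasing multi-index, form an
   orthonormal basis: each [e_I] occurs [k!] times in the sum over all [s], and the
   non-injective [s] contribute [0]. *)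
Definition form_ip k (f g : altform W k) : R :=
  (k`!)%:R^-1 * \sum_(s : {ffun 'I_k -> 'I_(\dim {:W})})
    (f [tuple tnth orthonormal_basis (s i) | i < k] *
     g [tuple tnth orthonormal_basis (s i) | i < k]).

(* The unit top-degree form that is a positive multiple of [f]: the volume form of the
   orientation for which [f > 0]. *)
Definition volume k (f : altform W k) : altform W k := (Num.sqrt (form_ip f f))^-1 *: f.

(* [*g], characterised by [f ∧ *g = ⟨f, g⟩ vol] for all [f]. *)
Definition hodge k m (vol : altform W (k + m)) (g : altform W k) : altform W m :=
  xget 0 [set h : altform W m | forall f : altform W k, wedge f h = form_ip f g *: vol].

End InnerProduct.

Arguments hodge {R W} ip k m vol g.

Notation "f ∧ g" := (wedge f g) (at level 39, left associativity) : ring_scope.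

(* The topology of a finite-dimensional real vector space is the one of its
   coordinates, in any basis. *)
Section Calculus.
Variables (R : realType) (V : vectType R).
Local Notation b := (vbasis {:V}).

Definition vlim (u : nat -> V) : V :=
  \sum_(i < \dim {:V}) limn (fun n => coord b i (u n) : R) *: b`_i.

Definition vderive (c : R -> V) (t : R) : V :=
  \sum_(i < \dim {:V}) derive1 (fun s => coord b i (c s) : R) t *: b`_i.

End Calculus.

Definition lfun_exp (R : realType) (W : vectType R) (xi : 'End(W)) : 'End(W) :=
  vlim (fun n => \sum_(j < n) (j`!)%:R^-1 *: iter j (comp_lfun xi) \1%VF).

Section TripleCrossProduct.
Variables (R : realType) (W : vectType R) (ip : {dot W for idfun}).
Implicit Types (P : 3.-tuple W -> W) (Phi : altform W 4).

Definition triple_cross_product P :=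
  [/\ multilinear P, alternating P,
      forall t i, ip (P t) (tnth t i) = 0 &
      forall t, vnorm ip (P t) = wedge_norm ip t].

Definition positive_product P := forall e u v w,
  ip e u = 0 -> ip e v = 0 -> ip u v = 0 ->
  ip w e = 0 -> ip w u = 0 -> ip w v = 0 -> ip w (P [tuple e; u; v]) = 0 ->
  P [tuple e; u; P [tuple e; v; w]] = vnorm ip e ^+ 2 *: P [tuple u; v; w].

Definition cayley_calibration P Phi := forall x u v w,
  Phi [tuple x; u; v; w] = ip x (P [tuple u; v; w]).

Definition so : set 'End(W) :=
  [set xi | forall u v, ip (xi u) v = - ip u (xi v)].

(* [ω_ξ]; it is a 2-form when [ξ ∈ so(W)]. *)
Definition omega (xi : 'End(W)) (t : 2.-tuple W) : R :=
  ip (tnth t ord0) (xi (tnth t ord_max)).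

End TripleCrossProduct.

Section Stabilizer.
Variables (R : realType) (W : vectType R).

(* [G(W, Φ)]; an endomorphism of a finite-dimensional space is invertible when its
   kernel is trivial. *)
Definition stabilizer k (Phi : altform W k) : set 'End(W) :=
  [set g | lker g = 0%VS /\ pullback g Phi = Phi].

(* The Lie algebra of a closed subgroup of [GL(W)]. *)
Definition lie_algebra (G : set 'End(W)) : set 'End(W) :=
  [set xi | forall t : R, G (lfun_exp (t *: xi))].

Definition lie_derivative k (xi : 'End(W)) (f : altform W k) : altform W k :=
  vderive (fun t => pullback (lfun_exp (t *: xi)) f) 0.

(* [G] acts by pullback; the left action [f ↦ (g^-1)^* f] has the same invariant
   subspaces, as [G] is stable under inverses. *)
Definition invariant_subspace (G : set 'End(W)) k (U : {vspace altform W k}) :=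
  forall g f, G g -> f \in U -> pullback g f \in U.

Definition irreducible_representation (G : set 'End(W)) k (L : {vspace altform W k}) :=
  [/\ L != 0%VS, invariant_subspace G L &
      forall U : {vspace altform W k},
        (U <= L)%VS -> invariant_subspace G U -> U = 0%VS \/ U = L].

End Stabilizer.

Definition orthogonal_splitting (R : realType) (W : vectType R)
    (ip : {dot W for idfun}) k n (L : n.-tuple {vspace altform W k}) :=
  [/\ (\sum_(i < n) tnth L i)%VS = fullv, directv (\sum_(i < n) tnth L i) &
      forall i j f g, i != j -> f \in tnth L i -> g \in tnth L j ->
        form_ip ip f g = 0].

(* Main.v *)
From HB Require Import structures.
Require Import Defs.
From Stdlib Require Import ZArith.
From mathcomp Require Import all_boot all_order all_fingroup all_algebra.
From mathcomp Require Import all_classical all_reals all_analysis.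
From mathcomp Require Import ring lra zify ssrZ.
Import Order.TTheory GRing.Theory Num.Theory.
Import numFieldNormedType.Exports.

(** In a suitable orthonormal basis everything becomes arithmetic with integer matrices.

    A positive triple cross product admits a Cayley frame: an orthonormal basis
    [e_0, ..., e_7] in which [Phi] has fourteen nonzero coefficients, all equal to 1 or
    -1, as for the octonions ([cayley_frame]). In the coordinates of such a frame the
    operators [Phi ∧ .], [*], [ι(.)Phi] and [xi |-> L_xi Phi] have integer matrices. Each
    summand is the image of an integer multiple of a projection; that these projections
    are orthogonal idempotents with sum 1 and the right traces is decided by evaluation,
    and this gives the splittings and the dimensions ([splitting_by_check],
    [dim_prj_space]).

    On 2-forms, [T = *(Phi ∧ .)] is symmetric with [T^2 = 2 T + 3], so its eigenvalues are
    3 and -1, and [ι(u)ι(v)Phi = - T (u^* ∧ v^* )]; the descriptions of the two summands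
    follow ([L2_7_wedge], [L2_21_interior]). An endomorphism [xi] belongs to the Lie
    algebra iff [L_xi Phi = 0], because [exp(t xi)^* Phi] is then constant
    ([lie_algebraP]). The Gram matrix of [xi |-> L_xi Phi] shows that such a [xi] is skew
    ([lie0_so]), and that among skew [xi] the condition means [T omega_xi = - omega_xi]
    ([lie_omega_L2_21]). The same Gram matrix identifies the 7-dimensional space of
    4-forms ([mem_L4_7]).

    The stabilizer consists of isometries: for [w = ι(u)ι(v)Phi] one has
    [(Phi ∧ w) ∧ w = 6 |u ∧ v|^2 vol], so that [|u ∧ v|], and with it the metric, is
    determined by [Phi] ([gram_interior2], [stabilizer_isometry]). Every summand is thus
    described by data that the stabilizer preserves.

    Irreducibility rests on one observation ([irreducible_matrix]). Averaging over a
    group of sign changes and applying squares of a few elements of the Lie algebra gives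
    an operator which, restricted to the summand, has the form [v^T v]. An invariant
    subspace then either contains [v] or is orthogonal to it. As [v] generates the
    summand, the subspace is everything in the first case; in the second case its
    orthogonal complement contains [v], hence everything, and the subspace is zero. *)

Set Implicit Arguments.
Unset Strict Implicit.
Unset Printing Implicit Defensive.

Local Open Scope classical_set_scope.
Local Open Scope ring_scope.
Delimit Scope Z_scope with ZZ.

(** * Alternating forms evaluated on sequences *)

Section Evaluation.
Variables (R : realType) (W : vectType R).
Implicit Types (s : seq W) (x y : W).

(** Sequences instead of tuples: slots are then located by concatenation, with no
    dependent sizes to carry. Missing arguments are read as 0. *)
Definition ev k (f : altform W k) (s : seq W) : R :=
  f [tuple nth 0 s i | i < k].

Arguments ev : simpl never.

Lemma ev_tuple k (f : altform W k) (t : k.-tuple W) : ev f t = f t.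
Proof.
by congr (form_fun f _); apply: eq_from_tnth => i; rewrite tnth_mktuple (tnth_nth 0).
Qed.

Lemma ev_eqP k (f g : altform W k) :
  (forall s, size s = k -> ev f s = ev g s) -> f = g.
Proof. by move=> fg; apply/formP => t; rewrite -!ev_tuple fg ?size_tuple. Qed.

Let slotE k s1 s2 x (lt_s1 : (size s1 < k)%N) :
  [tuple nth 0 (s1 ++ x :: s2) i | i < k] =
  tset [tuple nth 0 (s1 ++ 0 :: s2) i | i < k] (Ordinal lt_s1) x.
Proof.
apply: eq_from_tnth => i; rewrite tnth_tset !tnth_mktuple !nth_cat -val_eqE /=.
have [//|lei] := ltnP i (size s1); first by move=> lt; rewrite ltn_eqF.
case: (i - size s1)%N (subnKC lei) => [|d] <- /=; first by rewrite addn0 eqxx.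
by rewrite -[X in _ == X]addn0 eqn_add2l.
Qed.

Lemma ev_slot k (f : altform W k) s1 s2 a x y : (size s1 < k)%N ->
  ev f (s1 ++ (a *: x + y) :: s2) =
  a * ev f (s1 ++ x :: s2) + ev f (s1 ++ y :: s2).
Proof.
move=> lt_s1; rewrite /ev (slotE s2 x lt_s1) (slotE s2 y lt_s1).
by rewrite (slotE s2 (a *: x + y) lt_s1) form_linear.
Qed.

Lemma ev_slotD k (f : altform W k) s1 s2 x y : (size s1 < k)%N ->
  ev f (s1 ++ (x + y) :: s2) = ev f (s1 ++ x :: s2) + ev f (s1 ++ y :: s2).
Proof. by move=> lt_s1; rewrite -[x]scale1r ev_slot // mul1r scale1r. Qed.

Lemma ev_slot0 k (f : altform W k) s1 s2 : (size s1 < k)%N ->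
  ev f (s1 ++ 0 :: s2) = 0.
Proof.
move=> lt_s1; have := ev_slot f s2 (-1) 0 0 lt_s1.
by rewrite scaler0 addr0 mulN1r addNr.
Qed.

Lemma ev_slotZ k (f : altform W k) s1 s2 a x : (size s1 < k)%N ->
  ev f (s1 ++ (a *: x) :: s2) = a * ev f (s1 ++ x :: s2).
Proof. by move=> lt_s1; rewrite -[a *: x]addr0 ev_slot // ev_slot0 // addr0. Qed.

Lemma ev_slot_sum k (f : altform W k) s1 s2 (I : Type) (r : seq I) (c : I -> R)
    (v : I -> W) : (size s1 < k)%N ->
  ev f (s1 ++ (\sum_(i <- r) c i *: v i) :: s2) =
  \sum_(i <- r) c i * ev f (s1 ++ v i :: s2).
Proof.
move=> lt_s1; elim: r => [|i r IHr]; first by rewrite !big_nil ev_slot0.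
by rewrite !big_cons ev_slot // IHr.
Qed.

Lemma ev_repeat k (f : altform W k) s1 s2 s3 x :
  (size s1 + size s2 + 1 < k)%N -> ev f (s1 ++ x :: s2 ++ x :: s3) = 0.
Proof.
move=> lt; have l1 : (size s1 < k)%N by lia.
have l2 : (size s1 + (size s2).+1 < k)%N by lia.
apply: (@form_alternating _ _ _ f (Ordinal l1) (Ordinal l2)).
  by rewrite -val_eqE /=; lia.
rewrite !tnth_mktuple /= !nth_cat ltnn subnn /=.
rewrite -[X in (_ < X)%N]addn0 ltn_add2l /= -[X in (_ - X)%N]addn0 subnDl subn0 /=.
by rewrite nth_cat ltnn subnn.
Qed.

Lemma ev_swap k (f : altform W k) s1 s2 x y : (size s1 + 1 < k)%N ->
  ev f (s1 ++ x :: y :: s2) = - ev f (s1 ++ y :: x :: s2).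
Proof.
move=> lt; have l1 : (size s1 < k)%N by lia.
have l2 z : (size (rcons s1 z) < k)%N by rewrite size_rcons; lia.
have rep z : ev f (s1 ++ z :: z :: s2) = 0.
  by apply: (@ev_repeat _ f s1 [::]) => /=; lia.
have D z t : ev f (s1 ++ z :: t + y :: s2) = ev f (s1 ++ z :: t :: s2) + ev f (s1 ++ z :: y :: s2).
  by rewrite -!(cat_rcons z) ev_slotD.
have := rep (x + y); rewrite ev_slotD // !D !rep addr0 add0r.
by move/eqP; rewrite addr_eq0 => /eqP.
Qed.

Lemma ev_front k (f : altform W k) s1 s2 x : (size s1 < k)%N ->
  ev f (s1 ++ x :: s2) = (-1) ^+ size s1 * ev f (x :: s1 ++ s2).
Proof.
elim/last_ind: s1 s2 => [|s1 y IH] s2; first by rewrite mul1r.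
rewrite size_rcons => lt; rewrite cat_rcons ev_swap ?addn1 //.
rewrite IH; last by lia.
by rewrite exprS mulN1r cat_rcons mulNr.
Qed.

Lemma ev_interior k u (f : altform W k.+1) s :
  ev (interior_product u f) s = ev f (u :: s).
Proof.
congr (form_fun f _); apply: eq_from_tnth => i; rewrite tnth_mktuple (tnth_nth 0) /=.
by case: i => -[|i] lt_i //=; rewrite (nth_map (Ordinal (lt_i : (i < k)%N))) ?size_enum_ord // nth_enum_ord.
Qed.

Lemma ev_pullback k (g : 'End(W)) (f : altform W k) s :
  ev (pullback g f) s = ev f (map g s).
Proof.
congr (form_fun f _); apply: eq_from_tnth => i.
rewrite tnth_map !tnth_mktuple; case: (ltnP i (size s)) => lt_i.
  by rewrite (nth_map 0).
by rewrite !nth_default ?size_map // linear0.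
Qed.

Lemma evD k (f g : altform W k) s : ev (f + g) s = ev f s + ev g s.
Proof. by []. Qed.

Lemma evZ k a (f : altform W k) s : ev (a *: f) s = a * ev f s.
Proof. by []. Qed.

Lemma evN k (f : altform W k) s : ev (- f) s = - ev f s.
Proof. exact: formNE. Qed.

Lemma ev_covector (ip : {dot W for idfun}) u x : ev (covector ip u) [:: x] = ip u x.
Proof. by rewrite /ev /= /covector_fun tnth_mktuple. Qed.

End Evaluation.
Arguments ev : simpl never.

(** * Exterior products as sums over shuffles *)

Section Shuffles.
Variable T : Type.

(** Each entry holds the parity of the shuffle ([true] if odd), the chosen
    subsequence of length [k] and its complement. *)
Fixpoint splits k (s : seq T) : seq (bool * seq T * seq T) :=
  if s isn't x :: s' then [seq (false, [::], [::]) | _ <- iota 0 (k == 0%N)]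
  else (if k is k'.+1 then [seq (q.1.1, x :: q.1.2, q.2) | q <- splits k' s'] else [::])
       ++ [seq (odd k (+) q.1.1, q.1.2, x :: q.2) | q <- splits k s'].

End Shuffles.

Lemma splits_map T T' (h : T -> T') k s :
  splits k (map h s) = [seq (q.1.1, map h q.1.2, map h q.2) | q <- splits k s].
Proof.
by elim: s k => [|x s IHs] [|k] //=; rewrite ?map_cat !IHs -!map_comp.
Qed.

Lemma splits_big T k (s : seq T) : (size s < k)%N -> splits k s = [::].
Proof. by elim: s k => [|x s IHs] [|k] //= lt; rewrite !IHs //; lia. Qed.

Section PermutationSums.
Variables (R : realType) (W : vectType R).

Definition perm_seq n (p : 'S_n) : seq nat := [seq nat_of_ord (p i) | i <- enum 'I_n].

Lemma size_perm_seq n (p : 'S_n) : size (perm_seq p) = n.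
Proof. by rewrite size_map size_enum_ord. Qed.

Lemma nth_perm_seq n (p : 'S_n) (i : 'I_n) : nth 0%N (perm_seq p) i = p i.
Proof. by rewrite (nth_map i) ?size_enum_ord // nth_ord_enum. Qed.

Definition insert_at (U : Type) i (x : U) s := take i s ++ x :: drop i s.

Lemma size_insert_at (U : Type) i (x : U) s : size (insert_at i x s) = (size s).+1.
Proof. by rewrite size_cat /= addnS -size_cat cat_take_drop. Qed.

Lemma take_insert_at (U : Type) i k (x : U) s : (i <= k)%N -> (k <= size s)%N ->
  take k.+1 (insert_at i x s) = insert_at i x (take k s).
Proof.
move=> leik leks; rewrite /insert_at take_cat size_takel ?(leq_trans leik) //.
by rewrite ltnNge (leqW leik) /= subSn //= take_drop subnK // take_takel.
Qed.

Lemma drop_insert_at (U : Type) i k (x : U) s : (i <= k)%N -> (k <= size s)%N ->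
  drop k.+1 (insert_at i x s) = drop k s.
Proof.
move=> leik leks; rewrite /insert_at drop_cat size_takel ?(leq_trans leik) //.
by rewrite ltnNge (leqW leik) /= subSn //= drop_drop subnK.
Qed.

Lemma take_insert_at_le (U : Type) i k (x : U) s : (k <= i)%N -> (i <= size s)%N ->
  take k (insert_at i x s) = take k s.
Proof.
by move=> leki leis; rewrite /insert_at takel_cat ?size_takel // take_takel.
Qed.

Lemma drop_insert_at_le (U : Type) i k (x : U) s : (k <= i)%N -> (i <= size s)%N ->
  drop k (insert_at i x s) = insert_at (i - k) x (drop k s).
Proof.
move=> leki leis; rewrite /insert_at drop_drop subnK // drop_cat size_takel //.
have [ltki|leik] := ltnP k i; first by rewrite take_drop subnK.
by have -> : i = k by [lia]; rewrite subnn take0.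
Qed.

Lemma map_insert_at (U V : Type) (h : U -> V) i x s :
  map h (insert_at i x s) = insert_at i (h x) (map h s).
Proof. by rewrite /insert_at map_cat map_take map_cons map_drop. Qed.

Lemma perm_seq_lift n (i : 'I_n.+1) (p : 'S_n) :
  perm_seq (lift_perm i ord0 p) = insert_at i 0%N (map S (perm_seq p)).
Proof.
have lei : (i <= n)%N by rewrite -ltnS.
have sz : size (map S (perm_seq p)) = n by rewrite size_map size_perm_seq.
apply: (@eq_from_nth _ 0%N); first by rewrite size_insert_at sz size_perm_seq.
move=> j; rewrite size_perm_seq => ltj.
rewrite -[j]/(nat_of_ord (Ordinal ltj)) nth_perm_seq; set jo := Ordinal ltj.
rewrite nth_cat size_takel ?sz //; case: (unliftP i jo) => [j'|] jE; last first.
  by rewrite jE lift_perm_id ltnn subnn.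
rewrite jE lift_perm_lift /= /bump /= add1n.
have [lij|lij] := leqP i j'.
  rewrite add1n ltnNge (leq_trans lij) //= subSn //= nth_drop subnKC //.
  by rewrite (nth_map 0%N) ?size_perm_seq // nth_perm_seq.
by rewrite add0n lij nth_take // (nth_map 0%N) ?size_perm_seq // nth_perm_seq.
Qed.

Definition perm_sum n k (F G : seq W -> R) (s : seq W) : R :=
  \sum_(p : 'S_n) (-1) ^+ p *
    (F [seq nth 0 s i | i <- take k (perm_seq p)] *
     G [seq nth 0 s i | i <- drop k (perm_seq p)]).

Definition front_sign m (F : seq W -> R) := forall i x s,
  size s = m -> (i <= m)%N -> F (insert_at i x s) = (-1) ^+ i * F (x :: s).

Lemma lift_perm_bij n :
  bijective (fun ip : 'I_n.+1 * 'S_n => lift_perm ip.1 ord0 ip.2).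
Proof.
apply: inj_card_bij; last first.
  by rewrite card_prod !card_Sn card_ord factS.
move=> [i p] [j q] /= /permP E; have ij : i = j.
  apply: (@perm_inj _ (lift_perm j ord0 q)).
  by rewrite -E !lift_perm_id.
subst j; congr pair; apply/permP => k.
by have := E (lift i k); rewrite !lift_perm_lift => /lift_inj.
Qed.

(** Peeling off the argument [x]: permutations are classified by the slot [i] that
    receives it. Alternation makes the contribution depend only on whether [i] lies
    in the first block of [k] slots or in the second. *)
Lemma perm_sum_cons n k (F G : seq W -> R) x s : (k <= n.+1)%N ->
  (forall k', k = k'.+1 -> front_sign k' F) ->
  (forall m, n.+1 = (k + m.+1)%N -> front_sign m G) ->
  perm_sum n.+1 k F G (x :: s) =
    k%:R * perm_sum n k.-1 (F \o cons x) G s +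
    (n.+1 - k)%:R * ((-1) ^+ k * perm_sum n k F (G \o cons x) s).
Proof.
move=> lek sF sG.
rewrite {1}/perm_sum (reindex _ (onW_bij _ (lift_perm_bij n))) /=.
rewrite -(pair_big xpredT xpredT (fun i p => (-1) ^+ lift_perm i ord0 p *
    (F [seq nth 0 (x :: s) j | j <- take k (perm_seq (lift_perm i ord0 p))] *
     G [seq nth 0 (x :: s) j | j <- drop k (perm_seq (lift_perm i ord0 p))]))) /=.
have nthS (l : seq nat) : [seq nth 0 (x :: s) j | j <- map S l] = [seq nth 0 s j | j <- l].
  by rewrite -map_comp.
have sgnE (i : 'I_n.+1) (p : 'S_n) :
    (-1) ^+ lift_perm i ord0 p = (-1) ^+ i * (-1) ^+ p :> R.
  by rewrite odd_lift_perm /= addbF signr_addb signr_odd.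
have szl (p : 'S_n) := size_perm_seq p.
have szS (p : 'S_n) : size [seq j.+1 | j <- perm_seq p] = n by rewrite size_map.
rewrite (eq_bigr (fun i : 'I_n.+1 =>
    if (i < k)%N then perm_sum n k.-1 (F \o cons x) G s
    else (-1) ^+ k * perm_sum n k F (G \o cons x) s)); last first.
  move=> i _; have lein : (i <= n)%N by rewrite -ltnS.
  have [ltik|leki] := ltnP i k.
  - apply: eq_bigr => p _.
    case: k lek sF {sG} ltik => // k lek sF ltik; rewrite sgnE perm_seq_lift.
    rewrite take_insert_at ?drop_insert_at ?szS // map_insert_at /=.
    rewrite -map_take -map_drop !nthS (sF k) ?size_map ?size_takel ?szl //.
    by rewrite !mulrA -[_ * _ * (-1) ^+ i]mulrAC -exprMn mulrNN mulr1 expr1n mul1r.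
  - rewrite mulr_sumr; apply: eq_bigr => p _; rewrite sgnE perm_seq_lift.
    rewrite take_insert_at_le ?drop_insert_at_le ?szS // map_insert_at /=.
    rewrite -map_take -map_drop !nthS.
    rewrite (sG (n - k)%N) ?size_map ?size_drop ?szl //; [|lia|lia].
    have -> : (-1) ^+ i = (-1) ^+ k * (-1) ^+ (i - k) :> R.
      by rewrite -exprD subnKC.
    set u := (-1) ^+ (i - k); have uu : u * u = 1.
      by rewrite -exprMn mulrNN mulr1 expr1n.
    set v := (-1) ^+ k; set w := (-1) ^+ p; set y := F _; set z := G _.
    clearbody u v w y z; transitivity (v * (w * (y * z)) * (u * u)); first ring.
    by rewrite uu mulr1.
set a := perm_sum n k.-1 _ _ _; set b := _ * perm_sum _ _ _ _ _.
rewrite -(big_mkord xpredT (fun i => if (i < k)%N then a else b)).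
rewrite (big_cat_nat _ lek) //= !big_nat.
rewrite (eq_bigr (fun _ => a)) => [|i /andP[_ ->]//].
rewrite [X in _ + X](eq_bigr (fun _ => b)) => [|i /andP[]]; last first.
  by rewrite leqNgt => /negbTE ->.
by rewrite -!big_nat !sumr_const_nat subn0 !mulr_natl.
Qed.

Definition shuffle_sum k (F G : seq W -> R) (s : seq W) : R :=
  \sum_(q <- splits k s) (-1) ^+ q.1.1 * (F q.1.2 * G q.2).

Lemma shuffle_sum_cons k F G x s :
  shuffle_sum k F G (x :: s) =
    (0 < k)%N%:R * shuffle_sum k.-1 (F \o cons x) G s +
    (-1) ^+ k * shuffle_sum k F (G \o cons x) s.
Proof.
rewrite /shuffle_sum /= big_cat /=; congr (_ + _); last first.
  rewrite big_map mulr_sumr; apply: eq_bigr => q _ /=.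
  by rewrite signr_addb signr_odd !mulrA.
by case: k => [|k]; rewrite ?big_nil ?mul0r // big_map mul1r.
Qed.

Lemma eq_shuffle_sum k F F' G G' s : F =1 F' -> G =1 G' ->
  shuffle_sum k F G s = shuffle_sum k F' G' s.
Proof. by move=> FF GG; apply: eq_bigr => q _; rewrite FF GG. Qed.

Lemma eq_perm_sum n k F F' G G' s : F =1 F' -> G =1 G' ->
  @perm_sum n k F G s = perm_sum n k F' G' s.
Proof. by move=> FF GG; apply: eq_bigr => q _; rewrite FF GG. Qed.

Lemma front_sign_ev k (f : altform W k) m : k = m.+1 -> front_sign m (ev f).
Proof.
move=> kE i x s szs lei; rewrite /insert_at ev_front ?size_takel ?szs ?kE //.
by rewrite cat_take_drop.
Qed.

(** Both sides satisfy the same recursion in the first argument, which replaces [f]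
    or [g] by an interior product. *)
Lemma perm_sum_splits n k m (f : altform W k) (g : altform W m) s :
  n = (k + m)%N -> size s = n ->
  perm_sum n k (ev f) (ev g) s = (k`! * m`!)%:R * shuffle_sum k (ev f) (ev g) s.
Proof.
elim: n k m f g s => [|n IHn] k m f g s nE szs.
  have [k0 m0] : k = 0%N /\ m = 0%N by lia.
  subst k m; case: s szs => // _; rewrite /shuffle_sum /= big_seq1 /perm_sum.
  rewrite (big_pred1 1%g) => [|p]; last first.
    by apply/esym/eqP/permP => -[].
  have -> : perm_seq (1%g : 'S_0) = [::] by apply: size0nil; rewrite size_perm_seq.
  by rewrite odd_perm1 /= !mul1r.
case: s szs => // x s [szs]; rewrite perm_sum_cons; first last.
- by move=> m' m'E; apply: front_sign_ev; lia.
- by move=> k' kE; apply: front_sign_ev.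
- by lia.
rewrite shuffle_sum_cons mulrDr; congr (_ + _).
- case: k f nE => [|k] f nE; first by rewrite !mul0r mulr0.
  have fE : ev f \o cons x =1 ev (interior_product x f) by move=> t; rewrite ev_interior.
  rewrite (eq_perm_sum n _ s fE (frefl _)) (eq_shuffle_sum _ s fE (frefl _)) /=.
  rewrite (IHn k m) //; last by lia.
  by rewrite mul1r mulrA -natrM factS mulnA.
- have -> : (n.+1 - k)%N = m by lia.
  case: m g nE => [|m] g nE.
    rewrite mul0r /shuffle_sum splits_big; last by lia.
    by rewrite big_nil !mulr0.
  have gE : ev g \o cons x =1 ev (interior_product x g) by move=> t; rewrite ev_interior.
  rewrite (eq_perm_sum n _ s (frefl _) gE) (eq_shuffle_sum _ s (frefl _) gE).
  rewrite (IHn k m) //; last by lia.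
  by rewrite factS mulnCA [in RHS]natrM -!mulrA; congr (_ * _); rewrite mulrCA.
Qed.

(** The normalised sum over all permutations collapses to a sum over shuffles;
    coefficients of exterior products are computed in this form. *)
Lemma ev_wedge k m (f : altform W k) (g : altform W m) s : size s = (k + m)%N ->
  ev (wedge f g) s = shuffle_sum k (ev f) (ev g) s.
Proof.
move=> szs; apply: (@mulfI _ (k`! * m`!)%:R).
  by rewrite pnatr_eq0 -lt0n muln_gt0 !fact_gt0.
rewrite -(perm_sum_splits _ _ erefl szs) {1}/ev /= /wedge_fun mulrA mulfV ?mul1r; last first.
  by rewrite pnatr_eq0 -lt0n muln_gt0 !fact_gt0.
apply: eq_bigr => p _; congr (_ * (_ * _)); congr (form_fun _ _); apply: eq_from_tnth => i;
  rewrite !tnth_mktuple.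
- rewrite (nth_map 0%N) ?size_takel ?size_perm_seq ?leq_addr // nth_take //.
  by rewrite -[nat_of_ord i]/(nat_of_ord (lshift m i)) nth_perm_seq.
- rewrite (nth_map 0%N) ?size_drop ?size_perm_seq ?addKn // nth_drop.
  by rewrite -[(k + i)%N]/(nat_of_ord (rshift k i)) nth_perm_seq.
Qed.

End PermutationSums.

(** * The inner product of forms *)

Section Words.
Variable T : Type.

Fixpoint words k (A : seq T) : seq (seq T) :=
  if k is k'.+1 then [seq x :: w | x <- A, w <- words k' A] else [:: [::]].

Fixpoint combs (A : seq T) k : seq (seq T) :=
  if k is k'.+1 then
    if A is x :: A' then map (cons x) (combs A' k') ++ combs A' k else [::]
  else [:: [::]].

Lemma combs_splits (A : seq T) k : [seq q.1.2 | q <- splits k A] = combs A k.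
Proof.
elim: A k => [|x A IH] [|k] //=; first by rewrite -map_comp [LHS]IH; case: A {IH}.
by rewrite map_cat -!map_comp -!IH -!map_comp.
Qed.

End Words.

Lemma words_map T T' (h : T -> T') k A : words k (map h A) = map (map h) (words k A).
Proof.
by elim: k => //= k ->; rewrite map_allpairs allpairs_mapl allpairs_mapr.
Qed.

Lemma combs_map T T' (h : T -> T') k A : combs (map h A) k = map (map h) (combs A k).
Proof.
by elim: A k => [|x A IH] [|k] //=; rewrite !IH map_cat -!map_comp.
Qed.

Lemma mem_words (T : eqType) k (A : seq T) w :
  (w \in words k A) = (size w == k) && all (mem A) w.
Proof.
elim: k w => [|k IH] [|x w] //=.
- by apply/allpairsP => -[[y v] [_ _]].
rewrite eqSS.
apply/allpairsP/idP => [[[y v] /= [yA vA [-> ->]]]|].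
  by move: vA; rewrite IH => /andP[-> ->]; rewrite yA.
by case/and3P=> szw xA wA; exists (x, w); split => //=; rewrite IH szw.
Qed.

Lemma words_uniq (T : eqType) k (A : seq T) : uniq A -> uniq (words k A).
Proof.
move=> uA; elim: k => //= k IH; apply: allpairs_uniq => //.
by move=> [x v] [y w] _ _ /= [-> ->].
Qed.

Lemma size_combs T (A : seq T) k : all (fun w => size w == k) (combs A k).
Proof.
elim: A k => [|x A IH] [|k] //=; rewrite all_cat IH andbT all_map.
by apply: sub_all (IH k) => w /=; rewrite eqSS.
Qed.

Section InnerProductForms.
Variables (R : realType) (W : vectType R) (ip : {dot W for idfun}).

Lemma ipC u v : ip u v = ip v u.
Proof. by rewrite hermC expr0 mul1r. Qed.

Lemma ip_gt0 u : u != 0 -> 0 < ip u u.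
Proof. exact: neq0_dnorm_gt0. Qed.

Lemma ip_ge0 u : 0 <= ip u u.
Proof.
by have [->|/ip_gt0/ltW//] := eqVneq u 0; rewrite linear0l.
Qed.

Lemma ip_eq0 u : ip u u = 0 -> u = 0.
Proof.
by move=> u0; apply/eqP/negPn/negP => /ip_gt0; rewrite u0 ltxx.
Qed.

Lemma ipDl u v w : ip (u + v) w = ip u w + ip v w.
Proof. exact: linearDl. Qed.
Lemma ipDr u v w : ip u (v + w) = ip u v + ip u w.
Proof. exact: linearDr. Qed.
Lemma ipZl a u w : ip (a *: u) w = a * ip u w.
Proof. exact: linearZl_LR. Qed.
Lemma ipZr a u w : ip u (a *: w) = a * ip u w.
Proof. exact: linearZr_LR. Qed.
Lemma ipNl u w : ip (- u) w = - ip u w.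
Proof. exact: linearNl. Qed.
Lemma ipNr u w : ip u (- w) = - ip u w.
Proof. exact: linearNr. Qed.
Lemma ip0r u : ip u 0 = 0. Proof. exact: linear0r. Qed.
Lemma ip_suml I (r : seq I) (F : I -> W) v : ip (\sum_(i <- r) F i) v = \sum_(i <- r) ip (F i) v.
Proof. exact: linear_sumlz. Qed.
Lemma ip_sumr I (r : seq I) (F : I -> W) v : ip v (\sum_(i <- r) F i) = \sum_(i <- r) ip v (F i).
Proof. exact: linear_sumr. Qed.

Lemma ip_inj u v : (forall w, ip u w = ip v w) -> u = v.
Proof.
by move=> uv; apply/subr0_eq/ip_eq0; rewrite ipDl ipNl uv subrr.
Qed.

Definition onb (e : seq W) := size e = \dim {:W} /\
  forall i j, (i < size e)%N -> (j < size e)%N -> ip e`_i e`_j = (i == j)%:R.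

Lemma onb_expand e x : onb e -> x = \sum_(y <- e) ip y x *: y.
Proof.
move=> [sze eE].
have free_e : free e.
  rewrite -[e]/(val (in_tuple e)); apply/freeP => c c0 i.
  have := congr1 (ip e`_i) c0; rewrite ip0r ip_sumr (bigD1 i) //= big1 => [|j ji].
    by rewrite ipZr eE // eqxx mulr1 addr0.
  rewrite ipZr eE // (_ : _ == _ = false) ?mulr0 //.
  by rewrite eq_sym; apply/negbTE.
have bas : basis_of {:W} (in_tuple e).
  by rewrite basisEfree free_e subvf /= sze leqnn.
rewrite {1}(coord_basis bas (memvf x)) (big_nth 0) big_mkord.
apply: eq_bigr => i _; congr (_ *: _).
rewrite {2}(coord_basis bas (memvf x)) ip_sumr (bigD1 i) //= big1 => [|j ji].
  by rewrite ipZr eE // eqxx mulr1 addr0.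
rewrite ipZr eE // (_ : _ == _ = false) ?mulr0 //.
by rewrite eq_sym; apply/negbTE.
Qed.

Lemma onb_orthonormal_basis : onb (orthonormal_basis ip).
Proof.
split; first by rewrite size_tuple.
have /andP[/allP e1] := orthonormal_basisP ip.
set e := tval _ => epo.
have epo' : forall (s : seq W) (a b : nat), pair_ortho_rec ip s ->
    (a < b < size s)%N -> ip s`_a s`_b = 0.
  elim=> [|x s IHs] [|a] [|b] //=; rewrite ?andbF ?ltn0 //.
  - by move=> /andP[+ _] bs; rewrite /ortho_rec /= andbT => /allP/(_ _ (mem_nth 0 bs))/eqP.
  - by move=> /andP[_ /IHs] /[apply].
move=> i j li lj; have [<-|] := eqVneq i j.
  by have /= := e1 _ (mem_nth 0 li) => /eqP.
rewrite neq_ltn => /orP[ij|ji]; first by apply: epo' => //; rewrite ij.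
by rewrite ipC; apply: epo' => //; rewrite ji.
Qed.

(** The trace of a bilinear map is the same in all orthonormal bases. Applied slot
    by slot, this frees [form_ip] from the basis chosen to define it. *)
Lemma onb_trace e b (h : W -> W -> R) : onb e -> onb b ->
  (forall y, linear_for *%R (h^~ y)) -> (forall x, linear_for *%R (h x)) ->
  \sum_(x <- b) h x x = \sum_(x <- e) h x x.
Proof.
move=> eO bO hl hr.
have h0l y : h 0 y = 0 by have := hl y (-1) 0 0; rewrite scaler0 addr0 mulN1r addNr.
have h0r y : h y 0 = 0 by have := hr y (-1) 0 0; rewrite scaler0 addr0 mulN1r addNr.
have hsl (c : W -> R) y s : h (\sum_(z <- s) c z *: z) y = \sum_(z <- s) c z * h z y.
  by elim: s => [|z s IH]; rewrite ?big_nil // !big_cons hl IH.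
have hsr (c : W -> R) y s : h y (\sum_(z <- s) c z *: z) = \sum_(z <- s) c z * h y z.
  by elim: s => [|z s IH]; rewrite ?big_nil // !big_cons hr IH.
have hE x : h x x = \sum_(y <- e) \sum_(z <- e) ip y x * ip z x * h y z.
  rewrite {1}(onb_expand x eO) hsl; apply: eq_bigr => y _.
  rewrite [X in h y X](onb_expand x eO) hsr mulr_sumr; apply: eq_bigr => z _.
  by rewrite mulrA.
under eq_bigr do rewrite hE.
rewrite exchange_big /=; apply: eq_bigr => y _.
rewrite exchange_big /= [X in h y X](onb_expand y eO) hsr; apply: eq_bigr => z _.
rewrite -mulr_suml; congr (_ * _).
rewrite [X in ip z X](onb_expand y bO) ip_sumr; apply: eq_bigr => x _.
by rewrite ipZr [ip x y]ipC [ip z x]ipC ipC.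
Qed.

Definition word_sum k (f g : altform W k) (A : seq W) : R :=
  \sum_(w <- words k A) ev f w * ev g w.

Lemma word_sumS k (f g : altform W k.+1) A :
  word_sum f g A = \sum_(x <- A) word_sum (interior_product x f) (interior_product x g) A.
Proof.
rewrite /word_sum /= big_allpairs_dep /=; apply: eq_bigr => x _.
by apply: eq_bigr => w _; rewrite !ev_interior.
Qed.

Lemma interior_linear k (f : altform W k.+1) a x y :
  interior_product (a *: x + y) f = a *: interior_product x f + interior_product y f.
Proof.
apply: ev_eqP => s szs; rewrite evD evZ !ev_interior.
exact: (@ev_slot _ _ _ f [::]).
Qed.

Lemma word_sum_linear k (g : altform W k) A : linear_for *%R (fun f => word_sum f g A).
Proof.
move=> a f h; rewrite /word_sum mulr_sumr -big_split /=; apply: eq_bigr => w _.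
by rewrite evD evZ mulrDl mulrA.
Qed.

Lemma word_sumC k (f g : altform W k) A : word_sum f g A = word_sum g f A.
Proof. by apply: eq_bigr => w _; rewrite mulrC. Qed.

Lemma word_sum_onb k (f g : altform W k) e b : onb e -> onb b ->
  word_sum f g b = word_sum f g e.
Proof.
move=> eO bO; elim: k f g => [|k IH] f g; first by rewrite /word_sum.
rewrite !word_sumS; under eq_bigr do rewrite IH.
apply: (@onb_trace e b (fun x y =>
    word_sum (interior_product x f) (interior_product y g) e)) => // [y|x] a u v.
  by rewrite interior_linear; apply: word_sum_linear.
by rewrite interior_linear ![word_sum (interior_product x f) _ _]word_sumC;
  apply: word_sum_linear.
Qed.

Lemma interior_swap k (f : altform W k.+2) x y :
  interior_product x (interior_product y f) = - interior_product y (interior_product x f).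
Proof.
by apply: ev_eqP => s _; rewrite evN !ev_interior; apply: (@ev_swap _ _ _ f [::]).
Qed.

Lemma interior_diag k (f : altform W k.+2) x :
  interior_product x (interior_product x f) = 0.
Proof.
by apply: ev_eqP => s _; rewrite !ev_interior; apply: (@ev_repeat _ _ _ f [::] [::]).
Qed.

Lemma word_sum0 k (g : altform W k) A : word_sum 0 g A = 0.
Proof. by apply: big1 => w _; rewrite mul0r. Qed.

Lemma word_sumNN k (f g : altform W k) A : word_sum (- f) (- g) A = word_sum f g A.
Proof. by apply: eq_bigr => w _; rewrite !evN mulrNN. Qed.

(** A word on which [f] does not vanish contains [x] at most once, in one of [k.+1]
    positions. *)
Lemma word_sum_cons k (f g : altform W k.+1) x A :
  word_sum f g (x :: A) =
  word_sum f g A + k.+1%:R * word_sum (interior_product x f) (interior_product x g) A.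
Proof.
elim: k f g => [|k IH] f g.
  by rewrite !word_sumS big_cons addrC /word_sum /= !big_seq1 mul1r; congr (_ + _);
    apply: eq_bigr => y _; rewrite !big_seq1.
rewrite !word_sumS big_cons !IH !interior_diag word_sum0 mulr0 addr0.
under eq_bigr => y _.
  rewrite IH (interior_swap f) (interior_swap g) word_sumNN; over.
rewrite big_split /= -mulr_sumr -word_sumS -[in RHS]word_sumS addrCA; congr (_ + _).
by rewrite -[in RHS]natr1 mulrDl mul1r addrC word_sumS.
Qed.

(** Each set of letters occurs once for every ordering of it, and the two signs
    cancel in the product. *)
Lemma word_sum_combs k (f g : altform W k) A :
  word_sum f g A = k`!%:R * \sum_(w <- combs A k) ev f w * ev g w.
Proof.
elim: A k f g => [|x A IH] [|k] f g.
- by rewrite mul1r.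
- by rewrite word_sumS /= !big_nil mulr0.
- by rewrite mul1r /word_sum.
rewrite word_sum_cons IH IH /= big_cat big_map mulrDr addrC; congr (_ + _).
rewrite factS natrM -mulrA; congr (_ * (_ * _)).
by apply: eq_bigr => w _; rewrite !ev_interior.
Qed.

Lemma sum_ffun_words k n (F : seq 'I_n -> R) :
  \sum_(s : {ffun 'I_k -> 'I_n}) F (codom s) = \sum_(w <- words k (enum 'I_n)) F w.
Proof.
rewrite -(big_map (fun s : {ffun 'I_k -> 'I_n} => codom s) xpredT F) /=.
have cE (t : k.-tuple 'I_n) : codom [ffun i => tnth t i] = t.
  by rewrite -[RHS](map_tnth_enum t) codomE; apply: eq_map => i; rewrite ffunE.
apply: perm_big; apply: uniq_perm.
- rewrite map_inj_uniq ?index_enum_uniq // => s t st; apply/ffunP => i.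
  have nthc (u : {ffun 'I_k -> 'I_n}) : nth (s i) (codom u) i = u i.
    by rewrite codomE (nth_map i) ?size_enum_ord // nth_ord_enum.
  by rewrite -nthc -[RHS]nthc st.
- exact/words_uniq/enum_uniq.
move=> w; rewrite mem_words; apply/mapP/andP => [[s _ ->]|[szw _]].
  rewrite codomE size_map size_enum_ord eqxx; split => //.
  by apply/allP => i _ /=; rewrite mem_enum.
by exists [ffun i => tnth (Tuple szw) i]; rewrite ?mem_index_enum // cE.
Qed.

Lemma form_ipE k (f g : altform W k) e : onb e ->
  form_ip ip f g = \sum_(w <- combs e k) ev f w * ev g w.
Proof.
move=> eO; apply: (@mulfI _ k`!%:R); first by rewrite pnatr_eq0 -lt0n fact_gt0.
rewrite -word_sum_combs (word_sum_onb f g (onb_orthonormal_basis) eO).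
rewrite /form_ip mulrA mulfV ?mul1r ?pnatr_eq0 -?lt0n ?fact_gt0 //.
set b := orthonormal_basis ip.
pose F (s : seq 'I_(\dim {:W})) := ev f (map (tnth b) s) * ev g (map (tnth b) s).
transitivity (\sum_(s : {ffun 'I_k -> 'I_(\dim {:W})}) F (codom s)).
  apply: eq_bigr => s _; rewrite /F -map_comp.
  by rewrite -2!(ev_tuple _ (mktuple _)) /=.
rewrite sum_ffun_words /word_sum.
by rewrite -[tval b in RHS](map_tnth_enum b) words_map big_map.
Qed.

End InnerProductForms.

(** * Coordinates in an orthonormal frame *)

(** Coefficients are binary integers, so that identities between large matrices can
    be decided by evaluation; this is their image in a ring. *)
Definition zr (R : pzRingType) (z : Z) : R := (int_of_Z z)%:~R.

Section Zr.
Variable R : pzRingType.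
Local Notation zr := (zr R).
Lemma zr1 : zr 1%ZZ = 1. Proof. by []. Qed.
Lemma zrD a b : zr (Z.add a b) = zr a + zr b.
Proof. by rewrite /zr -intrD; congr (_%:~R); exact: (rmorphD int_of_Z). Qed.
Lemma zrM a b : zr (Z.mul a b) = zr a * zr b.
Proof. by rewrite /zr -intrM; congr (_%:~R); exact: (rmorphM int_of_Z). Qed.
Lemma zrN a : zr (Z.opp a) = - zr a.
Proof. by rewrite /zr -intrN; congr (_%:~R); exact: (rmorphN int_of_Z). Qed.
End Zr.

Lemma zr_eq0 (R : numDomainType) a : (zr R a == 0) = Z.eqb a 0.
Proof. by rewrite /zr intr_eq0; case: a => // p; rewrite /= -(Pnat.Pos2Nat.id p); case: (Pos.to_nat p) (Pnat.Pos2Nat.is_pos p) => //; lia. Qed.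

Lemma mem_combs (T : eqType) (A : seq T) k w :
  (w \in combs A k) = subseq w A && (size w == k).
Proof.
elim: A k w => [|x A IH] [|k] w //=.
- by rewrite inE; case: w.
- by case: w.
- by rewrite inE; case: w => // y w; rewrite andbF.
rewrite mem_cat IH; case: w => [|y w] /=.
  by rewrite sub0seq orbF; apply/mapP => -[].
have [->|yx] := eqVneq y x; last first.
  by case: mapP => [[v _ [/eqP]]|_ //]; rewrite (negPf yx).
rewrite mem_map => [|u v []//]; rewrite IH eqSS.
apply/orP/idP => [[//|/andP[/cons_subseq -> ->]]//|]; by left.
Qed.

Lemma combs_uniq (T : eqType) (A : seq T) k : uniq A -> uniq (combs A k).
Proof.
elim: A k => [|x A IH] [|k] //= /andP[xA uA].
rewrite cat_uniq map_inj_uniq => [|u v []//]; rewrite !IH //= andbT.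
apply/hasPn => w; rewrite mem_combs => /andP[/mem_subseq wA _].
by apply/mapP => -[v _ wE]; case/negP: xA; apply: wA; rewrite wE mem_head.
Qed.

Lemma combs_full T (A : seq T) : combs A (size A) = [:: A].
Proof.
have none (B : seq T) k : (size B < k)%N -> combs B k = [::].
  by elim: B k => [|x B IH] [|k] //= lt; rewrite !IH //; lia.
by elim: A => //= x A ->; rewrite none.
Qed.

Definition idx n k := combs (iota 0 n) k.

Lemma mem_idx n k s : (s \in idx n k) = [&& sorted ltn s, all (ltn^~ n) s & size s == k].
Proof.
rewrite mem_combs andbA; congr (_ && _); apply/idP/andP => [sub|[srt /allP lt]].
  split; first exact: (subseq_sorted ltn_trans sub (iota_ltn_sorted 0 n)).
  by apply/allP => i /(mem_subseq sub); rewrite mem_iota.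
suff -> : s = [seq i <- iota 0 n | i \in s] by apply: filter_subseq.
apply: (irr_sorted_eq ltn_trans ltnn) => //.
  by apply: sorted_filter; [exact: ltn_trans | exact: iota_ltn_sorted].
move=> i; rewrite mem_filter mem_iota /= add0n.
by apply/idP/andP => [si|[]//]; split => //; apply: lt.
Qed.

Lemma filter_map_uniq (T U : eqType) (h : T -> U) s q : uniq (map h s) -> q \in s ->
  [seq r <- s | h r == h q] = [:: q].
Proof.
move=> us qs.
have : uniq [seq h r | r <- [seq r <- s | h r == h q]].
  exact: (subseq_uniq (map_subseq _ (filter_subseq _ _))).
have : all (fun r => h r == h q) [seq r <- s | h r == h q] by exact: filter_all.
have : q \in [seq r <- s | h r == h q] by rewrite mem_filter eqxx.
case: [seq _ <- _ | _] => [//|q1 [|q2 l]] /=; first by rewrite inE => /eqP ->.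
by move=> _ /and3P[/eqP -> /eqP -> _]; rewrite inE eqxx.
Qed.

Fixpoint sort_in (x : nat) (s : seq nat) : Z * seq nat :=
  if s is y :: s' then
    if (x < y)%N then (1%ZZ, x :: s)
    else if x == y then (0%ZZ, s)
    else let: (c, t) := sort_in x s' in (Z.opp c, y :: t)
  else (1%ZZ, [:: x]).

(** Insertion sort that records the sign of the permutation; the sign is [0] if an
    index is repeated. *)
Fixpoint sign_sort (s : seq nat) : Z * seq nat :=
  if s is x :: s' then
    let: (c, t) := sign_sort s' in let: (d, u) := sort_in x t in (Z.mul c d, u)
  else (1%ZZ, [::]).

Lemma size_sort_in x s : (size (sort_in x s).2 <= (size s).+1)%N.
Proof.
elim: s => //= y s; case: ltngtP => //= _; case: (sort_in x s) => c t /=; by rewrite ltnS.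
Qed.

Lemma size_sign_sort s : (size (sign_sort s).2 <= size s)%N.
Proof.
elim: s => //= x s; case: (sign_sort s) => c t /= le.
by case: (sort_in x t) (size_sort_in x t) => d u /= /leq_trans; apply.
Qed.

Lemma sort_in_sorted x s : sorted ltn s -> (sort_in x s).1 != 0%ZZ ->
  sorted ltn (sort_in x s).2 /\ perm_eq (sort_in x s).2 (x :: s).
Proof.
elim: s => //= y s IH pth; case: ltngtP => [ltxy|ltyx|->] //=; first by rewrite ltxy pth.
case E : (sort_in x s) => [c t] /= c0.
have [] := IH (path_sorted pth); first by rewrite E /=; apply: contraNneq c0 => ->.
rewrite E /= => srt pt; split; last first.
  by rewrite perm_sym (perm_catCA [:: x] [:: y] s) /= perm_cons perm_sym.
rewrite path_sortedE ?srt ?andbT; last exact: ltn_trans.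
apply/allP => z; rewrite (perm_mem pt) inE => /orP[/eqP -> //|zs].
by move: pth; rewrite path_sortedE => [/andP[/allP/(_ _ zs)]|]; last exact: ltn_trans.
Qed.

Lemma sign_sort_sorted s : (sign_sort s).1 != 0%ZZ ->
  sorted ltn (sign_sort s).2 /\ perm_eq (sign_sort s).2 s.
Proof.
elim: s => //= x s; case: (sign_sort s) => c t /= IH.
case E : (sort_in x t) => [d u] /= cd.
have [srt pt] : sorted ltn t /\ perm_eq t s.
  by apply: IH; apply: contraNneq cd => ->.
have [] := sort_in_sorted (x := x) srt.
  by rewrite E /=; apply: contraNneq cd => ->; rewrite Z.mul_0_r.
rewrite E /= => su pu; split => //; apply: perm_trans pu _.
by rewrite perm_cons.
Qed.

Lemma sign_sort_idx n k s : size s = k -> all (ltn^~ n) s ->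
  (sign_sort s).1 != 0%ZZ -> (sign_sort s).2 \in idx n k.
Proof.
move=> szs lts /sign_sort_sorted[srt pt].
by rewrite mem_idx srt (perm_all _ pt) lts (perm_size pt) szs eqxx.
Qed.

Definition normalize (l : seq (Z * seq nat)) : seq (Z * seq nat) :=
  [seq let: (c, t) := sign_sort q.2 in (Z.mul q.1 c, t) | q <- l].

Definition coef (l : seq (Z * seq nat)) (J : seq nat) : Z :=
  foldr (fun q acc => if q.2 == J then Z.add q.1 acc else acc) 0%ZZ l.

Section Frame.
Variables (R : realType) (W : vectType R) (ip : {dot W for idfun}) (e : seq W).
Hypothesis eO : onb ip e.
Local Notation zr := (zr R).

(** Frame coefficient of [f] at the multi-index [I], which need not be increasing. *)
Definition fc k (f : altform W k) (I : seq nat) : R := ev f [seq e`_i | i <- I].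

Lemma fc_sort_in k (f : altform W k) s x t : (size s + (size t).+1 <= k)%N ->
  fc f (s ++ x :: t) = zr (sort_in x t).1 * fc f (s ++ (sort_in x t).2).
Proof.
rewrite /fc; elim: t s => [|y t IH] s lt; first by rewrite mul1r.
rewrite /=; case: ltngtP => [_|_|->] /=; first by rewrite mul1r.
- case E : (sort_in x t) => [c u] /=; rewrite zrN map_cat /= ev_swap; last first.
    by rewrite size_map; move: lt => /=; lia.
  have := IH (rcons s y); rewrite E /= size_rcons !cat_rcons map_cat /= => ->.
    by rewrite mulNr.
  by move: lt => /=; lia.
- rewrite mul0r map_cat /=; apply: (@ev_repeat _ _ _ f _ [::]).
  by rewrite size_map; move: lt => /=; lia.
Qed.

Lemma fc_sign_sort k (f : altform W k) s : size s = k ->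
  fc f s = zr (sign_sort s).1 * fc f (sign_sort s).2.
Proof.
move=> szs; suff H p : (size p + size s <= k)%N ->
    fc f (p ++ s) = zr (sign_sort s).1 * fc f (p ++ (sign_sort s).2).
  by apply: (H [::]); rewrite szs.
elim: s p {szs} => [|x s IH] p; first by rewrite mul1r.
move=> /= lt; rewrite -cat_rcons IH; last by rewrite size_rcons; lia.
have := size_sign_sort s; case: (sign_sort s) => c t /= le.
rewrite cat_rcons fc_sort_in; last by lia.
by case: (sort_in x t) => d u; rewrite /= zrM mulrA.
Qed.

Lemma fc_normalize k (f : altform W k) l : all (fun q => size q.2 == k) l ->
  \sum_(q <- l) zr q.1 * fc f q.2 = \sum_(q <- normalize l) zr q.1 * fc f q.2.
Proof.
rewrite big_map => /allP szl; apply: eq_big_seq => q /szl/eqP/(fc_sign_sort f) ->.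
by case: (sign_sort q.2) => c t /=; rewrite zrM mulrA.
Qed.

Variable n : nat.
Hypothesis en : size e = n.

Lemma map_nth_iota0 : [seq e`_i | i <- iota 0 n] = e.
Proof. by rewrite -en -[RHS](mkseq_nth 0). Qed.

Lemma frame_expand x : x = \sum_(i <- iota 0 n) ip e`_i x *: e`_i.
Proof.
by rewrite -(big_map (fun i => e`_i) xpredT (fun y => ip y x *: y)) map_nth_iota0 -onb_expand.
Qed.

Section Coordinates.
Variable k : nat.
Local Notation N := (size (idx n k)).

Definition kappa (f : altform W k) : 'rV[R]_N := \row_j fc f (nth [::] (idx n k) j).

Lemma kappa_fc f J : J \in idx n k -> exists2 j : 'I_N, nth [::] (idx n k) j = J & kappa f 0 j = fc f J.
Proof.
move=> JI; have lt := JI; rewrite -index_mem in lt.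
by exists (Ordinal lt); rewrite ?mxE /= nth_index.
Qed.

Lemma kappa_linear : linear kappa.
Proof. by move=> a f g; apply/rowP => j; rewrite !mxE. Qed.
HB.instance Definition _ := GRing.isLinear.Build R (altform W k) 'rV[R]_N _ kappa kappa_linear.

Lemma fc_kappa_eq f g : kappa f = kappa g -> forall I, size I = k -> all (ltn^~ n) I -> fc f I = fc g I.
Proof.
move=> fg I szI ltI; rewrite !(fc_sign_sort _ szI).
have [->|c0] := eqVneq (sign_sort I).1 0%ZZ; first by rewrite !mul0r.
congr (_ * _); have [j jI <-] := kappa_fc f (sign_sort_idx szI ltI c0).
by rewrite fg mxE jI.
Qed.

(** Multilinearity reduces equality of forms to frame vectors, and sorting with
    signs reduces it to increasing multi-indices. *)
Lemma kappa_inj : injective kappa.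
Proof.
move=> f g fg; have fgI := fc_kappa_eq fg; apply: ev_eqP => s szs.
suff H I : all (ltn^~ n) I -> size I + size s = k ->
  ev f ([seq e`_i | i <- I] ++ s) = ev g ([seq e`_i | i <- I] ++ s) by apply: (H [::]).
elim: s {szs} I => [|x s IH] I ltI sz; first by rewrite cats0; apply: fgI => //; move: sz => /=; lia.
have szI : (size (map (nth 0%R e) I) < k)%N by rewrite size_map; move: sz => /=; lia.
rewrite (frame_expand x) !ev_slot_sum //; apply: eq_big_seq => i; rewrite mem_iota add0n => /andP[_ lti].
congr (_ * _); have := IH (rcons I i).
rewrite map_rcons !cat_rcons; apply; first by rewrite all_rcons ltI andbT.
by rewrite size_rcons; move: sz => /=; lia.
Qed.

Definition lin_row (l : seq (Z * seq nat)) : seq Z :=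
  let l' := normalize l in [seq coef l' J | J <- idx n k].

(** Operators on forms become integer matrices in this way: each coefficient of the
    image is a combination of coefficients of [f] at unsorted indices, that is, the
    pairing of [kappa f] with an integer row. *)
Lemma fc_lin f l : all (fun q => (size q.2 == k) && all (ltn^~ n) q.2) l ->
  \sum_(q <- l) zr q.1 * fc f q.2 = \sum_j kappa f 0 j * zr (nth 0%ZZ (lin_row l) j).
Proof.
move=> ok; rewrite fc_normalize; last by apply: sub_all ok => q /andP[].
have {ok} : all (fun q => Z.eqb q.1 0 || (q.2 \in idx n k)) (normalize l).
  rewrite all_map; apply: sub_all ok => q /andP[/eqP szq ltq] /=.
  have := sign_sort_idx szq ltq; case: (sign_sort q.2) => c t /= H.
  by have [->|/H ->] := eqVneq c 0%ZZ; rewrite ?orbT // Z.mul_0_r.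
rewrite /lin_row; elim: (normalize l) => [_|[c J] l' IH /=].
  rewrite big_nil big1 // => j _.
  by rewrite (nth_map [::]) //= mulr0.
case/andP=> cJ /IH {}IH; rewrite big_cons {}IH /=.
have E (j : 'I_N) : zr (nth 0%ZZ [seq if J == J0 then Z.add c (coef l' J0) else coef l' J0 | J0 <- idx n k] j) =
   (if J == nth [::] (idx n k) j then zr c else 0) + zr (nth 0%ZZ [seq coef l' J0 | J0 <- idx n k] j).
  by rewrite !(nth_map [::]) //; case: ifP => _; rewrite ?zrD ?add0r.
under [RHS]eq_bigr do rewrite E mulrDr.
rewrite big_split /=; congr (_ + _).
case/orP: cJ => [/Z.eqb_eq ->|JI].
  by rewrite mul0r big1 // => j _; case: ifP; rewrite mulr0.
have [j jJ <-] := kappa_fc f JI.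
rewrite (bigD1 j) //= jJ eqxx mulrC big1 ?addr0 // => i ij.
rewrite ifN ?mulr0 // -jJ nth_uniq ?combs_uniq ?iota_uniq //.
by rewrite eq_sym.
Qed.

Lemma form_ip_idx (f g : altform W k) : form_ip ip f g = \sum_(J <- idx n k) fc f J * fc g J.
Proof. by rewrite (form_ipE _ _ eO) -{1}map_nth_iota0 combs_map big_map. Qed.

Lemma form_ip_splits (f g : altform W k) :
  form_ip ip f g = \sum_(q <- splits k (iota 0 n)) fc f q.1.2 * fc g q.1.2.
Proof. by rewrite form_ip_idx /idx -combs_splits big_map. Qed.

Lemma form_ip_kappa f g : form_ip ip f g = \sum_j kappa f 0 j * kappa g 0 j.
Proof.
rewrite form_ip_idx (big_nth [::]) big_mkord.
by apply: eq_bigr => j _; rewrite !mxE.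
Qed.

Section Dual.
Variable I : seq nat.

Let dual_fun (t : k.-tuple W) : R :=
  \det (\matrix_(a < k, b < k) ip e`_(nth 0%N I b) (tnth t a)).

Fact dual_multilinear : multilinear dual_fun.
Proof.
move=> i t a x y; rewrite /dual_fun.
rewrite (@determinant_multilinear _ _ _ (\matrix_(c, b) ip e`_(nth 0%N I b) (tnth (tset t i x) c))
  (\matrix_(c, b) ip e`_(nth 0%N I b) (tnth (tset t i y) c)) i a 1) ?mul1r //.
- by apply/rowP => b; rewrite !mxE !tnth_tset eqxx mul1r ipDr ipZr.
- by apply/matrixP => c b; rewrite !mxE !tnth_tset eq_sym (negPf (neq_lift i c)).
- by apply/matrixP => c b; rewrite !mxE !tnth_tset eq_sym (negPf (neq_lift i c)).
Qed.

Fact dual_alternating : Defs.alternating dual_fun.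
Proof.
move=> i j t ij tij; apply: (determinant_alternate ij) => b.
by rewrite !mxE tij.
Qed.

Definition dual_form : altform W k := Form dual_multilinear dual_alternating.

Lemma fc_dual J : I \in idx n k -> J \in idx n k -> fc dual_form J = (I == J)%:R.
Proof.
rewrite !mem_idx => /and3P[sI ltI /eqP szI] /and3P[sJ ltJ /eqP szJ].
have uI : uniq I by apply: sorted_uniq sI; [exact: ltn_trans|exact: ltnn].
have nthlt (K : seq nat) b : all (ltn^~ n) K -> (b < size K)%N -> (nth 0%N K b < n)%N.
  by move=> /allP lt /(mem_nth 0%N)/lt.
have ME (a b : 'I_k) : ip e`_(nth 0%N I b) (tnth [tuple nth 0 [seq e`_i | i <- J] i | i < k] a) =
    (nth 0%N I b == nth 0%N J a)%:R.
  by rewrite tnth_mktuple (nth_map 0%N) ?szJ // (proj2 eO) ?en ?nthlt ?szI ?szJ.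
rewrite /fc /ev /= /dual_fun.
have [IJ|neq] := eqVneq I J.
  rewrite (_ : \matrix_(_, _) _ = 1%:M) ?det1 //.
  by apply/matrixP => a b; rewrite mxE ME -IJ mxE nth_uniq ?szI // eq_sym.
have [j jJ jI] : exists2 j, j \in J & j \notin I.
  apply/hasP; rewrite has_predC; apply: contra neq => /allP sub.
  have uJ : uniq J by apply: sorted_uniq sJ; [exact: ltn_trans|exact: ltnn].
  have [|_ eqm] := uniq_min_size uJ sub; first by rewrite szI szJ.
  by apply/eqP/esym; apply: (irr_sorted_eq ltn_trans ltnn) => //.
have lta : (index j J < k)%N by rewrite -szJ index_mem.
rewrite (expand_det_row _ (Ordinal lta)) big1 // => b _.
rewrite mxE ME /= nth_index // (_ : _ == _ = false) ?mul0r //.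
by apply: contraNF jI => /eqP <-; rewrite mem_nth // szI.
Qed.

End Dual.

Definition kinv (r : 'rV[R]_N) : altform W k :=
  \sum_j r 0 j *: dual_form (nth [::] (idx n k) j).

Lemma kinvK : cancel kinv kappa.
Proof.
move=> r; rewrite /kinv linear_sum; apply/rowP => i; rewrite summxE (bigD1 i) //= big1 => [|j ji].
  by rewrite linearZ !mxE fc_dual ?mem_nth // eqxx mulr1 addr0.
rewrite linearZ !mxE fc_dual ?mem_nth // nth_uniq ?combs_uniq ?iota_uniq //.
by rewrite -val_eqE in ji; rewrite (negPf ji) mulr0.
Qed.

Lemma kappaK : cancel kappa kinv.
Proof. by move=> f; apply: kappa_inj; rewrite kinvK. Qed.

End Coordinates.

Lemma top_form_eq (f g : altform W n) : ev f e = ev g e -> f = g.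
Proof.
move=> fg; apply: kappa_inj; apply/rowP => j; rewrite !mxE.
have : nth [::] (idx n n) j \in idx n n by rewrite mem_nth.
have -> : forall J, (J \in idx n n) = (J == iota 0 n).
  by move=> J; rewrite /idx -[X in combs _ X](size_iota 0 n) combs_full inE.
by move/eqP => ->; rewrite /fc map_nth_iota0.
Qed.

Lemma ev_wedge_frame k m (f : altform W k) (g : altform W m) J : size J = (k + m)%N ->
  fc (wedge f g) J = \sum_(q <- splits k J) (-1) ^+ q.1.1 * (fc f q.1.2 * fc g q.2).
Proof.
by move=> szJ; rewrite /fc ev_wedge ?size_map // /shuffle_sum splits_map big_map.
Qed.

Section Hodge.
Variables k m : nat.
Hypothesis km : n = (k + m)%N.
Hypothesis splits_uniq : uniq [seq q.2 | q <- splits k (iota 0 n)].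
Hypothesis splits_idx : all (fun q => q.2 \in idx n m) (splits k (iota 0 n)).

Definition star_row (g : altform W k) : 'rV[R]_(size (idx n m)) :=
  \row_j \sum_(q <- splits k (iota 0 n) | q.2 == nth [::] (idx n m) j)
    (-1) ^+ q.1.1 * fc g q.1.2.

Lemma fc_star_row g q : q \in splits k (iota 0 n) ->
  fc (kinv (star_row g)) q.2 = (-1) ^+ q.1.1 * fc g q.1.2.
Proof.
move=> qs; have [j jJ <-] := kappa_fc (kinv (star_row g)) (allP splits_idx _ qs).
rewrite kinvK mxE jJ.
by rewrite -big_filter (filter_map_uniq (h := snd)) ?big_seq1.
Qed.

Lemma wedge_star vol (f g : altform W k) h : ev vol e = 1 ->
  (forall q, q \in splits k (iota 0 n) -> fc h q.2 = (-1) ^+ q.1.1 * fc g q.1.2) ->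
  wedge f h = form_ip ip f g *: vol :> altform W (k + m).
Proof.
move=> vol1 hg; have := @top_form_eq; rewrite km; apply.
rewrite evZ vol1 mulr1 -{1}map_nth_iota0 -[LHS]/(fc _ _) ev_wedge_frame ?size_iota //.
rewrite form_ip_splits; apply: eq_big_seq => q qs; rewrite hg //.
by rewrite [fc f _ * (_ * _)]mulrCA signrMK.
Qed.

(** Exterior products with the dual basis read off every coefficient of a form of
    complementary degree, so at most one form has the property that defines the
    Hodge operator; [wedge_star] provides one. *)
Lemma fc_hodge (vol : altform W (k + m)) g q : ev vol e = 1 -> q \in splits k (iota 0 n) ->
  fc (hodge ip k m vol g) q.2 = (-1) ^+ q.1.1 * fc g q.1.2.
Proof.
move=> vol1 qs; rewrite /hodge; set S := mkset _.
have : S (xget 0 S).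
  apply: xgetPex; exists (kinv (star_row g)) => f.
  by apply: wedge_star => // q' /fc_star_row.
move: (xget 0 S) => h hP.
have sI r : r \in splits k (iota 0 n) -> r.1.2 \in idx n k.
  by move=> rs; rewrite /idx -combs_splits; apply: map_f rs.
have := congr1 (fun f => ev f e) (hP (dual_form k q.1.2)).
rewrite evZ vol1 mulr1 -{1}map_nth_iota0 -[X in X = _ -> _]/(fc _ _).
rewrite ev_wedge_frame ?size_iota // form_ip_splits.
have one (G : bool * seq nat * seq nat -> R) :
    \sum_(r <- splits k (iota 0 n)) (q.1.2 == r.1.2)%:R * G r = G q.
  transitivity (\sum_(r <- splits k (iota 0 n) | r.1.2 == q.1.2) G r).
    rewrite [RHS]big_mkcond; apply: eq_bigr => r _; rewrite eq_sym.
    by case: eqP; rewrite ?mul1r ?mul0r.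
  rewrite -big_filter (filter_map_uniq (h := fun r => r.1.2)) ?big_seq1 //.
  by rewrite combs_splits combs_uniq ?iota_uniq.
have -> : \sum_(r <- splits k (iota 0 n)) (-1) ^+ r.1.1 * (fc (dual_form k q.1.2) r.1.2 * fc h r.2) =
    (-1) ^+ q.1.1 * fc h q.2.
  rewrite -(one (fun r => (-1) ^+ r.1.1 * fc h r.2)); apply: eq_big_seq => r rs.
  by rewrite fc_dual ?sI // mulrCA.
have -> : \sum_(r <- splits k (iota 0 n)) fc (dual_form k q.1.2) r.1.2 * fc g r.1.2 = fc g q.1.2.
  rewrite -(one (fun r => fc g r.1.2)); apply: eq_big_seq => r rs.
  by rewrite fc_dual ?sI.
by move=> <-; rewrite signrMK.
Qed.

End Hodge.

End Frame.

(** * Cayley frames *)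

(** An entry [(b, c, (s, d))] means that [e_0 × e_b × e_c] is [e_d], or [- e_d] if
    [s] holds. *)
Definition cross_table : seq (nat * nat * (bool * nat)) :=
  [:: (1, 2, (false, 3)); (1, 4, (false, 5)); (2, 4, (false, 6)); (3, 4, (false, 7));
      (1, 3, (true, 2)); (2, 3, (false, 1)); (1, 5, (true, 4)); (2, 6, (true, 4));
      (3, 7, (true, 4)); (4, 5, (false, 1)); (4, 6, (false, 2)); (4, 7, (false, 3));
      (1, 6, (true, 7)); (2, 5, (false, 7)); (1, 7, (false, 6)); (3, 5, (true, 6));
      (2, 7, (true, 5)); (3, 6, (false, 5)); (5, 6, (true, 3)); (5, 7, (false, 2));
      (6, 7, (true, 1))]%N.

Definition cross_idx b c : bool * nat :=
  nth (false, 0%N) (map snd cross_table) (index (b, c) (map fst cross_table)).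

Definition cayley_terms : seq (Z * seq nat) :=
  [seq (1%ZZ, J) | J <- [:: [:: 0; 1; 6; 7]; [:: 0; 3; 5; 6]; [:: 1; 2; 4; 7];
                           [:: 2; 3; 4; 5]]%N] ++
  [seq ((-1)%ZZ, J) | J <- [:: [:: 0; 1; 2; 3]; [:: 0; 1; 4; 5]; [:: 0; 2; 4; 6];
      [:: 0; 2; 5; 7]; [:: 0; 3; 4; 7]; [:: 1; 2; 5; 6]; [:: 1; 3; 4; 6];
      [:: 1; 3; 5; 7]; [:: 2; 3; 6; 7]; [:: 4; 5; 6; 7]]%N].

Definition cross_idx_full b c : bool * nat :=
  if (b < c)%N then cross_idx b c else (~~ (cross_idx c b).1, (cross_idx c b).2).

Definition sgz (s : bool) : Z := if s then (-1)%ZZ else 1%ZZ.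

Lemma zr_sgz (R : pzRingType) s : zr R (sgz s) = (-1) ^+ s.
Proof. by case: s. Qed.

Lemma cross_idx_lt b c : ((cross_idx b c).2 < 8)%N.
Proof.
rewrite /cross_idx; set l := map snd _; set i := index _ _.
have [lti|gei] := ltnP i (size l); last by rewrite nth_default.
have : all (fun q => q.2 < 8)%N l by [].
by move/all_nthP; apply.
Qed.

Lemma cross_idx_gt0 b c : (0 < b < c)%N -> (c < 8)%N -> (0 < (cross_idx b c).2)%N.
Proof.
by case/andP; case: b => [|[|[|[|[|[|[|[|b]]]]]]]]; case: c => [|[|[|[|[|[|[|[|c]]]]]]]].
Qed.

Lemma cross_idx_full_lt b c : ((cross_idx_full b c).2 < 8)%N.
Proof. by rewrite /cross_idx_full; case: ifP => _; rewrite /= cross_idx_lt. Qed.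

(** [Phi(e_0, e_b, e_c, e_d) = - <e_b, e_0 × e_c × e_d>] *)
Definition table_Phi0 b c d : Z :=
  if (cross_idx c d).2 == b then Z.opp (sgz (cross_idx c d).1) else 0%ZZ.

(** Write [k] for the index of [e_0 × e_c × e_d]. If [k <> b], positivity rewrites
    [e_b × e_c × e_d] as [e_0 × e_b × (e_0 × e_c × e_d)]; if [k = b], the triple
    product is a multiple of [e_0]. *)
Definition table_Phi1 a b c d : Z :=
  if (cross_idx c d).2 == b then 0%ZZ
  else Z.mul (sgz (cross_idx c d).1)
    (let q := cross_idx_full b (cross_idx c d).2 in if q.2 == a then sgz q.1 else 0%ZZ).

Definition table_Phi (J : seq nat) : Z :=
  if J is [:: a; b; c; d] then
    if a is 0%N then table_Phi0 b c d else table_Phi1 a b c d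
  else 0%ZZ.

Definition cayley_coef (J : seq nat) : Z := coef cayley_terms J.

Section CayleyFrame.
Variables (R : realType) (W : vectType R) (ip : {dot W for idfun}).
Variables (P : 3.-tuple W -> W) (Phi : altform W 4).
Hypothesis tripleP : triple_cross_product ip P.
Hypothesis posP : positive_product ip P.
Hypothesis PhiP : cayley_calibration ip P Phi.

Local Notation br a b c := (P [tuple a; b; c]).

Lemma exists_unit_orthogonal (s : seq W) : (size s < \dim {:W})%N ->
  exists x, ip x x = 1 /\ forall y, y \in s -> ip y x = 0.
Proof.
move=> lts; pose h (x : W) : 'rV[R]_(size s) := \row_i ip s`_i x.
have hl : linear h by move=> a u v; apply/rowP => i; rewrite !mxE ipDr ipZr.
pose H : {linear W -> 'rV[R]_(size s)} := HB.pack h (GRing.isLinear.Build _ _ _ _ h hl).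
have := limg_ker_dim (linfun H) {:W}; rewrite capfv.
have := dimvS (subvf (linfun H @: {:W})%VS); rewrite dimvf /dim /= mul1n => leh dimE.
have k0 : lker (linfun H) != 0%VS.
  by apply: contraTneq lts => k0; rewrite -dimE k0 dimv0 -leqNgt.
have xK := memv_pick (lker (linfun H)).
set x := vpick _ in xK; have x0 : x != 0 by rewrite vpick0.
have xx := ip_gt0 ip x0; exists ((Num.sqrt (ip x x))^-1 *: x); split.
  rewrite ipZl ipZr mulrA -invfM -expr2 sqr_sqrtr ?ltW //.
  by rewrite mulVf // gt_eqF.
move=> y /(nthP 0)[i lti <-]; rewrite ipZr; move: xK; rewrite memv_ker lfunE /=.
by move=> /eqP/rowP/(_ (Ordinal lti)); rewrite !mxE => ->; rewrite mulr0.
Qed.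

Lemma ev_cayley x a b c : ev Phi [:: x; a; b; c] = ip x (br a b c).
Proof. by rewrite -PhiP -ev_tuple. Qed.

Lemma br_swap12 a b c : br a b c = - br b a c.
Proof.
apply: (@ip_inj _ _ ip) => x; rewrite ipNl !(ipC _ _ x) -!ev_cayley.
exact: (@ev_swap _ _ _ Phi [:: x]).
Qed.

Lemma br_swap23 a b c : br a b c = - br a c b.
Proof.
apply: (@ip_inj _ _ ip) => x; rewrite ipNl !(ipC _ _ x) -!ev_cayley.
exact: (@ev_swap _ _ _ Phi [:: x; a]).
Qed.

Lemma br_cycle a b c : br a b c = br b c a.
Proof. by rewrite br_swap12 br_swap23 opprK. Qed.

Lemma br_skew x a b c : ip x (br a b c) = - ip c (br a b x).
Proof.
rewrite -!ev_cayley (@ev_swap _ _ _ Phi [:: x; a]) // (@ev_swap _ _ _ Phi [:: x]) //.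
rewrite (@ev_swap _ _ _ Phi [::]) //= (@ev_swap _ _ _ Phi [:: c] [:: b] x a) //=.
by rewrite (@ev_swap _ _ _ Phi [:: c; a] [::] x b) //= !opprK.
Qed.

Lemma br_lin a b c x y : br a b (c *: x + y) = c *: br a b x + br a b y.
Proof.
apply: (@ip_inj _ _ ip) => z; rewrite ipDl ipZl !(ipC _ _ z) -!ev_cayley.
exact: (@ev_slot _ _ _ Phi [:: z; a; b]).
Qed.

Lemma brZ a b c x : br a b (c *: x) = c *: br a b x.
Proof.
apply: (@ip_inj _ _ ip) => z; rewrite ipZl !(ipC _ _ z) -!ev_cayley.
exact: (@ev_slotZ _ _ _ Phi [:: z; a; b]).
Qed.

Lemma brD a b x y : br a b (x + y) = br a b x + br a b y.
Proof. by rewrite -[x in LHS]scale1r br_lin scale1r. Qed.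

Lemma brN a b x : br a b (- x) = - br a b x.
Proof. by rewrite -scaleN1r brZ scaleN1r. Qed.

Lemma br_diag a b : br a b b = 0.
Proof. by have [_ alt _ _] := tripleP; apply: (alt (inord 1) (inord 2)); rewrite ?(tnth_nth 0) -?val_eqE /= ?inordK. Qed.

Lemma br_orth a b c : [/\ ip a (br a b c) = 0, ip b (br a b c) = 0 & ip c (br a b c) = 0].
Proof.
have [_ _ orth _] := tripleP.
by split; rewrite ipC; [have := orth [tuple a; b; c] (inord 0)|have := orth [tuple a; b; c] (inord 1)|
  have := orth [tuple a; b; c] (inord 2)]; rewrite (tnth_nth 0) inordK.
Qed.

Lemma br_norm a b x : ip a a = 1 -> ip b b = 1 -> ip a b = 0 -> ip a x = 0 -> ip b x = 0 ->
  ip (br a b x) (br a b x) = ip x x.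
Proof.
move=> aa bb ab ax bx; have [_ _ _ /(_ [tuple a; b; x])] := tripleP.
rewrite /vnorm /wedge_norm => nE.
have detE : \det (\matrix_(i < 3, j < 3) ip (tnth [tuple a; b; x] i) (tnth [tuple a; b; x] j)) = ip x x.
  rewrite (_ : \matrix_(i, j) _ = diag_mx (\row_i [:: 1; 1; ip x x]`_i)).
    by rewrite det_diag !big_ord_recl big_ord0 !mxE /= !mul1r mulr1.
  apply/matrixP => i j; rewrite !mxE !(tnth_nth 0).
  case: i => [[|[|[|i]]] lti] //; case: j => [[|[|[|j]]] ltj] //; rewrite -val_eqE /= ?aa ?bb ?ab ?ax ?bx //;
    by rewrite ipC ?ab ?ax ?bx.
by move: nE; rewrite detE => /eqP; rewrite eqr_sqrt ?ip_ge0 // => /eqP.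
Qed.

Lemma br_isometry a b x y : ip a a = 1 -> ip b b = 1 -> ip a b = 0 ->
  ip a x = 0 -> ip b x = 0 -> ip a y = 0 -> ip b y = 0 ->
  ip (br a b x) (br a b y) = ip x y.
Proof.
move=> aa bb ab ax bx ay by_; have := @br_norm a b (x + y) aa bb ab.
rewrite brD !ipDl !ipDr !br_norm // (ipC _ (br a b y) (br a b x)) (ipC _ y x).
by rewrite ax ay bx by_ addr0 => /(_ erefl erefl); lra.
Qed.

(** On the complement of [a] and [b] the map [br a b] is skew and isometric, hence a
    complex structure. *)
Lemma br_square a b x : ip a a = 1 -> ip b b = 1 -> ip a b = 0 -> ip a x = 0 -> ip b x = 0 ->
  br a b (br a b x) = - x.
Proof.
move=> aa bb ab ax bx; apply: (@ip_inj _ _ ip) => z; rewrite ipNl.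
have baa : br a b a = 0 by rewrite br_cycle br_cycle -br_cycle br_diag.
have bab : br a b b = 0 by rewrite br_diag.
pose y := z - ip a z *: a - ip b z *: b.
have zE : br a b z = br a b y by rewrite /y !brD !brN !brZ baa bab !scaler0 !subr0.
have [yO1 yO2 _] := br_orth a b x.
rewrite ipC br_skew zE br_isometry // /y.
- by rewrite !ipDr !ipNr !ipZr (ipC _ x a) (ipC _ x b) ax bx !mulr0 !subr0.
- by rewrite !ipDr !ipNr !ipZr aa ab; ring.
- by rewrite !ipDr !ipNr !ipZr bb (ipC _ b a) ab; ring.
Qed.

Section Frame.
Variable e0 : W.
Hypothesis e00 : ip e0 e0 = 1.

Lemma crossC a b : br e0 a b = - br e0 b a.
Proof. exact: br_swap23. Qed.

Lemma ip_cross a b c : ip a (br e0 b c) = ip b (br e0 c a).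
Proof. by rewrite [br e0 b c]crossC ipNr br_skew opprK. Qed.

Lemma cross_cross a b : ip a a = 1 -> ip e0 a = 0 -> ip e0 b = 0 -> ip a b = 0 ->
  br e0 a (br e0 a b) = - b.
Proof. by move=> aa a0 b0 ab; rewrite br_square. Qed.

(** Positivity re-associates nested products with [e0] of orthogonal vectors into
    one triple product, which is alternating. With [cross_cross], this determines
    the whole multiplication table. *)
Lemma cross_assoc a b c : ip e0 a = 0 -> ip e0 b = 0 -> ip e0 c = 0 ->
  ip a b = 0 -> ip a c = 0 -> ip b c = 0 -> ip c (br e0 a b) = 0 ->
  br e0 a (br e0 b c) = br a b c.
Proof.
move=> a0 b0 c0 ab ac bc cab; rewrite posP // ?(ipC _ c) //.
by rewrite /vnorm e00 sqrtr1 expr1n scale1r.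
Qed.

Lemma cross_assocC a b c : ip e0 a = 0 -> ip e0 b = 0 -> ip e0 c = 0 ->
  ip a b = 0 -> ip a c = 0 -> ip b c = 0 -> ip c (br e0 a b) = 0 ->
  br e0 a (br e0 b c) = br e0 c (br e0 a b).
Proof.
move=> a0 b0 c0 ab ac bc cab; rewrite !cross_assoc // ?(ipC _ c) ?ac ?bc //.
  by rewrite -br_cycle.
by rewrite -(ip_cross a b) -(ip_cross c a).
Qed.

Section Units.
Variables e1 e2 e4 : W.
Hypotheses (e11 : ip e1 e1 = 1) (e22 : ip e2 e2 = 1) (e44 : ip e4 e4 = 1).
Hypotheses (e01 : ip e0 e1 = 0) (e02 : ip e0 e2 = 0) (e04 : ip e0 e4 = 0).
Hypotheses (e12 : ip e1 e2 = 0) (e14 : ip e1 e4 = 0) (e24 : ip e2 e4 = 0).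
Local Notation "a × b" := (br e0 a b) (at level 40).
Let e3 := e1 × e2.
Hypothesis e34 : ip e3 e4 = 0.
Let e5 := e1 × e4.
Let e6 := e2 × e4.
Let e7 := e3 × e4.

Let frame := [:: e0; e1; e2; e3; e4; e5; e6; e7].

Let e03 : ip e0 e3 = 0. Proof. by case: (br_orth e0 e1 e2). Qed.
Let e13 : ip e1 e3 = 0. Proof. by case: (br_orth e0 e1 e2). Qed.
Let e23 : ip e2 e3 = 0. Proof. by case: (br_orth e0 e1 e2). Qed.
Let e33 : ip e3 e3 = 1. Proof. by rewrite br_norm. Qed.
Let e05 : ip e0 e5 = 0. Proof. by case: (br_orth e0 e1 e4). Qed.
Let e15 : ip e1 e5 = 0. Proof. by case: (br_orth e0 e1 e4). Qed.
Let e45 : ip e4 e5 = 0. Proof. by case: (br_orth e0 e1 e4). Qed.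
Let e55 : ip e5 e5 = 1. Proof. by rewrite br_norm. Qed.
Let e06 : ip e0 e6 = 0. Proof. by case: (br_orth e0 e2 e4). Qed.
Let e26 : ip e2 e6 = 0. Proof. by case: (br_orth e0 e2 e4). Qed.
Let e46 : ip e4 e6 = 0. Proof. by case: (br_orth e0 e2 e4). Qed.
Let e66 : ip e6 e6 = 1. Proof. by rewrite br_norm. Qed.
Let e07 : ip e0 e7 = 0. Proof. by case: (br_orth e0 e3 e4). Qed.
Let e37 : ip e3 e7 = 0. Proof. by case: (br_orth e0 e3 e4). Qed.
Let e47 : ip e4 e7 = 0. Proof. by case: (br_orth e0 e3 e4). Qed.
Let e77 : ip e7 e7 = 1. Proof. by rewrite br_norm. Qed.
Let x13 : e1 × e3 = - e2. Proof. by rewrite cross_cross. Qed.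
Let x23 : e2 × e3 = e1.
Proof. by rewrite /e3 (crossC e1) brN cross_cross ?opprK // ipC. Qed.
Let e25 : ip e2 e5 = 0. 
Proof. by rewrite /e5 (ip_cross e2) (ip_cross e1) (crossC e2) ipNr ipC e34 oppr0. Qed.
Let e16 : ip e1 e6 = 0. Proof. by rewrite ip_cross (crossC e4) ipNr -ip_cross (crossC e2) ipNr ipC e34 !oppr0. Qed.
Let e35 : ip e3 e5 = 0. Proof. by rewrite /e3 /e5 br_isometry. Qed.
Let e36 : ip e3 e6 = 0. Proof. by rewrite /e3 /e6 (crossC e1) ipNl br_isometry ?e14 ?oppr0 // ipC. Qed.
Let e17 : ip e1 e7 = 0. 
Proof. by rewrite /e7 (ip_cross e1) (ip_cross e3) x13 ipNr ipC e24 oppr0. Qed.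
Let e27 : ip e2 e7 = 0. 
Proof. by rewrite /e7 (ip_cross e2) (ip_cross e3) x23 ipC e14. Qed.
Let e56 : ip e5 e6 = 0.
Proof. by rewrite /e5 /e6 (crossC e1) (crossC e2) ipNl ipNr opprK br_isometry // ipC. Qed.
Let e57 : ip e5 e7 = 0.
Proof. by rewrite /e5 /e7 (crossC e1) (crossC e3) ipNl ipNr opprK br_isometry // ipC. Qed.
Let e67 : ip e6 e7 = 0.
Proof. by rewrite /e6 /e7 (crossC e2) (crossC e3) ipNl ipNr opprK br_isometry // ipC. Qed.

Let frame_norm i : (i < 8)%N -> ip frame`_i frame`_i = 1.
Proof. by case: i => [|[|[|[|[|[|[|[|i]]]]]]]]. Qed.

Let frame_orth i j : (i < j < 8)%N -> ip frame`_i frame`_j = 0.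
Proof.
case/andP; case: i => [|[|[|[|[|[|[|[|i]]]]]]]]; case: j => [|[|[|[|[|[|[|[|j]]]]]]]] //=.
Qed.

Let frame_ip i j : (i < 8)%N -> (j < 8)%N -> ip frame`_i frame`_j = (i == j)%:R.
Proof.
move=> li lj; case: ltngtP => [ij|ji|<-]; last exact: frame_norm.
  by rewrite frame_orth ?ij.
by rewrite ipC frame_orth ?ji.
Qed.

Let x15 : e1 × e5 = - e4. Proof. by rewrite cross_cross. Qed.
Let x26 : e2 × e6 = - e4. Proof. by rewrite cross_cross. Qed.
Let x37 : e3 × e7 = - e4. Proof. by rewrite cross_cross. Qed.
Let x45 : e4 × e5 = e1. Proof. by rewrite /e5 (crossC e1) brN cross_cross ?opprK // ipC. Qed.
Let x46 : e4 × e6 = e2. Proof. by rewrite /e6 (crossC e2) brN cross_cross ?opprK // ipC. Qed.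
Let x47 : e4 × e7 = e3. Proof. by rewrite /e7 (crossC e3) brN cross_cross ?opprK // ipC. Qed.
Let x16 : e1 × e6 = - e7. Proof. by rewrite /e6 cross_assocC ?(ipC ip e4) // crossC. Qed.
Let x25 : e2 × e5 = e7.
Proof. by rewrite /e5 cross_assocC ?(ipC ip e2 e1) ?(crossC e2 e1) ?ipNr ?(ipC ip e4) ?e34 ?oppr0 // brN -crossC. Qed.
Let x17 : e1 × e7 = e6.
Proof. by rewrite /e7 cross_assocC ?x13 ?ipNr ?(ipC ip e4) ?e24 ?oppr0 // brN -crossC. Qed.
Let x35 : e3 × e5 = - e6.
Proof. by rewrite /e5 cross_assocC ?(ipC ip e3 e1) ?(crossC e3 e1) ?x13 ?opprK ?(ipC ip e4) // crossC. Qed.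
Let x27 : e2 × e7 = - e5.
Proof. by rewrite /e7 cross_assocC ?x23 ?(ipC ip e4) // crossC. Qed.
Let x36 : e3 × e6 = e5.
Proof. by rewrite /e6 cross_assocC ?(ipC ip e3 e2) ?(crossC e3 e2) ?x23 ?ipNr ?(ipC ip e4) ?e14 ?oppr0 // brN -crossC. Qed.
Let x56 : e5 × e6 = - e3.
Proof.
by rewrite /e6 cross_assocC ?(crossC e5 e2) ?x25 ?ipNr ?e47 ?oppr0 ?brN ?x47 //; rewrite ipC.
Qed.
Let x57 : e5 × e7 = e2.
Proof.
by rewrite /e7 cross_assocC ?(crossC e5 e3) ?x35 ?opprK ?x46 //; rewrite ipC.
Qed.
Let x67 : e6 × e7 = - e1.
Proof.
by rewrite /e7 cross_assocC ?(crossC e6 e3) ?x36 ?ipNr ?e45 ?oppr0 ?brN ?x45 //; rewrite ipC.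
Qed.

Let sg (q : bool * nat) := (-1) ^+ q.1 *: frame`_q.2.

Let frame_cross_lt b c : (0 < b < c)%N -> (c < 8)%N ->
  frame`_b × frame`_c = sg (cross_idx b c).
Proof.
case/andP; case: b => [|[|[|[|[|[|[|[|b]]]]]]]]; case: c => [|[|[|[|[|[|[|[|c]]]]]]]] //= _ _ _;
  by rewrite /sg /= ?expr1 ?scale1r ?scaleN1r.
Qed.

Let frame_orth0 i : (0 < i < 8)%N -> ip e0 frame`_i = 0.
Proof. by case/andP => i0 i8; rewrite -[e0]/(frame`_0) frame_orth ?i0. Qed.

Let fc_frame a b c d : fc frame Phi [:: a; b; c; d] = ip frame`_a (br frame`_b frame`_c frame`_d).
Proof. exact: ev_cayley. Qed.

Let frame_Phi0 b c d : (0 < b < c)%N -> (c < d < 8)%N ->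
  fc frame Phi [:: 0; b; c; d]%N = zr R (table_Phi0 b c d).
Proof.
move=> /andP[b0 bc] /andP[cd d8]; have c8 := ltn_trans cd d8; have b8 := ltn_trans bc c8.
rewrite /fc /= (@ev_swap _ _ _ Phi [::]) // ev_cayley frame_cross_lt ?cd ?(ltn_trans b0) //.
rewrite /sg ipZr frame_ip ?cross_idx_lt // /table_Phi0 eq_sym.
by case: eqP; rewrite ?mulr0 ?oppr0 // mulr1 zrN zr_sgz.
Qed.

Let frame_cross b c : (0 < b < 8)%N -> (0 < c < 8)%N -> b != c ->
  frame`_b × frame`_c = sg (cross_idx_full b c).
Proof.
move=> /andP[b0 b8] /andP[c0 c8] bc; rewrite /cross_idx_full; case: ltngtP bc => // lt _.
  by rewrite frame_cross_lt ?b0.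
by rewrite crossC frame_cross_lt ?c0 // /sg -scaleNr -signrN.
Qed.

Let frame_Phi1 a b c d : (0 < a < b)%N -> (b < c)%N -> (c < d < 8)%N ->
  fc frame Phi [:: a; b; c; d]%N = zr R (table_Phi1 a b c d).
Proof.
move=> /andP[a0 ab] bc /andP[cd d8]; have c8 := ltn_trans cd d8; have b8 := ltn_trans bc c8.
have b0 := ltn_trans a0 ab; have c0 := ltn_trans b0 bc; have d0 := ltn_trans c0 cd.
have a8 := ltn_trans ab b8; rewrite fc_frame.
have cdE : frame`_c × frame`_d = sg (cross_idx c d) by rewrite frame_cross_lt ?c0.
have k8 := cross_idx_lt c d; rewrite /table_Phi1; case: (eqVneq (cross_idx c d).2 b) => [kb|kb].
  have -> : frame`_b = (-1) ^+ (cross_idx c d).1 *: (frame`_c × frame`_d).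
    by rewrite cdE /sg scalerA -expr2 sqrr_sign scale1r kb.
  rewrite [br (_ *: _) _ _]br_cycle brZ (br_cycle e0) br_square ?frame_norm //.
  - by rewrite scalerN ipNr ipZr ipC frame_orth0 ?a0 // mulr0 oppr0.
  - by rewrite frame_orth ?cd.
  - by rewrite ipC frame_orth0 ?c0.
  - by rewrite ipC frame_orth0 ?d0.
rewrite -cross_assoc ?frame_orth0 ?a0 ?b0 ?c0 ?d0 //.
- rewrite cdE /sg brZ ipZr zrM zr_sgz; congr (_ * _).
  have kpos : (0 < (cross_idx c d).2)%N by rewrite cross_idx_gt0 ?c0 ?cd.
  rewrite frame_cross ?b0 ?kpos //; last by rewrite eq_sym.
  rewrite /sg ipZr frame_ip ?cross_idx_full_lt // [a == _]eq_sym.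
  by case: eqP; rewrite ?mulr0 // mulr1 zr_sgz.
- by rewrite frame_orth ?bc.
- by rewrite frame_orth ?(ltn_trans bc cd).
- by rewrite frame_orth ?cd.
- rewrite (ip_cross frame`_d) cdE /sg ipZr frame_ip // [b == _]eq_sym (negPf kb) mulr0.
  by [].
Qed.

Lemma frame_Phi J : J \in idx 8 4 -> fc frame Phi J = zr R (cayley_coef J).
Proof.
move=> JI; have := JI; rewrite mem_idx => /and3P[srt lts /eqP].
case: J JI srt lts => [|a [|b [|c [|d [|]]]]] // JI /and4P[ab bc cd _] /and5P[_ _ _ d8 _] _.
have -> : cayley_coef [:: a; b; c; d] = table_Phi [:: a; b; c; d].
  by apply/eqP; move: {ab bc cd d8} JI; apply/allP: [:: a; b; c; d]; vm_compute.
have cd8 : (c < d < 8)%N by apply/andP.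
rewrite /table_Phi; case: a ab {JI} => [|a] ab; first by apply: frame_Phi0 => //; apply/andP.
by apply: frame_Phi1.
Qed.

Lemma frame_onb : \dim {:W} = 8%N -> onb ip frame.
Proof. by move=> d8; split => //= i j; apply: frame_ip. Qed.

End Units.

End Frame.

(** As for octonion units: choose orthonormal [e0], [e1], [e2], then a unit vector
    [e4] orthogonal to them and to [e0 × e1 × e2]; their products complete the
    frame. *)
Lemma cayley_frame : \dim {:W} = 8%N ->
  exists e : seq W, [/\ onb ip e, size e = 8%N &
    forall J, J \in idx 8 4 -> fc e Phi J = zr R (cayley_coef J)].
Proof.
move=> d8.
have [|e0 [e00 _]] := @exists_unit_orthogonal [::]; first by rewrite d8.
have [|e1 [e11 o1]] := @exists_unit_orthogonal [:: e0]; first by rewrite d8.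
have [|e2 [e22 o2]] := @exists_unit_orthogonal [:: e0; e1]; first by rewrite d8.
have [|e4 [e44 o4]] := @exists_unit_orthogonal [:: e0; e1; e2; br e0 e1 e2]; first by rewrite d8.
have e01 : ip e0 e1 = 0 by rewrite o1 ?inE ?eqxx.
have e02 : ip e0 e2 = 0 by rewrite o2 ?inE ?eqxx.
have e12 : ip e1 e2 = 0 by rewrite o2 ?inE ?eqxx ?orbT.
have e04 : ip e0 e4 = 0 by rewrite o4 ?inE ?eqxx.
have e14 : ip e1 e4 = 0 by rewrite o4 ?inE ?eqxx ?orbT.
have e24 : ip e2 e4 = 0 by rewrite o4 ?inE ?eqxx ?orbT.
have e34 : ip (br e0 e1 e2) e4 = 0 by rewrite o4 ?inE ?eqxx ?orbT.
eexists; split; [exact: (@frame_onb e0 e00 e1 e2 e4)|by []|exact: (@frame_Phi e0 e00 e1 e2 e4)].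
Qed.

End CayleyFrame.

(** * Exponentials and Lie derivatives *)

Section Coordinatewise.
Variables (R : realType) (V : vectType R).
Local Notation b := (vbasis {:V}).

Lemma cvg_bigsum (I : Type) (r : seq I) (u : I -> nat -> R) (l : I -> R) :
  (forall i, u i @ \oo --> l i) ->
  (fun n => \sum_(i <- r) u i n) @ \oo --> \sum_(i <- r) l i.
Proof.
move=> ul; elim: r => [|i r IH].
  by rewrite big_nil; under eq_fun do rewrite big_nil; apply: cvg_cst.
by rewrite big_cons; under eq_fun do rewrite big_cons; apply: cvgD.
Qed.

Lemma is_derive_bigsum (I : Type) (r : seq I) (u : I -> R -> R) (l : I -> R) (t : R) :
  (forall i, is_derive t 1 (u i) (l i)) ->
  is_derive t 1 (fun s => \sum_(i <- r) u i s) (\sum_(i <- r) l i).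
Proof.
move=> ul; elim: r => [|i r IH].
  by rewrite big_nil; under eq_fun do rewrite big_nil; apply: is_derive_cst.
by rewrite big_cons; under eq_fun do rewrite big_cons; apply: is_deriveD.
Qed.

Lemma vbasis_sum (v : V) : v = \sum_(i < \dim {:V}) coord b i v *: b`_i.
Proof. exact: coord_vbasis (memvf v). Qed.

Lemma scalar_sum (phi : {scalar V}) I (r : seq I) (c : I -> R) (w : I -> V) :
  phi (\sum_(i <- r) c i *: w i) = \sum_(i <- r) c i * phi (w i).
Proof. by rewrite linear_sum; apply: eq_bigr => i _; rewrite linearZ. Qed.

Variables (I : Type) (r : seq I) (l : I -> {scalar V}) (w : I -> V).
Hypothesis frame : forall v, v = \sum_(i <- r) l i v *: w i.

(** Limits taken coordinatewise in one basis commute with every linear functional,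
    and convergence may be checked in any other frame. *)
Lemma vlim_scalar (u : nat -> V) (phi : {scalar V}) :
  (forall i, cvgn (fun n => l i (u n) : R)) ->
  (fun n => phi (u n) : R) @ \oo --> (phi (vlim u) : R).
Proof.
move=> cu; have cuk k : cvgn (fun n => coord b k (u n) : R).
  apply/cvg_ex; exists (\sum_(i <- r) limn (fun n => l i (u n) : R) * coord b k (w i)).
  have -> : (fun n => coord b k (u n) : R) = fun n => \sum_(i <- r) l i (u n) * coord b k (w i).
    by apply/funext => n; rewrite [u n in LHS]frame scalar_sum.
  by apply: cvg_bigsum => i; apply: cvgMl; apply: cu.
rewrite /vlim scalar_sum.
have -> : (fun n => phi (u n) : R) = fun n => \sum_(i < \dim {:V}) coord b i (u n) * phi b`_i.
  by apply/funext => n; rewrite [u n in LHS]vbasis_sum scalar_sum.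
by apply: cvg_bigsum => i; apply: cvgMl; apply: cuk.
Qed.

Lemma vderive_scalar (c : R -> V) (t : R) (phi : {scalar V}) :
  (forall i, derivable (fun s => l i (c s) : R) t 1) ->
  is_derive t 1 (fun s => phi (c s) : R) (phi (vderive c t)).
Proof.
move=> dc.
have dl (f : R -> R) (a : R) df : is_derive t 1 f df -> is_derive t 1 (fun s => f s * a) (df * a).
  move=> fd; have -> : (fun s => f s * a) = a *: f by apply/funext => s; rewrite mulrC.
  by rewrite mulrC; apply: is_deriveZ.
have dck k : derivable (fun s => coord b k (c s) : R) t 1.
  have -> : (fun s => coord b k (c s) : R) = fun s => \sum_(i <- r) l i (c s) * coord b k (w i).
    by apply/funext => s; rewrite [c s in LHS]frame scalar_sum.
  apply: (@ex_derive _ _ _ _ _ _ (\sum_(i <- r) 'D_1 (fun s => l i (c s) : R) t * coord b k (w i))).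
  by apply: is_derive_bigsum => i; apply: dl; apply: derivableP.
rewrite /vderive scalar_sum.
have -> : (fun s => phi (c s) : R) = fun s => \sum_(i < \dim {:V}) coord b i (c s) * phi b`_i.
  by apply/funext => s; rewrite [c s in LHS]vbasis_sum scalar_sum.
apply: is_derive_bigsum => i; apply: dl; rewrite derive1E; apply: derivableP.
exact: dck.
Qed.

End Coordinatewise.

Section Entries.
Variables (R : realType) (W : vectType R) (ip : {dot W for idfun}) (e : seq W).
Hypothesis eO : onb ip e.
Local Notation n := (size e).

Definition entry (y x : W) (g : 'End(W)) : R := ip y (g x).

Fact entry_linear y x : scalar (entry y x).
Proof. by move=> a g h; rewrite /entry add_lfunE scale_lfunE ipDr ipZr. Qed.
HB.instance Definition _ y x :=
  GRing.isLinear.Build R 'End(W) R *%R (entry y x) (entry_linear y x).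

Definition unit_lfun (y x : W) : 'End(W) := linfun (fun z => ip x z *: y).

Lemma unit_lfunE y x z : unit_lfun y x z = ip x z *: y.
Proof.
have lin : linear (fun z => ip x z *: y) by move=> a u v; rewrite ipDr ipZr scalerDl scalerA.
exact: (lfunE (HB.pack (fun z => ip x z *: y) (GRing.isLinear.Build _ _ _ _ _ lin))).
Qed.

Definition pairs := [seq (i, j) | i <- iota 0 n, j <- iota 0 n].

Lemma lfun_frame (g : 'End(W)) :
  g = \sum_(p <- pairs) entry e`_p.1 e`_p.2 g *: unit_lfun e`_p.1 e`_p.2.
Proof.
apply/lfunP => x; rewrite sum_lfunE big_allpairs_dep /= (frame_expand eO erefl (g x)).
apply: eq_bigr => i _; rewrite {1}(frame_expand eO erefl x) linear_sum ip_sumr scaler_suml.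
apply: eq_bigr => j _; rewrite scale_lfunE unit_lfunE linearZ ipZr scalerA.
by rewrite mulrC.
Qed.

End Entries.

Section Exponential.
Variables (R : realType) (W : vectType R) (ip : {dot W for idfun}) (e : seq W).
Hypothesis eO : onb ip e.
Variable xi : 'End(W).
Local Notation n := (size e).

Let N1 (x : W) : R := \sum_(i <- iota 0 n) `|ip e`_i x|.
Let M := \sum_(i <- iota 0 n) N1 (xi e`_i).

Let M_ge0 : 0 <= M.
Proof. by apply: sumr_ge0 => i _; apply: sumr_ge0. Qed.

Let N1_ge0 x : 0 <= N1 x. Proof. exact: sumr_ge0. Qed.

Let N1_xi x : N1 (xi x) <= M * N1 x.
Proof.
have H i : `|ip e`_i (xi x)| <= \sum_(j <- iota 0 n) `|ip e`_j x| * `|ip e`_i (xi e`_j)|.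
  rewrite {1}(frame_expand eO erefl x) linear_sum ip_sumr.
  apply: le_trans (ler_norm_sum _ _ _) _; apply: ler_sum => j _.
  by rewrite linearZ ipZr normrM.
apply: le_trans (ler_sum _ (fun i _ => H i)) _; rewrite exchange_big mulr_suml /=.
rewrite big_seq [leRHS]big_seq; apply: ler_sum => j jn; rewrite -mulr_sumr mulrC.
apply: ler_wpM2l; first exact: N1_ge0.
by rewrite /N1 (big_rem j) //= lerDl sumr_ge0.
Qed.

Let ip_bound y x : `|ip y x| <= N1 y * N1 x.
Proof.
rewrite {1}(frame_expand eO erefl y) ip_suml; apply: le_trans (ler_norm_sum _ _ _) _.
rewrite mulr_suml big_seq [leRHS]big_seq; apply: ler_sum => i isn.
rewrite ipZl normrM; apply: ler_wpM2l => //.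
by rewrite /N1 (big_rem i) //= lerDl sumr_ge0.
Qed.

Let coefs y x j : R := ip y (iter j xi x) / j`!%:R.

Let coefs_diffs y x : pseries_diffs (coefs y x) = coefs y (xi x).
Proof.
apply/funext => j; rewrite /pseries_diffs /coefs iterSr factS natrM invfM mulrCA.
by rewrite mulVKf ?pnatr_eq0.
Qed.

Let cvg_coefs y x (t : R) : cvgn (pseries (coefs y x) t).
Proof.
apply: normed_cvg; rewrite /=.
have iterb j : `|ip y (iter j xi x)| <= N1 y * (M ^+ j * N1 x).
  apply: le_trans (ip_bound _ _) _; apply: ler_wpM2l; first exact: N1_ge0.
  elim: j => [|j IH]; first by rewrite mul1r.
  apply: le_trans (N1_xi _) _; rewrite exprS -mulrA; apply: ler_wpM2l => //.
apply: (@series_le_cvg _ _ (fun j => (N1 y * N1 x) *: exp_coeff (M * `|t|) j)).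
- by move=> j; apply: normr_ge0.
- move=> j; apply: mulr_ge0; first exact: mulr_ge0.
  by apply: exp_coeff_ge0; apply: mulr_ge0.
- move=> j; rewrite /coefs /exp_coeff /= !normrM normfV normrX normr_nat exprMn.
  rewrite [leRHS](_ : _ = N1 y * (M ^+ j * N1 x) * (j`!%:R^-1 * `|t| ^+ j)); last first.
    rewrite /GRing.scale /=; ring.
  by rewrite -mulrA; apply: ler_wpM2r; rewrite ?mulr_ge0 ?invr_ge0 ?exprn_ge0.
- by apply: is_cvg_seriesZ; apply: is_cvg_series_exp_coeff.
Qed.

Local Notation E t := (lfun_exp (t *: xi)).

Let iterE (t : R) j x : iter j (comp_lfun (t *: xi)) \1%VF x = t ^+ j *: iter j xi x.
Proof.
elim: j => [|j IH] /=; first by rewrite id_lfunE scale1r.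
by rewrite comp_lfunE IH scale_lfunE linearZ scalerA -exprS.
Qed.

Let partial (t : R) m : 'End(W) :=
  \sum_(j < m) (j`!)%:R^-1 *: iter j (comp_lfun (t *: xi)) \1%VF.

Let entry_partial y x t :
  (fun m => entry ip y x (partial t m) : R) = pseries (coefs y x) t.
Proof.
apply/funext => m; rewrite /entry /partial sum_lfunE ip_sumr /pseries /series /= big_mkord.
apply: eq_bigr => j _; rewrite scale_lfunE iterE !ipZr /coefs.
by move: (t ^+ j) (j`!%:R^-1) => p q; ring.
Qed.

Let cvg_partial (phi : {scalar 'End(W)}) t :
  (fun m => phi (partial t m) : R) @ \oo --> (phi (E t) : R).
Proof.
apply: (@vlim_scalar _ _ _ (pairs e) (fun p => entry ip e`_p.1 e`_p.2)
         (fun p => unit_lfun ip e`_p.1 e`_p.2)) => [g|p]; first exact: lfun_frame.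
by rewrite -/(partial t) entry_partial; apply: cvg_coefs.
Qed.

Let ip_exp y x t : ip y (E t x) = limn (pseries (coefs y x) t).
Proof.
have := @cvg_partial (entry ip y x) t; rewrite entry_partial.
by move/(cvg_lim (@Rhausdorff R)); rewrite /entry.
Qed.

Lemma exp_comm t x : E t (xi x) = xi (E t x).
Proof.
apply: (@ip_inj _ _ ip) => y; rewrite !(ipC _ _ y).
have lin : scalar (fun g : 'End(W) => ip y (xi (g x))).
  by move=> a g h; rewrite add_lfunE scale_lfunE linearD linearZ ipDr ipZr.
pose phi : {scalar 'End(W)} := HB.pack (fun g : 'End(W) => ip y (xi (g x)))
  (GRing.isLinear.Build _ _ _ _ _ lin).
have c1 := @cvg_partial (entry ip y (xi x)) t.
have c2 := @cvg_partial phi t.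
suff phiE : (fun m => phi (partial t m) : R) = (fun m => entry ip y (xi x) (partial t m) : R).
  by rewrite phiE in c2; exact: (cvg_unique (@Rhausdorff R) c1 c2).
apply/funext => m /=.
rewrite /entry /partial !sum_lfunE linear_sum !ip_sumr; apply: eq_bigr => j _ /=.
by rewrite !scale_lfunE !iterE -iterSr !linearZ.
Qed.

(** The entries of [exp(t xi)] are power series in [t], dominated by the exponential
    series of [M |t|] where [M] is the sum of the absolute entries of [xi]; they are
    differentiated term by term. *)
Lemma is_derive_exp (y x : W) (t : R) :
  is_derive t 1 (fun s => ip y (E s x) : R) (ip y (xi (E t x))).
Proof.
rewrite -exp_comm ip_exp -coefs_diffs.
have -> : (fun s => ip y (E s x) : R) = (fun s => limn (pseries (coefs y x) s)).
  by apply/funext => s; rewrite ip_exp.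
apply: (@pseries_snd_diffs _ _ (`|t| + 1)); rewrite ?coefs_diffs ?coefs_diffs; try exact: cvg_coefs.
by rewrite [ltRHS]ger0_norm ?addr_ge0 // ltrDl.
Qed.

Lemma exp0 x : E 0 x = x.
Proof.
apply: (@ip_inj _ _ ip) => y; rewrite !(ipC _ _ y).
have c0 : (fun m => entry ip y x (partial 0 m) : R) @ \oo --> (ip y x : R).
  apply: cvg_near_cst; exists 1%N => // m /= m0.
  rewrite /entry /partial sum_lfunE; case: m m0 => // m _.
  rewrite big_ord_recl big1 => [|j _]; last first.
    by rewrite scale_lfunE iterE expr0n scale0r scaler0.
  by rewrite scale_lfunE iterE invr1 !scale1r addr0.
exact: (cvg_unique (@Rhausdorff R) (@cvg_partial (entry ip y x) 0) c0).
Qed.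

End Exponential.

Section LieAction.
Variables (R : realType) (W : vectType R).

(** The derivation that [xi] induces on forms, slot by slot. *)
Definition lie_ev k (xi : 'End(W)) (f : altform W k) (s : seq W) : R :=
  \sum_(i <- iota 0 (size s)) ev f (take i s ++ xi s`_i :: drop i.+1 s).

Lemma lie_ev_cons k xi (f : altform W k.+1) x s :
  lie_ev xi f (x :: s) = ev f (xi x :: s) + lie_ev xi (interior_product x f) s.
Proof.
rewrite /lie_ev /= big_cons /= drop0; congr (_ + _).
rewrite -[1%N]addn0 iotaDl big_map; apply: eq_bigr => i _.
by rewrite ev_interior.
Qed.

Lemma lie_ev_interior_sum k xi (f : altform W k.+1) (r : seq nat) (c : nat -> R) (v : nat -> W) s :
  lie_ev xi (interior_product (\sum_(i <- r) c i *: v i) f) s =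
  \sum_(i <- r) c i * lie_ev xi (interior_product (v i) f) s.
Proof.
under [RHS]eq_bigr do rewrite /lie_ev mulr_sumr.
rewrite exchange_big; apply: eq_bigr => j _; rewrite ev_interior.
rewrite (@ev_slot_sum _ _ _ f [::]) //; apply: eq_bigr => i _.
by rewrite ev_interior.
Qed.

Variables (ip : {dot W for idfun}) (e : seq W).
Hypothesis eO : onb ip e.
Variable xi : 'End(W).
Local Notation E t := (lfun_exp (t *: xi)).

Lemma is_derive_ev_exp k (f : altform W k) s (t : R) : size s = k ->
  is_derive t 1 (fun u => ev f (map (E u) s)) (lie_ev xi f (map (E t) s)).
Proof.
elim: k f s => [|k IH] f [|x s] //=.
  by move=> _; rewrite /lie_ev big_nil; apply: is_derive_cst.
move=> /eqP; rewrite eqSS => /eqP sz; have fE u : ev f (E u x :: map (E u) s) =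
    \sum_(i <- iota 0 (size e)) ip e`_i (E u x) * ev (interior_product e`_i f) (map (E u) s).
  rewrite {1}(frame_expand eO erefl (E u x)) (@ev_slot_sum _ _ _ f [::]) //.
  by apply: eq_bigr => i _; rewrite ev_interior.
under eq_fun do rewrite fE.
rewrite lie_ev_cons [X in interior_product X](frame_expand eO erefl) lie_ev_interior_sum.
rewrite {1}(frame_expand eO erefl (xi _)) (@ev_slot_sum _ _ _ f [::]) // -big_split /=.
apply: is_derive_bigsum => i.
apply: is_derive_eq (is_deriveM (is_derive_exp eO xi e`_i x t) (IH (interior_product e`_i f) s sz)) _.
by rewrite /GRing.scale /= ev_interior addrC mulrC [X in _ + X]mulrC addrC mulrC.
Qed.

Lemma derivable_ev_exp k (f : altform W k) s (t : R) : size s = k ->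
  derivable (fun u : R => ev f (map (E u) s) : R) t 1.
Proof. by move=> sz; have [] := is_derive_ev_exp f t sz. Qed.

Fact ev_scalar k (s : seq W) : scalar (fun f : altform W k => ev f s).
Proof. by []. Qed.

Definition ev_at k (s : seq W) : {scalar altform W k} :=
  HB.pack (fun f : altform W k => ev f s)
    (GRing.isLinear.Build R (altform W k) R *%R (fun f => ev f s) (ev_scalar s)).

Lemma form_frame k (f : altform W k) :
  f = \sum_(j < size (idx (size e) k))
        ev_at k (map (nth 0 e) (nth [::] (idx (size e) k) j)) f *:
        dual_form ip e k (nth [::] (idx (size e) k) j).
Proof.
by rewrite -{1}(kappaK eO erefl f) /kinv; apply: eq_bigr => j _; rewrite mxE.
Qed.

Lemma curve_scalar k (f : altform W k) (phi : {scalar altform W k}) :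
  is_derive (0 : R) 1 (fun t => phi (pullback (E t) f) : R) (phi (lie_derivative xi f)).
Proof.
apply: (@vderive_scalar _ _ _ (index_enum 'I_(size (idx (size e) k)))
  (fun j => ev_at k (map (nth 0 e) (nth [::] (idx (size e) k) j))) _ (@form_frame k)) => j.
have sz : size (map (nth 0 e) (nth [::] (idx (size e) k) j)) = k.
  by rewrite size_map; apply/eqP/(allP (size_combs (iota 0 (size e)) k))/mem_nth.
rewrite [X in derivable X](_ : _ = fun t : R => ev f (map (E t) (map (nth 0 e) (nth [::] (idx (size e) k) j)))).
  exact: derivable_ev_exp.
by apply/funext => t; rewrite /= ev_pullback.
Qed.

Lemma is_derive_uniq (f : R -> R) (t a b : R) :
  is_derive t 1 f a -> is_derive t 1 f b -> a = b.
Proof. by move=> [_ <-] [_ <-]. Qed.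

Lemma exp0_map s : map (E 0) s = s.
Proof. by rewrite -[RHS]map_id; apply: eq_map => x; apply: exp0 eO _ _. Qed.

Lemma ev_lie_derivative k (f : altform W k) s : size s = k ->
  ev (lie_derivative xi f) s = lie_ev xi f s.
Proof.
move=> sz; apply: (is_derive_uniq (curve_scalar f (ev_at k s))).
rewrite -[X in lie_ev _ _ X]exp0_map.
rewrite [X in is_derive _ _ X](_ : _ = fun t : R => ev f (map (E t) s)).
  exact: is_derive_ev_exp.
by apply/funext => t; rewrite /= ev_pullback.
Qed.

(** The curve [exp(t xi)^* Phi] has derivative [exp(t xi)^* (L_xi Phi)], so it is
    constant as soon as [L_xi Phi = 0]. The nondegeneracy of [Phi] then makes [exp(t
    xi)] injective. *)
Lemma lie_algebraP k (Phi : altform W k.+1) :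
  (forall x, (forall s, size s = k -> ev Phi (x :: s) = 0) -> x = 0) ->
  lie_algebra (stabilizer Phi) xi <-> lie_derivative xi Phi = 0.
Proof.
move=> nondeg; split=> [g|L0].
  apply: ev_eqP => s sz.
  apply: (is_derive_uniq (curve_scalar Phi (ev_at k.+1 s))).
  rewrite [X in is_derive _ _ X](_ : _ = cst (ev Phi s)); first exact: is_derive_cst.
  by apply/funext => t; have [_ /= ->] := g t.
have inv t s : size s = k.+1 -> ev Phi (map (E t) s) = ev Phi s.
  move=> sz; rewrite -[in RHS](exp0_map s).
  apply: (@is_derive_0_is_cst _ (fun u : R => ev Phi (map (E u) s))) => u.
  rewrite -[X in is_derive _ _ _ X](_ : lie_ev xi Phi (map (E u) s) = _).
    exact: is_derive_ev_exp.
  by rewrite -ev_lie_derivative ?size_map // L0.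
move=> t; split; last by apply: ev_eqP => s sz; rewrite ev_pullback inv.
apply/eqP; rewrite -subv0; apply/subvP => x; rewrite memv_ker memv0 => /eqP Ex.
apply/eqP/nondeg => s sz; rewrite -(inv t) /= ?sz // Ex.
exact: (@ev_slot0 _ _ _ Phi [::]).
Qed.

(** A subspace contains the velocity of every curve inside it: the functionals [h
    |-> coord i (h - projv U h)], whose common kernel is [U], vanish along the
    curve. *)
Lemma lie_derivative_mem k (G : set 'End(W)) (U : {vspace altform W k}) f :
  invariant_subspace G U -> lie_algebra G xi -> f \in U -> lie_derivative xi f \in U.
Proof.
move=> invU gxi fU; pose b := vbasis {:altform W k}.
suff H i : coord b i (lie_derivative xi f - projv U (lie_derivative xi f)) = 0.
  rewrite -(subrK (projv U (lie_derivative xi f)) (lie_derivative xi f)).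
  rewrite [X in X + _](coord_vbasis (memvf _)) big1 ?add0r ?memv_proj // => i _.
  by rewrite H scale0r.
have lin : scalar (fun h : altform W k => coord b i (h - projv U h)).
  move=> a g h; rewrite -[RHS]linearP; congr (coord b i _).
  by rewrite linearP opprD scalerBr addrACA.
pose phi : {scalar altform W k} := HB.pack (fun h : altform W k => coord b i (h - projv U h))
  (GRing.isLinear.Build _ _ _ _ _ lin).
apply: (is_derive_uniq (curve_scalar f phi)).
rewrite [X in is_derive _ _ X](_ : _ = cst 0); first exact: is_derive_cst.
by apply/funext => t /=; rewrite projv_id ?subrr ?linear0 // invU.
Qed.

End LieAction.

(** * Integer matrices and an irreducibility criterion *)

Definition zmat := seq (seq Z).
Definition entz (M : zmat) i j : Z := nth 0%ZZ (nth [::] M i) j.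

Fixpoint dotz (u v : seq Z) : Z :=
  match u, v with x :: u', y :: v' => Z.add (Z.mul x y) (dotz u' v') | _, _ => 0%ZZ end.

(** [A B^T] instead of [A B], so that all products are taken between rows. *)
Definition mulzT (A B : zmat) : zmat := [seq [seq dotz r c | c <- B] | r <- A].

Definition tabz m n (f : nat -> nat -> Z) : zmat :=
  [seq [seq f i j | j <- iota 0 n] | i <- iota 0 m].

Definition trz n (A : zmat) : zmat := [seq [seq nth 0%ZZ r j | r <- A] | j <- iota 0 n].

Definition narrow n (A : zmat) := all (fun r => size r <= n)%N A.

Fixpoint linz (a : Z) (u : seq Z) (b : Z) (v : seq Z) : seq Z :=
  match u, v with
  | x :: u', y :: v' => Z.add (Z.mul a x) (Z.mul b y) :: linz a u' b v'
  | [::], _ => [seq Z.mul b y | y <- v]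
  | _, [::] => [seq Z.mul a x | x <- u]
  end.

Section IntegerMatrices.
Variable R : realType.
Local Notation zr := (zr R).

Definition zmx m n (M : zmat) : 'M[R]_(m, n) := \matrix_(i, j) zr (entz M i j).
Definition zrow n (u : seq Z) : 'rV[R]_n := \row_j zr (nth 0%ZZ u j).

Lemma zr_dotz n u v : (size u <= n)%N ->
  zr (dotz u v) = \sum_(j < n) zr (nth 0%ZZ u j) * zr (nth 0%ZZ v j).
Proof.
elim: u v n => [|x u IH] [|y v] [|n] //= le;
  try by rewrite big1 // => j _; rewrite nth_nil ?mul0r ?mulr0.
by rewrite zrD zrM big_ord_recl (IH _ n).
Qed.

Lemma dotzC u v : dotz u v = dotz v u.
Proof. by elim: u v => [|x u IH] [|y v] //=; rewrite IH Z.mul_comm. Qed.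

Lemma zmx_mulzT m n p A B : narrow n A -> zmx m p (mulzT A B) = zmx m n A *m (zmx p n B)^T.
Proof.
move=> nA; apply/matrixP => i j; rewrite !mxE /entz.
under eq_bigr do rewrite !mxE /entz.
have [lti|gei] := ltnP i (size A); last first.
  rewrite ![nth [::] _ i]nth_default ?size_map // nth_nil big1 // => k _.
  by rewrite nth_nil mul0r.
rewrite (nth_map [::]) // -zr_dotz; last by apply: (all_nthP [::] nA).
have [ltj|gej] := ltnP j (size B); first by rewrite (nth_map [::]).
by rewrite nth_default ?size_map // [nth [::] B j]nth_default // dotzC.
Qed.

Lemma zmx_tabz m n f : zmx m n (tabz m n f) = \matrix_(i, j) zr (f i j).
Proof.
apply/matrixP => i j; rewrite !mxE /entz (nth_map 0%N) ?size_iota //.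
by rewrite (nth_map 0%N) ?size_iota // !nth_iota.
Qed.

Lemma row_zmx m n M (i : 'I_m) : row i (zmx m n M) = zrow n (nth [::] M i).
Proof. by apply/rowP => j; rewrite !mxE. Qed.

Lemma nth_linz a u b v j :
  nth 0%ZZ (linz a u b v) j = Z.add (Z.mul a (nth 0%ZZ u j)) (Z.mul b (nth 0%ZZ v j)).
Proof.
elim: u v j => [|x u IH] [|y v] [|j] //=; rewrite ?IH ?nth_nil ?Z.mul_0_r ?Z.add_0_r //.
- have [lt|ge] := ltnP j (size v); first by rewrite (nth_map 0%ZZ).
  by rewrite !nth_default ?size_map // Z.mul_0_r.
- have [lt|ge] := ltnP j (size u); first by rewrite (nth_map 0%ZZ).
  by rewrite !nth_default ?size_map // Z.mul_0_r.
Qed.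

Lemma zrow_linz n a u b v : zrow n (linz a u b v) = zr a *: zrow n u + zr b *: zrow n v.
Proof. by apply/rowP => j; rewrite !mxE nth_linz zrD !zrM. Qed.

Lemma zrow_mulmx n m u (M : zmat) : narrow n M ->
  zrow n u *m (zmx m n M)^T = zrow m [seq dotz u r | r <- M].
Proof.
move=> nM; apply/rowP => i; rewrite !mxE; under eq_bigr do rewrite !mxE /entz.
have [lti|gei] := ltnP i (size M); last first.
  have -> : nth 0%ZZ [seq dotz u r | r <- M] i = 0%ZZ by rewrite nth_default ?size_map.
  by rewrite big1 // => k _; rewrite [nth [::] M i]nth_default // nth_nil mulr0.
rewrite (nth_map [::]) // dotzC (@zr_dotz n); last by apply: (all_nthP [::] nM).
by apply: eq_bigr => k _; rewrite mulrC.
Qed.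

End IntegerMatrices.

Definition reduce_by (w : seq Z) (pr : nat * seq Z) : seq Z :=
  let: (p, r) := pr in let wp := nth 0%ZZ w p in let rp := nth 0%ZZ r p in
  if Z.eqb wp 0 || Z.eqb rp 0 then w else linz rp w (Z.opp wp) r.

Definition reduce (rows : seq (nat * seq Z)) (w : seq Z) : seq Z := foldl reduce_by w rows.

Definition nullz (w : seq Z) := all (Z.eqb 0) w.

(** Spinning: [todo] holds vectors to be reduced against [rows], and every new row
    sends its images under [gens] to [todo]. Only the inclusion of the result in
    stable subspaces is ever used, so neither termination nor independence has to be
    established. *)
Fixpoint cyclic_span (fuel : nat) (gens : seq zmat) (rows : seq (nat * seq Z))
    (todo : seq (seq Z)) : seq (nat * seq Z) :=
  if fuel is fuel'.+1 then
    if todo is w :: todo' then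
      let w' := reduce rows w in
      if nullz w' then cyclic_span fuel' gens rows todo'
      else cyclic_span fuel' gens (rcons rows (find (fun x => ~~ Z.eqb 0 x) w', w'))
             (todo' ++ [seq [seq dotz w' r | r <- L] | L <- gens])
    else rows
  else rows.

Section CyclicSpan.
Variables (R : realType) (n m : nat) (U : 'M[R]_(m, n)) (gens : seq zmat).
Hypothesis gens_narrow : all (narrow n) gens.
Hypothesis gens_stable : forall L, L \in gens -> (U *m (zmx R n n L)^T <= U)%MS.

Let inU w := (zrow R n w <= U)%MS.

Lemma reduce_by_span pr w : inU pr.2 -> inU (reduce_by w pr) = inU w.
Proof.
case: pr => p r /= rU; case: ifP => // /norP[_ rp].
have rp0 : zr R (nth 0%ZZ r p) != 0 by rewrite zr_eq0.
rewrite /inU zrow_linz -(eqmx_scale (zrow R n w) rp0).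
set a := _ *: zrow R n w; set d := _ *: zrow R n r.
have dU : (d <= U)%MS by apply: scalemx_sub.
apply/idP/idP => [adU|aU]; last exact: addmx_sub.
by rewrite -[a](addrK d) addmx_sub // -scaleN1r scalemx_sub.
Qed.

Lemma reduce_span rows w : all (fun pr => inU pr.2) rows -> inU (reduce rows w) = inU w.
Proof.
by elim: rows w => //= pr rows IH w /andP[prU rowsU]; rewrite IH // reduce_by_span.
Qed.

Lemma cyclic_span_sub fuel rows todo :
  all (fun pr => inU pr.2) rows -> all inU todo ->
  all (fun pr => inU pr.2) (cyclic_span fuel gens rows todo).
Proof.
elim: fuel rows todo => //= fuel IH rows [//|w todo] rowsU /= /andP[wU todoU].
have w'U : inU (reduce rows w) by rewrite reduce_span.
case: ifP => _; apply: IH => //; first by rewrite all_rcons w'U.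
rewrite all_cat todoU all_map; apply/allP => L Lg /=.
rewrite /inU -(@zrow_mulmx _ n) ?(allP gens_narrow) //.
by apply: submx_trans (gens_stable Lg); apply: submxMr.
Qed.

Lemma nullz_zrow w : nullz w -> zrow R n w = 0.
Proof.
move=> /allP w0; apply/rowP => j; rewrite !mxE.
have [lt|ge] := ltnP j (size w); last by rewrite nth_default.
by have /Z.eqb_eq <- := w0 _ (mem_nth 0%ZZ lt).
Qed.

Lemma cyclic_span_full fuel v (P : zmat) : inU v ->
  all (fun r => nullz (reduce (cyclic_span fuel gens [::] [:: v]) r)) P ->
  (zmx R n n P <= U)%MS.
Proof.
move=> vU /all_nthP PU; apply/row_subP => i; rewrite row_zmx -/(inU _).
have [lt|ge] := ltnP i (size P); last first.
  by rewrite /inU nth_default // nullz_zrow // sub0mx.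
rewrite -(reduce_span (rows := cyclic_span fuel gens [::] [:: v])).
  by rewrite /inU nullz_zrow ?sub0mx // PU.
by apply: cyclic_span_sub => //=; rewrite vU.
Qed.

End CyclicSpan.

Section Irreducibility.
Variables (R : realType) (n : nat) (P : 'M[R]_n) (gens : seq 'M[R]_n) (s c : R) (v : 'rV[R]_n).
Hypothesis s0 : s != 0.
Hypothesis PP : P *m P = s *: P.
Hypothesis Psym : P^T = P.
Hypothesis gens_sym : forall g, g \in gens -> g^T = g \/ g^T = - g.
Let stable m (U : 'M[R]_(m, n)) := forall g, g \in gens -> (U *m g <= U)%MS.
Variable word : seq 'M[R]_n.
Hypothesis word_gens : {subset word <= gens}.
Hypothesis rank_one : c *: (P *m foldr mulmx 1%:M word) = v^T *m v.
Hypothesis cyclic : forall U : 'M[R]_n, stable U -> (v <= U)%MS -> (P <= U)%MS.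

(** If [U] pairs nontrivially with [v], then the rank-one element [v^T v] of the
    algebra puts [v] into [U], and [v] generates everything. Otherwise [v] lies in
    the orthogonal of [U], which is stable because the generators are symmetric or
    skew; so [P] is orthogonal to [U], and [U = 0]. *)
Lemma irreducible_matrix (U : 'M[R]_n) : stable U -> (U <= P)%MS -> U = 0 \/ (P <= U)%MS.
Proof.
move=> stU UP; have UPs : U *m P = s *: U.
  by case/submxP: UP => X ->; rewrite -mulmxA PP -scalemxAr.
have stw : (U *m foldr mulmx 1%:M word <= U)%MS.
  elim: word word_gens => [|g w IH] sub /=; first by rewrite mulmx1.
  rewrite mulmxA; apply: submx_trans (submxMr _ (stU g _)) _; first by rewrite sub ?mem_head.
  by apply: IH => h hw; rewrite sub // inE hw orbT.
have [Uv0|Uv] := eqVneq (U *m v^T) 0; last first.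
  right; apply: cyclic => //.
  have [i vi0] : exists i, (U *m v^T) i 0 != 0.
    apply/existsP; apply: contraNT Uv; rewrite negb_exists => /forallP z.
    by apply/eqP/matrixP => i j; rewrite (ord1 j) !mxE; move/negPn/eqP: (z i); rewrite !mxE.
  have : ((U *m v^T) i 0 *: v <= U)%MS.
    have -> : (U *m v^T) i 0 *: v = row i (U *m v^T *m v).
      by apply/rowP => j; rewrite !mxE big_ord1 /= mxE.
    rewrite -mulmxA -rank_one -scalemxAr mulmxA UPs -scalemxAl scalerA.
    by apply: submx_trans (row_sub _ _) _; apply: scalemx_sub.
  by move/(scalemx_sub ((U *m v^T) i 0)^-1); rewrite scalerA mulVf // scale1r.
left; pose K := kermx U^T.
have stK : stable K.
  move=> g gg; apply/sub_kermxP.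
  have [X XE] : exists X, U *m g^T = X *m U.
    apply/submxP; have [->|->] := gens_sym gg; first exact: stU.
    by rewrite mulmxN -scaleN1r; apply: scalemx_sub; apply: stU.
  rewrite -mulmxA -[g]trmxK -trmx_mul XE trmx_mul mulmxA.
  by rewrite (_ : K *m U^T = 0) ?mul0mx //; apply/sub_kermxP.
have /cyclic-/(_ stK) PK : (v <= K)%MS.
  by apply/sub_kermxP; rewrite -[v]trmxK -trmx_mul Uv0 trmx0.
have /sub_kermxP := PK => PU0.
have : U *m P = 0 by rewrite -Psym -[U]trmxK -trmx_mul PU0 trmx0.
by rewrite UPs => /eqP; rewrite scaler_eq0 (negPf s0) => /eqP.
Qed.

End Irreducibility.

(** A full rank factorisation [p = C B] of an idempotent satisfies [B C = 1]. *)
Lemma mxrank_idempotent (F : numFieldType) n (p : 'M[F]_n) : p *m p = p -> \tr p = (\rank p)%:R.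
Proof.
move=> pp; have [B rB] := row_freeP (row_base_free p).
have [C cC] := row_fullP (col_base_full p).
have key : forall (k : nat) (cb : 'M[F]_(n, k)) (rb : 'M[F]_(k, n))
    (D1 : 'M[F]_(n, k)) (D2 : 'M[F]_(k, n)),
    D2 *m cb = 1%:M -> rb *m D1 = 1%:M -> cb *m rb *m (cb *m rb) = cb *m rb ->
    rb *m cb = 1%:M.
  move=> k cb rb D1 D2 lcb rrb /(congr1 (fun X => D2 *m X *m D1)).
  by rewrite !mulmxA lcb !mul1mx -!mulmxA rrb mulmx1.
have E := mulmx_base p.
rewrite -[X in \tr X]E mxtrace_mulC (key _ _ _ _ _ cC rB) ?mxtrace1 //.
by rewrite !mulmx_base.
Qed.

(** * The Cayley form over the integers *)

(** The calibration at an arbitrary multi-index, [cayley_coef] being its values at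
    increasing ones. *)
Definition cayley_val (I : seq nat) : Z :=
  let: (c, J) := sign_sort I in Z.mul c (cayley_coef J).

(** The matrix of the operator whose coefficient at [J] is the combination [lc J] of
    the coefficients of its argument. *)
Definition op_mat k k' (lc : seq nat -> seq (Z * seq nat)) : zmat :=
  [seq lin_row 8 k (lc J) | J <- idx 8 k'].

Definition lc_wedge (J : seq nat) : seq (Z * seq nat) :=
  [seq (Z.mul (sgz q.1.1) (cayley_coef q.1.2), q.2) | q <- splits 4 J].

Definition lc_star k (J : seq nat) : seq (Z * seq nat) :=
  [seq (sgz q.1.1, q.1.2) | q <- splits k (iota 0 8) & q.2 == J].

Definition lc_comp (f g : seq nat -> seq (Z * seq nat)) (J : seq nat) : seq (Z * seq nat) :=
  flatten [seq [seq (Z.mul p.1 q.1, q.2) | q <- g p.2] | p <- f J].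

(** The operator [*(Phi ∧ .)] on 2-forms: its entries are again those of [Phi]. *)
Definition Tz : zmat := [seq [seq cayley_val (K ++ J) | J <- idx 8 2] | K <- idx 8 2].
(** The map from [u] to [ι(u)Phi]. *)
Definition Az : zmat := [seq [seq cayley_val (i :: J) | J <- idx 8 3] | i <- iota 0 8].
(** The Hodge operator on 4-forms. *)
Definition Sz : zmat := op_mat 4 4 (lc_star 4).
Definition fz : zmat := [:: [seq cayley_coef J | J <- idx 8 4]].

Definition lc_lie (X : seq (nat * nat * Z)) (J : seq nat) : seq (Z * seq nat) :=
  flatten [seq [seq (t.2, take i J ++ t.1.1 :: drop i.+1 J) | t <- X & t.1.2 == nth 0%N J i]
          | i <- iota 0 (size J)].

Definition lie_mat k X := op_mat k k (lc_lie X).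

(** [L_xi Phi] for the matrix unit [xi = e_a ⊗ e_b^*]. *)
Definition lie_row a b : seq Z :=
  [seq foldr Z.add 0%ZZ [seq Z.mul q.1 (cayley_val q.2) | q <- lc_lie [:: (a, b, 1%ZZ)] J] | J <- idx 8 4].
Definition index_pairs := [seq (a, b) | a <- iota 0 8, b <- iota 0 8].
Definition Dz : zmat := [seq lie_row p.1 p.2 | p <- index_pairs].
(** The map from [xi] to [L_xi Phi], restricted to skew [xi]. *)
Definition D2z : zmat :=
  [seq let: (a, b) := (nth 0%N K 0, nth 0%N K 1) in linz 1 (lie_row a b) (-1) (lie_row b a)
  | K <- idx 8 2].

Definition deltaz (i j : nat) : Z := if i == j then 1%ZZ else 0%ZZ.

(** Integer multiples of the orthogonal projections onto the summands. *)
Definition P2_7 := tabz 28 28 (fun i j => Z.add (entz Tz i j) (deltaz i j)).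
Definition P2_21 := tabz 28 28 (fun i j => Z.sub (Z.mul 3 (deltaz i j)) (entz Tz i j)).
Definition P3_8 := mulzT (trz 56 Az) (trz 56 Az).
Definition P3_48 := tabz 56 56 (fun i j => Z.sub (Z.mul 7 (deltaz i j)) (entz P3_8 i j)).
Definition P4_1 := mulzT (trz 70 fz) (trz 70 fz).
Definition P4_7 := [seq [seq Z.div x 4 | x <- r] | r <- mulzT (trz 70 D2z) (trz 70 D2z)].
Definition P4_35 := tabz 70 70 (fun i j => Z.sub (deltaz i j) (entz Sz i j)).
Definition P4_27 := tabz 70 70 (fun i j =>
  Z.sub (Z.mul 28 (Z.add (deltaz i j) (entz Sz i j)))
        (Z.add (Z.mul 4 (entz P4_1 i j)) (Z.mul 7 (entz P4_7 i j)))).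

Definition skew2 a b c d (z : Z) : seq (nat * nat * Z) :=
  [:: (a, b, 1%ZZ); (b, a, (-1)%ZZ); (c, d, z); (d, c, Z.opp z)].

(** Five elements of the Lie algebra of the stabilizer; they generate enough of it
    for the irreducibility of all summands. *)
Definition spin_gens : seq (seq (nat * nat * Z)) :=
  [:: skew2 1 2 5 6 1; skew2 1 2 4 7 (-1); skew2 0 1 6 7 (-1); skew2 0 2 1 3 (-1); skew2 0 4 2 6 (-1)].

(** Codewords of the extended Hamming code on eight letters: changing the signs of
    the [e_i] with [i] in a codeword preserves [Phi]. *)
Definition sign_codes : seq (seq nat) := [:: [:: 0; 1; 2; 3]; [:: 0; 1; 4; 5]; [:: 0; 2; 4; 6]]%N.

Definition code_sign (c J : seq nat) : Z := sgz (odd (count (mem c) J)).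

(** Averaging over the sign changes against the character of [J0] multiplies by 8
    the coordinates [J] on which they act as on [J0], and kills the others. *)
Definition mask_val (J0 J : seq nat) : Z :=
  foldr Z.mul 1%ZZ [seq Z.add 1 (Z.mul (code_sign c J0) (code_sign c J)) | c <- sign_codes].

Definition mask_mat k J0 : zmat :=
  let I := idx 8 k in
  [seq [seq if J == J' then mask_val J0 J else 0%ZZ | J' <- I] | J <- I].

Definition act_word (P : zmat) (ws : seq zmat) : zmat := foldl mulzT P ws.

Definition pivot (M : zmat) : nat := find (fun i => ~~ Z.eqb 0 (entz M i i)) (iota 0 (size M)).

Definition gcdz_seq (u : seq Z) : Z := foldr Z.gcd 0%ZZ u.

(** The primitive vector [v] if [M] is proportional to [v^T v]. *)
Definition seed (M : zmat) : seq Z :=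
  let r := nth [::] M (pivot M) in let g := gcdz_seq r in [seq Z.div x g | x <- r].

Definition word_mat k J0 Xs : seq zmat :=
  mask_mat k J0 :: flatten [seq [:: lie_mat k X; lie_mat k X] | X <- Xs].

Definition gen i := nth [::] spin_gens i.

(** * Eigenspaces and orthogonal splittings *)

(** Multiplying the sum by [p j] on both sides gives [\sum_(k != j) (p k p j)^T (p k
    p j) = 0], a sum of positive semidefinite matrices. *)
Lemma orthogonal_projections (R : realType) n m (p : 'I_m -> 'M[R]_n) :
  (forall i, (p i)^T = p i) -> (forall i, p i *m p i = p i) -> \sum_i p i = 1%:M ->
  forall i j, i != j -> p i *m p j = 0.
Proof.
move=> psym pp p1 i j ij.
have sq (B : 'M[R]_n) : \tr (B^T *m B) = \sum_a \sum_b B b a ^+ 2.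
  by apply: eq_bigr => a _; rewrite mxE; apply: eq_bigr => b _; rewrite mxE expr2.
have sq_ge0 (B : 'M[R]_n) : 0 <= \tr (B^T *m B).
  by rewrite sq; apply: sumr_ge0 => a _; apply: sumr_ge0 => b _; apply: sqr_ge0.
have E k : (p k *m p j)^T *m (p k *m p j) = p j *m p k *m p j.
  by rewrite trmx_mul !psym mulmxA -[p j *m p k *m p k]mulmxA pp.
have : \sum_(k | k != j) \tr ((p k *m p j)^T *m (p k *m p j)) = 0.
  under eq_bigr do rewrite E; rewrite -linear_sum /= -mulmx_suml -mulmx_sumr.
  have -> : \sum_(k | k != j) p k = 1%:M - p j by rewrite -p1 [in RHS](bigD1 j) //= [RHS]addrC addKr.
  by rewrite mulmxBr mulmx1 pp subrr mul0mx linear0.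
move/eqP; rewrite psumr_eq0 // => /allP/(_ i (mem_index_enum _)); rewrite ij /= sq.
rewrite psumr_eq0 => [/allP sq0|a _]; last by apply: sumr_ge0 => b _; apply: sqr_ge0.
apply/matrixP => b a; rewrite [RHS]mxE; apply/eqP.
have := sq0 a (mem_index_enum _); rewrite /= psumr_eq0 => [/allP/(_ b (mem_index_enum _))|c _]; last exact: sqr_ge0.
by rewrite /= sqrf_eq0.
Qed.

Section ProjectorSubspaces.
Variables (R : realType) (W : vectType R) (ip : {dot W for idfun}) (e : seq W).
Hypothesis eO : onb ip e.
Variables (n : nat) (k : nat).
Hypothesis en : size e = n.
Local Notation N := (size (idx n k)).
Local Notation kap := (@kappa R W e n k).
Local Notation kin := (@kinv R W ip e n k).

Fact kinv_linear : linear kin.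
Proof. by move=> a r s; apply: (kappa_inj eO en); rewrite linearP /= !kinvK. Qed.
HB.instance Definition _ := GRing.isLinear.Build R 'rV[R]_N (altform W k) _ kin kinv_linear.

Definition eigen_forms (p : 'M[R]_N) : {vspace altform W k} :=
  lker (linfun (mulmxr (p - 1%:M) \o kap)).

Lemma mem_eigen_forms p f : f \in eigen_forms p <-> kap f *m p = kap f.
Proof.
rewrite memv_ker lfunE /= mulmxBr mulmx1 subr_eq0.
by split=> [/eqP|->].
Qed.

Lemma mem_eigen_forms_kinv p r : kin r \in eigen_forms p <-> r *m p = r.
Proof. by rewrite mem_eigen_forms kinvK. Qed.

Lemma dim_eigen_forms (p : 'M[R]_N) : p *m p = p -> \dim (eigen_forms p) = \rank p.
Proof.
move=> pp; pose h := linfun (kin \o mulmxr (row_base p)).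
have -> : eigen_forms p = (h @: {:'rV[R]_(\rank p)})%VS.
  apply/vspaceP => f; apply/idP/idP.
    move=> /mem_eigen_forms fp; have : (kap f <= row_base p)%MS.
      by rewrite eq_row_base -fp submxMl.
    case/submxP => r rE; apply/memv_imgP; exists r; first exact: memvf.
    by rewrite lfunE /= -rE (kappaK eO en).
  case/memv_imgP => r _ ->; rewrite lfunE /=; apply/mem_eigen_forms_kinv.
  have /submxP[X ->] : (r *m row_base p <= p)%MS.
    by rewrite -(eq_row_base p) submxMl.
  by rewrite -mulmxA pp.
rewrite limg_dim_eq; first by rewrite dimvf /dim /= mul1n.
apply/eqP; rewrite -subv0; apply/subvP => r; rewrite memv_cap memvf /= memv_ker memv0 lfunE /=.
move=> /eqP/(congr1 kap); rewrite linear0 (kinvK eO en) => r0.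
have /row_freeP[B rB] := row_base_free p.
by rewrite -[r]mulmx1 -rB mulmxA r0 mul0mx.
Qed.

Lemma dim_eigen_forms_trace (p : 'M[R]_N) d : p *m p = p -> \tr p = d%:R ->
  \dim (eigen_forms p) = d.
Proof.
move=> pp trd; rewrite dim_eigen_forms //; apply/eqP.
by rewrite -(eqr_nat R) -mxrank_idempotent // trd.
Qed.

Lemma form_ip_mx f g : form_ip ip f g = (kap f *m (kap g)^T) 0 0.
Proof.
rewrite (form_ip_kappa eO en) mxE; apply: eq_bigr => j _.
by rewrite [(kap g)^T _ _]mxE.
Qed.

Lemma splitting_eigen_forms m (L : m.-tuple {vspace altform W k}) (p : 'I_m -> 'M[R]_N) :
  (forall i, tnth L i = eigen_forms (p i)) -> (forall i, (p i)^T = p i) ->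
  (forall i, p i *m p i = p i) -> \sum_i p i = 1%:M -> orthogonal_splitting ip L.
Proof.
move=> LE psym pp p1; have pq := orthogonal_projections psym pp p1.
have mem i f : f \in tnth L i -> kap f *m p i = kap f by rewrite LE => /mem_eigen_forms.
split.
- apply/vspaceP => f; rewrite memvf.
  have -> : f = \sum_i kin (kap f *m p i).
    apply: (kappa_inj eO en); rewrite linear_sum /=.
    by under eq_bigr do rewrite (kinvK eO en); rewrite -mulmx_sumr p1 mulmx1.
  apply: memv_sumr => i _; rewrite LE; apply/mem_eigen_forms_kinv.
  by rewrite -mulmxA pp.
- apply/directv_sum_independent => u uL u0 i _.
  apply: (kappa_inj eO en); rewrite linear0 -(mem i _ (uL i isT)).
  have := congr1 (fun f => kap f *m p i) u0; rewrite linear0 mul0mx linear_sum /= mulmx_suml.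
  rewrite (bigD1 i) //= big1 ?addr0 // => j ji.
  by rewrite -(mem j _ (uL j isT)) -mulmxA pq // mulmx0.
- move=> i j f g ij /mem fi /mem gj.
  by rewrite form_ip_mx -fi -gj trmx_mul psym -mulmxA [p i *m _]mulmxA pq // mul0mx mulmx0 mxE.
Qed.

End ProjectorSubspaces.

Section CayleyCoordinates.
Variables (R : realType) (W : vectType R) (ip : {dot W for idfun}) (e : seq W).
Hypothesis eO : onb ip e.
Hypothesis e8 : size e = 8%N.
Variable Phi : altform W 4.
Hypothesis PhiE : forall J, J \in idx 8 4 -> fc e Phi J = zr R (cayley_coef J).
Local Notation zr := (zr R).
Local Notation zmx := (zmx R).
Local Notation N k := (size (idx 8 k)).
Local Notation kap := (kappa e 8).

Lemma fc_Phi J : size J = 4%N -> all (ltn^~ 8%N) J -> fc e Phi J = zr (cayley_val J).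
Proof.
move=> sz lt; rewrite (fc_sign_sort e Phi sz) /cayley_val.
have := sign_sort_idx sz lt; case: (sign_sort J) => c K /= H; rewrite zrM.
by have [->|/H/PhiE ->//] := eqVneq c 0%ZZ; rewrite !mul0r.
Qed.

Definition wf_lc k k' (lc : seq nat -> seq (Z * seq nat)) :=
  all (fun J => all (fun q => (size q.2 == k) && all (ltn^~ 8%N) q.2) (lc J)) (idx 8 k').

Lemma kappa_op k k' (f : altform W k) (h : altform W k') lc : wf_lc k k' lc ->
  (forall J, J \in idx 8 k' -> fc e h J = \sum_(q <- lc J) zr q.1 * fc e f q.2) ->
  kap h = kap f *m (zmx (N k') (N k) (op_mat k k' lc))^T.
Proof.
move=> /allP wf hE; apply/rowP => j; have Jj : nth [::] (idx 8 k') j \in idx 8 k' by rewrite mem_nth.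
rewrite mxE hE // (@fc_lin _ _ _ 8) ?wf // mxE; apply: eq_bigr => i _.
congr (_ * _); rewrite [in RHS]mxE mxE /entz /op_mat; congr (zr (nth _ _ _)).
by rewrite (nth_map [::] [::]).
Qed.

Lemma sub_idx k J K m : K \in combs J m -> J \in idx 8 k -> K \in idx 8 m.
Proof.
rewrite mem_combs => /andP[sub /eqP sz]; rewrite !mem_idx sz eqxx andbT => /and3P[srt lt _].
rewrite (subseq_sorted ltn_trans sub) //=; apply/allP => i /(mem_subseq sub).
exact: (allP lt).
Qed.

Lemma fc_wedge_Phi m (f : altform W m) J : J \in idx 8 (4 + m) ->
  fc e (Phi ∧ f) J = \sum_(q <- lc_wedge J) zr q.1 * fc e f q.2.
Proof.
move=> JI; have := JI; rewrite mem_idx => /and3P[_ _ /eqP szJ].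
rewrite ev_wedge_frame // big_map big_seq [RHS]big_seq; apply: eq_bigr => q qs.
rewrite PhiE ?zrM ?zr_sgz ?mulrA //; apply: sub_idx JI.
by rewrite -combs_splits; apply: (map_f (fun q => q.1.2)).
Qed.

Lemma ev_Phi_Phi : ev (Phi ∧ Phi) e = 14%:R.
Proof.
rewrite -(map_nth_iota0 e8) -[LHS]/(fc e _ _) (@fc_wedge_Phi 4) // big_map.
transitivity (zr (foldr Z.add 0%ZZ [seq Z.mul (Z.mul (sgz q.1.1) (cayley_coef q.1.2)) (cayley_coef q.2) | q <- splits 4 (iota 0 8)])).
  rewrite big_seq.
  have : all (fun q => q.2 \in idx 8 4) (splits 4 (iota 0 8)) by vm_compute.
  move=> /allP H; under eq_bigr => q qs do rewrite /= PhiE ?H // -zrM.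
  rewrite -big_seq; elim: (splits _ _) => [|q s IH]; first by rewrite big_nil.
  by rewrite big_cons /= zrD IH.
by set z := foldr _ _ _; have -> : z = 14%ZZ by vm_compute.
Qed.

Lemma form_ip_top (f : altform W 8) : form_ip ip f f = ev f e ^+ 2.
Proof.
rewrite (form_ip_idx eO e8) /idx -[X in combs _ X](size_iota 0 8) combs_full big_seq1.
by rewrite /fc (map_nth_iota0 e8) expr2.
Qed.

(** [Phi ∧ Phi] is [14] times the frame's volume form, so a Cayley frame is positive
    for the orientation. *)
Lemma ev_volume : ev (volume ip (Phi ∧ Phi) : altform W 8) e = 1.
Proof.
rewrite /volume [form_ip _ _ _](form_ip_top (Phi ∧ Phi)) evZ.
have E : ev (Phi ∧ Phi : altform W 8) e = 14%:R := ev_Phi_Phi.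
by rewrite E sqrtr_sqr ger0_norm // mulVf // pnatr_eq0.
Qed.

Lemma fc_star k m (vol : altform W (k + m)) (g : altform W k) J :
  (k + m)%N = 8%N -> ev vol e = 1 ->
  uniq [seq q.2 | q <- splits k (iota 0 8)] ->
  all (fun q => q.2 \in idx 8 m) (splits k (iota 0 8)) ->
  J \in [seq q.2 | q <- splits k (iota 0 8)] ->
  fc e (hodge ip k m vol g) J = \sum_(q <- lc_star k J) zr q.1 * fc e g q.2.
Proof.
move=> km vol1 us Is /mapP[q qs ->]; rewrite (fc_hodge eO e8) //.
by rewrite /lc_star (filter_map_uniq (h := snd)) //= big_seq1 zr_sgz.
Qed.

End CayleyCoordinates.

Definition scalez (c : Z) (M : zmat) : zmat := [seq [seq Z.mul c x | x <- r] | r <- M].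
Definition tracez n (M : zmat) : Z := foldr Z.add 0%ZZ [seq entz M i i | i <- iota 0 n].

Section ScaledProjectors.
Variable R : realType.
Local Notation zr := (zr R).
Local Notation zmx := (zmx R).

Lemma zmx_trz m n A : (zmx m n A)^T = zmx n m (trz n A).
Proof.
apply/matrixP => i j; rewrite !mxE /entz (nth_map 0%N) ?size_iota // nth_iota //.
have [lt|ge] := ltnP j (size A); first by rewrite (nth_map [::]).
by rewrite [nth [::] A j]nth_default // nth_nil nth_default ?size_map.
Qed.

Lemma zmx_scalez m n c A : zmx m n (scalez c A) = zr c *: zmx m n A.
Proof.
apply/matrixP => i j; rewrite !mxE -zrM /entz; congr (zr _).
have [lt|ge] := ltnP i (size A); last first.
  by rewrite ![nth [::] _ i]nth_default ?size_map // !nth_nil Z.mul_0_r.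
rewrite (nth_map [::]) //; set r := nth [::] A i.
have [lt'|ge'] := ltnP j (size r); first by rewrite (nth_map 0%ZZ).
by rewrite !nth_default ?size_map // Z.mul_0_r.
Qed.

Lemma zmx_null m n A : all nullz A -> zmx m n A = 0.
Proof.
move=> /all_nthP nA; apply/row_matrixP => i; rewrite row_zmx row0.
have [lt|ge] := ltnP i (size A); first by rewrite nullz_zrow // nA.
by rewrite nth_default // nullz_zrow.
Qed.

Lemma zr_sumz (s : seq Z) : zr (foldr Z.add 0%ZZ s) = \sum_(z <- s) zr z.
Proof. by elim: s => [|z s IH]; rewrite ?big_nil // big_cons -IH -zrD. Qed.

Lemma tr_zmx n A : \tr (zmx n n A) = zr (tracez n A).
Proof.
rewrite /tracez zr_sumz big_map -[n in iota 0 n]subn0 -/(index_iota 0 n) big_mkord.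
by apply: eq_bigr => i _; rewrite mxE.
Qed.

Definition prj n (q : Z * zmat) : 'M[R]_n := (zr q.1)^-1 *: zmx n n q.2.

(** [q = (s, M)] stands for the matrix [M / s]. *)
Definition prj_ok n (q : Z * zmat) :=
  [&& ~~ Z.eqb q.1 0, narrow n q.2, trz n q.2 == q.2 & mulzT q.2 q.2 == scalez q.1 q.2].

Lemma prj_sym n q : prj_ok n q -> (prj n q)^T = prj n q.
Proof. by case/and4P=> _ _ /eqP sym _; rewrite /prj linearZ /= zmx_trz sym. Qed.

Lemma zmx_prj_sq n q : prj_ok n q -> zmx n n q.2 *m zmx n n q.2 = zr q.1 *: zmx n n q.2.
Proof.
case/and4P=> _ nar /eqP sym /eqP sq.
by rewrite -{2}sym -zmx_trz -zmx_mulzT // sq zmx_scalez.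
Qed.

Lemma prj_idem n q : prj_ok n q -> prj n q *m prj n q = prj n q.
Proof.
move=> ok; rewrite /prj -scalemxAl -scalemxAr zmx_prj_sq // scalerK //.
by case/and4P: ok; rewrite zr_eq0.
Qed.

Lemma prj_trace n q d : ~~ Z.eqb q.1 0 -> tracez n q.2 = Z.mul q.1 (Z.of_nat d) ->
  \tr (prj n q) = d%:R.
Proof.
move=> s0 tE; rewrite /prj mxtraceZ tr_zmx tE zrM mulKf ?zr_eq0 //.
by rewrite /zr (_ : int_of_Z (Z.of_nat d) = d) //; lia.
Qed.

Definition splitting_check n (l : seq (Z * zmat)) (c : Z) :=
  [&& all (prj_ok n) l,
      ~~ Z.eqb c 0, all (fun q => Z.mul (Z.div c q.1) q.1 == c) l &
      tabz n n (fun i j => foldr Z.add 0%ZZ [seq Z.mul (Z.div c q.1) (entz q.2 i j) | q <- l]) ==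
      tabz n n (fun i j => Z.mul c (deltaz i j))].

Lemma prj_sum n l c : splitting_check n l c -> \sum_(q <- l) prj n q = 1%:M.
Proof.
case/and4P=> /allP ok c0 /allP cs /eqP/(congr1 (zmx n n)).
rewrite !zmx_tabz => E; apply: (@scalerI _ _ (zr c)); first by rewrite zr_eq0.
transitivity (\matrix_(i < n, j < n) zr (Z.mul c (deltaz i j))); last first.
  apply/matrixP => i j; rewrite !mxE zrM /deltaz -val_eqE.
  by case: eqP; rewrite ?mulr0 // mulr1.
rewrite -E scaler_sumr; apply/matrixP => i j; rewrite summxE mxE zr_sumz big_map.
apply: eq_big_seq => q ql; rewrite /prj !mxE !zrM.
rewrite mulrA -[in LHS](eqP (cs q ql)) zrM mulfK // zr_eq0.
by have /and4P[] := ok q ql.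
Qed.

End ScaledProjectors.

Section SplittingByCheck.
Variables (R : realType) (W : vectType R) (ip : {dot W for idfun}) (e : seq W).
Hypothesis eO : onb ip e.
Variables (n : nat) (k : nat).
Hypothesis en : size e = n.
Local Notation N := (size (idx n k)).

Definition prj_space (q : Z * zmat) : {vspace altform W k} :=
  eigen_forms e (prj R N q).

Lemma splitting_by_check l c (L : (size l).-tuple {vspace altform W k}) :
  splitting_check N l c -> (forall i, tnth L i = prj_space (nth (0%ZZ, [::]) l i)) ->
  orthogonal_splitting ip L.
Proof.
move=> chk LE; have /and4P[/allP ok _ _ _] := chk.
have okn (i : 'I_(size l)) : prj_ok N (nth (0%ZZ, [::]) l i) by apply/ok/mem_nth.
apply: (splitting_eigen_forms eO en (p := fun i => prj R N (nth (0%ZZ, [::]) l i))) => //.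
- by move=> i; apply: prj_sym.
- by move=> i; apply: prj_idem.
- by rewrite -(prj_sum R chk) (big_nth (0%ZZ, [::])) big_mkord.
Qed.

Lemma dim_prj_space q d : prj_ok N q -> tracez N q.2 = Z.mul q.1 (Z.of_nat d) ->
  \dim (prj_space q) = d.
Proof.
move=> ok tE; rewrite /prj_space (dim_eigen_forms_trace eO en (d := d)) //.
  exact: prj_idem.
by apply: prj_trace => //; case/and4P: ok.
Qed.

Lemma mem_prj_space q f : ~~ Z.eqb q.1 0 ->
  f \in prj_space q <-> kappa e n f *m zmx R N N q.2 = zr R q.1 *: kappa e n f.
Proof.
move=> s0; rewrite mem_eigen_forms /prj -scalemxAr; have s0R : zr R q.1 != 0 by rewrite zr_eq0.
split=> [H|->]; last by rewrite scalerK.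
by rewrite -[in RHS]H scalerKV.
Qed.

End SplittingByCheck.

(** * Irreducibility from finite data *)

Definition wf_gen k X := all (fun t => t.1.2 < 8)%N X && wf_lc k k (lc_lie X).

Definition lie_mats k : seq zmat := [seq lie_mat k X | X <- spin_gens].

(** Rank one without division: [m] is the pivot entry and [g v] the pivot row of
    [M], so a symmetric [M] has rank one iff [m M = (g v)^T (g v)]. *)
Definition word_ok k (q : Z * zmat) J0 Xs :=
  let M := act_word q.2 (word_mat k J0 Xs) in
  let p := pivot M in let m := entz M p p in let v := seed M in
  let g := gcdz_seq (nth [::] M p) in
  [&& ~~ Z.eqb m 0, ~~ Z.eqb g 0 &
      scalez m M == [seq [seq Z.mul (Z.mul g g) (Z.mul x y) | y <- v] | x <- v]].

(** The hypotheses of [irreducible_matrix] in decidable form. A word consists of the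
    averaging over sign changes followed by squares of Lie algebra elements. *)
Definition irr_check k (q : Z * zmat) J0 Xs :=
  let n := size (idx 8 k) in
  let gens := lie_mats k in
  let ws := word_mat k J0 Xs in
  let v := seed (act_word q.2 ws) in
  (* at most [1 + 5 * 48] vectors are ever processed *)
  let rows := cyclic_span 300 gens [::] [:: v] in
  [&& all (wf_gen k) spin_gens,
      all (fun L => narrow n L && (trz n L == scalez (-1)%ZZ L)) gens,
      trz n (mask_mat k J0) == mask_mat k J0,
      all (mem spin_gens) Xs,
      all (fun L => size L <= n)%N ws,
      word_ok k q J0 Xs &
      all (fun r => nullz (reduce rows r)) q.2].

Section MatrixIrreducibility.
Variable R : realType.
Local Notation zmx := (zmx R).
Local Notation zr := (zr R).

Lemma narrow_mulzT n A B : (size B <= n)%N -> narrow n (mulzT A B).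
Proof. by move=> sB; rewrite /narrow all_map; apply/allP => r _ /=; rewrite size_map. Qed.

Lemma act_word_mx n (P : zmat) ws : narrow n P -> all (fun L => size L <= n)%N ws ->
  zmx n n (act_word P ws) = zmx n n P *m foldr mulmx 1%:M [seq (zmx n n L)^T | L <- ws].
Proof.
elim: ws P => [|L ws IH] P nP /=; first by rewrite mulmx1.
by case/andP=> sL sw; rewrite mulmxA -zmx_mulzT // -IH // narrow_mulzT.
Qed.

Lemma word_mat_sub k J0 Xs : all (mem spin_gens) Xs ->
  {subset word_mat k J0 Xs <= mask_mat k J0 :: lie_mats k}.
Proof.
move=> /allP XsI L; rewrite /word_mat in_cons => /orP[/eqP ->|/flattenP[_ /mapP[X XI ->]] LI].
  exact: mem_head.
have {LI}-> : L = lie_mat k X by move: LI; rewrite !inE orbb => /eqP.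
by rewrite in_cons map_f ?orbT //; apply: XsI.
Qed.

Lemma outer_zmx n g v : zmx n n [seq [seq Z.mul (Z.mul g g) (Z.mul x y) | y <- v] | x <- v] =
  (zr g ^+ 2) *: ((zrow R n v)^T *m zrow R n v).
Proof.
apply/matrixP => i j; rewrite !mxE big_ord1 !mxE /entz.
have [lt|ge] := ltnP i (size v); last first.
  have -> : nth 0%ZZ v i = 0%ZZ by rewrite nth_default.
  by rewrite [nth [::] _ i]nth_default ?size_map // nth_nil mul0r mulr0.
rewrite (nth_map 0%ZZ) //; have [lt'|ge'] := ltnP j (size v).
  by rewrite (nth_map 0%ZZ) // !zrM expr2.
by rewrite [nth 0%ZZ v j]nth_default // nth_default ?size_map // !mulr0.
Qed.

Lemma irr_check_matrix k q J0 Xs (U : 'M[R]_(size (idx 8 k))) :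
  let n := size (idx 8 k) in prj_ok n q -> irr_check k q J0 Xs ->
  (forall L, L \in mask_mat k J0 :: lie_mats k -> (U *m (zmx n n L)^T <= U)%MS) ->
  (U <= zmx n n q.2)%MS -> U = 0 \/ (zmx n n q.2 <= U)%MS.
Proof.
move=> n ok; rewrite /irr_check -/n.
set ws := word_mat k J0 Xs.
case/and5P=> _ /allP lie /eqP mask_sym XsI /and3P[szw /and3P[m0 g0 /eqP wE] cyc] stU UP.
move: m0 g0 wE cyc; rewrite -/ws; set M := act_word q.2 ws; set v := seed M.
set m := entz _ _ _; set g := gcdz_seq _ => m0 g0 wE cyc.
have s0 : zr q.1 != 0 by rewrite zr_eq0; case/and4P: ok.
apply: (@irreducible_matrix _ _ (zmx n n q.2) [seq (zmx n n L)^T | L <- mask_mat k J0 :: lie_mats k]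
  (zr q.1) (zr m / zr g ^+ 2) (zrow R n v) s0 (zmx_prj_sq R ok) _ _ [seq (zmx n n L)^T | L <- ws]) => //.
- by case/and4P: ok => _ _ /eqP sym _; rewrite zmx_trz sym.
- move=> _ /mapP[L Ls ->]; move: Ls; rewrite inE => /orP[/eqP ->|Ll].
    by left; rewrite trmxK zmx_trz mask_sym.
  right; have /andP[_ /eqP sk] := lie L Ll.
  by rewrite trmxK zmx_trz sk zmx_scalez scaleN1r opprK.
- move=> _ /mapP[L Lw ->]; apply/mapP; exists L => //; exact: word_mat_sub Lw.
- rewrite -act_word_mx //; last by case/and4P: ok.
  rewrite [zr m / _]mulrC -scalerA -zmx_scalez wE outer_zmx scalerK //.
  by rewrite expf_neq0 ?zr_eq0.
- move=> V stV vV; apply: (cyclic_span_full (gens := lie_mats k)) vV cyc.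
    by apply/allP => L /lie/andP[].
  by move=> L Ll; apply: stV; apply/mapP; exists L; rewrite // inE Ll orbT.
- by move=> _ /mapP[L Ls ->]; apply: stU.
Qed.

End MatrixIrreducibility.

Section GeneratorsInStabilizer.
Variables (R : realType) (W : vectType R) (ip : {dot W for idfun}) (e : seq W).
Hypothesis eO : onb ip e.
Hypothesis e8 : size e = 8%N.
Variable Phi : altform W 4.
Hypothesis PhiE : forall J, J \in idx 8 4 -> fc e Phi J = zr R (cayley_coef J).
Local Notation zr := (zr R).
Local Notation zmx := (zmx R).
Local Notation N k := (size (idx 8 k)).
Local Notation kap := (kappa e 8).

Lemma sum_iota8 (F : nat -> R) : \sum_(i <- iota 0 8) F i = \sum_(i < 8) F i.
Proof. by rewrite -(big_mkord xpredT F). Qed.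

Lemma kappa_interior_Phi u :
  kap (interior_product u Phi) = (\row_(i < 8) ip e`_i u) *m zmx 8 (N 3) Az.
Proof.
apply/rowP => j; have Jj : nth [::] (idx 8 3) j \in idx 8 3 by rewrite mem_nth.
rewrite mxE /fc ev_interior {1}(frame_expand eO e8 u) (@ev_slot_sum _ _ _ Phi [::]) //.
rewrite sum_iota8 mxE; apply: eq_bigr => i _; rewrite !mxE /entz; congr (_ * _).
have := Jj; rewrite mem_idx => /and3P[_ lt /eqP sz].
rewrite (nth_map 0%N) ?size_iota // nth_iota // add0n (nth_map [::]) //.
by rewrite -[ev Phi _]/(fc e Phi (_ :: _)) (fc_Phi PhiE) //= ?sz // ltn_ord lt.
Qed.

Lemma A_orth : zmx 8 (N 3) Az *m (zmx 8 (N 3) Az)^T = 7%:R%:M.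
Proof.
rewrite -zmx_mulzT; last by vm_compute.
have -> : mulzT Az Az = tabz 8 8 (fun i j => Z.mul 7 (deltaz i j)) by vm_compute.
rewrite zmx_tabz; apply/matrixP => i j; rewrite !mxE zrM /deltaz -val_eqE /=.
by case: eqP => _; rewrite ?mulr1 ?mulr0.
Qed.

Lemma Phi_nondegenerate x : (forall s, size s = 3%N -> ev Phi (x :: s) = 0) -> x = 0.
Proof.
move=> x0; have : kap (interior_product x Phi) = 0.
  apply/rowP => j; rewrite !mxE /fc ev_interior x0 // size_map.
  by apply/eqP/(allP (size_combs (iota 0 8) 3))/mem_nth.
rewrite kappa_interior_Phi => /(congr1 (fun r => r *m (zmx 8 (N 3) Az)^T)).
rewrite mul0mx -mulmxA A_orth mul_mx_scalar => /eqP; rewrite scaler_eq0 pnatr_eq0 /= => /eqP/rowP r0.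
rewrite (frame_expand eO e8 x) big_seq big1 // => i; rewrite mem_iota /= add0n => lti.
by have := r0 (Ordinal lti); rewrite !mxE /= => ->; rewrite scale0r.
Qed.

Definition skew_end (X : seq (nat * nat * Z)) : 'End(W) :=
  \sum_(t <- X) zr t.2 *: unit_lfun ip e`_t.1.1 e`_t.1.2.

Lemma skew_endE X b : all (fun t => t.1.2 < 8)%N X -> (b < 8)%N ->
  skew_end X e`_b = \sum_(t <- X | t.1.2 == b) zr t.2 *: e`_t.1.1.
Proof.
move=> /allP X8 b8; rewrite /skew_end sum_lfunE [RHS]big_mkcond; apply: eq_big_seq => t tX.
rewrite scale_lfunE unit_lfunE (proj2 eO) ?e8 ?X8 //.
by case: eqP; rewrite ?scale1r // scale0r scaler0.
Qed.

Lemma fc_lie X k (f : altform W k) J : all (fun t => t.1.2 < 8)%N X -> size J = k ->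
  all (ltn^~ 8%N) J ->
  fc e (lie_derivative (skew_end X) f) J = \sum_(q <- lc_lie X J) zr q.1 * fc e f q.2.
Proof.
move=> X8 szJ ltJ; rewrite /fc (ev_lie_derivative eO) ?size_map //.
rewrite /lie_ev /lc_lie big_flatten big_map size_map; apply: eq_big_seq => i.
rewrite mem_iota add0n => /= lti; rewrite (nth_map 0%N) // skew_endE //; last exact: (allP ltJ _ (mem_nth _ lti)).
have lti' : (size (take i (map (nth 0%R e) J)) < k)%N.
  by rewrite -szJ size_takel // size_map; exact: ltnW.
rewrite -[X in _ ++ X :: _]big_filter.
rewrite (ev_slot_sum f (drop i.+1 (map (nth 0 e) J)) _ (fun t : nat * nat * Z => zr t.2) (fun t => e`_t.1.1) lti') big_map.
by apply: eq_bigr => t _; rewrite map_cat map_take /= map_drop.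
Qed.

Lemma kappa_lie k X (f : altform W k) : wf_gen k X ->
  kap (lie_derivative (skew_end X) f) = kap f *m (zmx (N k) (N k) (lie_mat k X))^T.
Proof.
case/andP=> X8 wf; apply: kappa_op => // J JI.
by have := JI; rewrite mem_idx => /and3P[_ lt /eqP sz]; apply: fc_lie.
Qed.

Lemma kappa_Phi : kap Phi = zmx 1 (N 4) fz.
Proof.
apply/rowP => j; rewrite [LHS]mxE [RHS]mxE PhiE ?mem_nth // /entz /fz.
by rewrite -[nth [::] [:: _] _]/([seq cayley_coef J | J <- idx 8 4]) (nth_map [::]).
Qed.

Lemma skew_end_lie X : X \in spin_gens -> lie_algebra (stabilizer Phi) (skew_end X).
Proof.
move=> XI; apply/(lie_algebraP eO _ Phi_nondegenerate).
apply: (kappa_inj eO e8); rewrite kappa_lie //; last first.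
  have : all (wf_gen 4) spin_gens by vm_compute.
  by move/allP; apply.
rewrite kappa_Phi linear0 -zmx_mulzT; last by vm_compute.
apply: zmx_null; have : all (fun X => all nullz (mulzT fz (lie_mat 4 X))) spin_gens by vm_compute.
by move/allP; apply.
Qed.

Definition sign_end (c : seq nat) : 'End(W) :=
  \sum_(i <- iota 0 8) (-1) ^+ (i \in c) *: unit_lfun ip e`_i e`_i.

Lemma sign_endE c b : (b < 8)%N -> sign_end c e`_b = (-1) ^+ (b \in c) *: e`_b.
Proof.
move=> b8; rewrite /sign_end sum_lfunE (bigD1_seq b) ?mem_iota ?iota_uniq //= big_seq_cond big1 ?addr0.
  by rewrite scale_lfunE unit_lfunE (proj2 eO) ?e8 // eqxx scale1r.
move=> i /andP[]; rewrite (mem_iota 0 8) add0n => /= i8 ib.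
by rewrite scale_lfunE unit_lfunE (proj2 eO) ?e8 // (negPf ib) scale0r scaler0.
Qed.

Lemma zr_code_sign c J : zr (code_sign c J) = (-1) ^+ count (mem c) J.
Proof. by rewrite /code_sign zr_sgz signr_odd. Qed.

Lemma fc_sign_end c k (f : altform W k) J : size J = k -> all (ltn^~ 8%N) J ->
  fc e (pullback (sign_end c) f) J = zr (code_sign c J) * fc e f J.
Proof.
rewrite zr_code_sign => szJ ltJ; rewrite {1}/fc ev_pullback.
suff H K s : (size s + size K = k)%N -> all (ltn^~ 8%N) K ->
    ev f (s ++ map (sign_end c) (map (nth 0 e) K)) =
    (-1) ^+ count (mem c) K * ev f (s ++ map (nth 0 e) K) by apply: (H J [::]).
elim: K s => [|b K IH] s /= sz; first by rewrite mul1r.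
case/andP=> b8 K8; rewrite sign_endE // ev_slotZ; last by lia.
have := IH (rcons s e`_b); rewrite size_rcons !cat_rcons => -> //; last by rewrite addSnnS.
by rewrite mulrA exprD.
Qed.

Lemma sign_end_stab c : c \in sign_codes -> stabilizer Phi (sign_end c).
Proof.
move=> cI; split.
  apply/eqP; rewrite -subv0; apply/subvP => x; rewrite memv_ker memv0 => /eqP sx.
  apply/eqP; rewrite (frame_expand eO e8 x) big_seq big1 // => i; rewrite mem_iota add0n => /= i8.
  have : ip e`_i (sign_end c x) = (-1) ^+ (i \in c) * ip e`_i x.
    rewrite {1}(frame_expand eO e8 x) linear_sum ip_sumr (bigD1_seq i) ?mem_iota ?iota_uniq //=.
    rewrite big_seq_cond big1 => [|j /andP[]]; last first.
      rewrite (mem_iota 0 8) add0n => /= j8 ji; rewrite linearZ /= sign_endE // !ipZr (proj2 eO) ?e8 //.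
      by rewrite eq_sym (negPf ji) !mulr0.
    by rewrite linearZ /= sign_endE // !ipZr (proj2 eO) ?e8 // eqxx addr0 mulr1 mulrC.
  rewrite sx ip0r => /esym/eqP; rewrite mulf_eq0 signr_eq0 /= => /eqP ->.
  by rewrite scale0r.
apply: (kappa_inj eO e8); apply/rowP => j; rewrite !mxE.
have Jj : nth [::] (idx 8 4) j \in idx 8 4 by rewrite mem_nth.
set J := nth _ _ _ in Jj *; have := Jj; rewrite mem_idx => /and3P[_ lt /eqP sz].
rewrite fc_sign_end // PhiE // -zrM; congr (zr _).
have : all (fun c => all (fun J => Z.mul (code_sign c J) (cayley_coef J) == cayley_coef J) (idx 8 4)) sign_codes.
  by vm_compute.
by move/allP/(_ c cI)/allP/(_ J Jj)/eqP.
Qed.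

(** The averaging is a product of operators [1 ± g^*] with [g] in the stabilizer. *)
Lemma mask_mem k (U : {vspace altform W k}) J0 f :
  invariant_subspace (stabilizer Phi) U -> f \in U ->
  exists2 h, h \in U & kap h = kap f *m (zmx (N k) (N k) (mask_mat k J0))^T.
Proof.
move=> invU fU.
pose F (cs : seq (seq nat)) := foldr (fun c h => h + zr (code_sign c J0) *: pullback (sign_end c) h) f cs.
have FU cs : {subset cs <= sign_codes} -> F cs \in U.
  elim: cs => [//|c cs IH] sub /=.
  have hU : F cs \in U by apply: IH => d dcs; rewrite sub // inE dcs orbT.
  apply: memvD => //; apply: memvZ; apply: invU => //.
  by apply: sign_end_stab; apply: sub; apply: mem_head.
exists (F sign_codes); first exact: FU.
have FE cs J : size J = k -> all (ltn^~ 8%N) J -> fc e (F cs) J =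
    zr (foldr Z.mul 1%ZZ [seq Z.add 1 (Z.mul (code_sign c J0) (code_sign c J)) | c <- cs]) * fc e f J.
  move=> sz lt; elim: cs => [|c cs IH]; first by rewrite mul1r.
  rewrite -[F (c :: cs)]/(F cs + zr (code_sign c J0) *: pullback (sign_end c) (F cs)).
  rewrite /fc evD evZ -!/(fc e _ _) fc_sign_end // IH.
  rewrite map_cons; set l := map _ cs; set a := Z.add 1 _.
  rewrite -[foldr _ _ (a :: l)]/(Z.mul a (foldr Z.mul 1%ZZ l)) /a !(zrM, zrD).
  by move: (zr (foldr _ _ _)) (fc e f J) => y z; rewrite zr1; ring.
apply/rowP => j; have Jj : nth [::] (idx 8 k) j \in idx 8 k by rewrite mem_nth.
have := Jj; rewrite mem_idx => /and3P[_ lt /eqP sz].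
rewrite !mxE FE // (bigD1 j) //= big1 ?addr0 => [|i ij].
  by rewrite !mxE /entz !(nth_map [::]) // eqxx mulrC.
rewrite !mxE /entz !(nth_map [::]) // nth_uniq ?combs_uniq ?iota_uniq //.
by rewrite eq_sym in ij; rewrite -val_eqE /= in ij; rewrite (negPf ij) mulr0.
Qed.

(** An invariant subspace is stable under the Lie algebra and under the sign
    changes; passing to coordinates, [irreducible_matrix] applies to the row space
    it spans. *)
Lemma irreducible_by_check k q J0 Xs d :
  prj_ok (N k) q -> irr_check k q J0 Xs -> \dim (prj_space e 8 k q) = d.+1 ->
  invariant_subspace (stabilizer Phi) (prj_space e 8 k q) ->
  irreducible_representation (stabilizer Phi) (prj_space e 8 k q).
Proof.
move=> ok chk dimq invq; have /andP[/allP wf _] := chk; split=> // [|U UL invU].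
  by rewrite -dimv_eq0 dimq.
pose b := vbasis U; pose Um : 'M[R]_(\dim U, N k) := \matrix_i kap b`_i.
have UmP f : f \in U <-> (kap f <= Um)%MS.
  split=> [fU|/submxP[r rE]].
    rewrite (coord_vbasis fU) linear_sum; apply: summx_sub => i _; rewrite linearZ.
    by apply: scalemx_sub; apply: submx_trans (row_sub i Um); rewrite rowK.
  have -> : f = \sum_i r 0 i *: b`_i.
    apply: (kappa_inj eO e8); rewrite rE mulmx_sum_row linear_sum; apply: eq_bigr => i _.
    by rewrite rowK linearZ.
  by apply: rpred_sum => i _; rewrite rpredZ // vbasis_mem // mem_nth // size_tuple.
have UmG f : f \in U <-> (kap f <= <<Um>>)%MS by rewrite genmxE.
have stU L : L \in mask_mat k J0 :: lie_mats k -> (<<Um>> *m (zmx _ _ L)^T <= <<Um>>)%MS.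
  move=> LI; rewrite genmxE (eqmxMr _ (genmxE Um)); apply/row_subP => i; rewrite row_mul rowK.
  have bU : b`_i \in U by rewrite vbasis_mem // mem_nth // size_tuple.
  move: LI; rewrite inE => /orP[/eqP ->|/mapP[X XI ->]].
    by have [h hU <-] := mask_mem J0 invU bU; apply/UmP.
  rewrite -kappa_lie ?wf //; apply/UmP; apply: (lie_derivative_mem eO invU) bU.
  exact: skew_end_lie.
have s0 : ~~ Z.eqb q.1 0 by case/and4P: ok.
have sub f : f \in prj_space e 8 k q -> (kap f <= zmx (N k) (N k) q.2)%MS.
  move=> /(@mem_prj_space _ _ _ _ _ _ _ s0) fE; have s0R : zr q.1 != 0 by rewrite zr_eq0.
  by rewrite -[kap f](scalerK s0R) -fE scalemx_sub // submxMl.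
have UP : (<<Um>> <= zmx (N k) (N k) q.2)%MS.
  rewrite genmxE; apply/row_subP => i; rewrite rowK; apply: sub.
  by apply: (subvP UL); rewrite vbasis_mem // mem_nth // size_tuple.
have [U0|PU] := irr_check_matrix ok chk stU UP; [left|right].
  apply/eqP; rewrite -subv0; apply/subvP => f /UmG; rewrite U0 submx0 memv0 => /eqP f0.
  by apply/eqP/(kappa_inj eO e8); rewrite f0 linear0.
apply/eqP; rewrite eqEsubv UL; apply/subvP => f /sub fP.
by apply/UmG; apply: submx_trans PU.
Qed.

End GeneratorsInStabilizer.

(** * Integer identities *)

Definition affz n (a : Z) (A : zmat) (b : Z) : zmat :=
  tabz n n (fun i j => Z.add (Z.mul a (entz A i j)) (Z.mul b (deltaz i j))).

Lemma Tz_entry i j : (i < size (idx 8 2))%N -> (j < size (idx 8 2))%N ->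
  entz Tz i j = cayley_val (nth [::] (idx 8 2) i ++ nth [::] (idx 8 2) j).
Proof. by move=> lti ltj; rewrite /entz /Tz !(nth_map [::]). Qed.

Lemma lie_row_entry a b j : (j < size (idx 8 4))%N -> nth 0%ZZ (lie_row a b) j =
  foldr Z.add 0%ZZ [seq Z.mul q.1 (cayley_val q.2) | q <- lc_lie [:: (a, b, 1%ZZ)] (nth [::] (idx 8 4) j)].
Proof. by move=> ltj; rewrite /lie_row (nth_map [::]). Qed.

Lemma D2z_entry (R : realType) (j : 'I_(size (idx 8 2))) : zrow R (size (idx 8 4)) (nth [::] D2z j) =
  let K := nth [::] (idx 8 2) j in
  zrow R _ (lie_row (nth 0%N K 0) (nth 0%N K 1)) - zrow R _ (lie_row (nth 0%N K 1) (nth 0%N K 0)).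
Proof. by rewrite /D2z (nth_map [::]) // zrow_linz scale1r scaleN1r. Qed.

Lemma Dz_entry p : (p < size index_pairs)%N ->
  nth [::] Dz p = lie_row (nth (0, 0)%N index_pairs p).1 (nth (0, 0)%N index_pairs p).2.
Proof. by move=> ltp; rewrite /Dz (nth_map (0, 0)%N). Qed.

Definition sym_pairs : zmat :=
  [seq [seq Z.add (Z.mul (deltaz p.1 q.1) (deltaz p.2 q.2)) (Z.mul (deltaz p.1 q.2) (deltaz p.2 q.1))
  | q <- index_pairs] | p <- index_pairs].
(** The Gram matrix of [Dz] acts by 4 on symmetric endomorphisms of trace zero, by
    28 on the identity, and preserves the skew ones. [14 Sym - 3 Tr], with [Sym] and
    [Tr] the operators [x + x^T] and [tr(x) 1], inverts it on symmetric
    endomorphisms up to scale. *)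
Definition sym_cofactor : zmat :=
  [seq [seq Z.sub (Z.mul 14 (Z.add (Z.mul (deltaz p.1 q.1) (deltaz p.2 q.2)) (Z.mul (deltaz p.1 q.2) (deltaz p.2 q.1))))
                  (Z.mul 3 (Z.mul (deltaz p.1 p.2) (deltaz q.1 q.2)))
  | q <- index_pairs] | p <- index_pairs].

Lemma Dz_symmetrizes : mulzT (mulzT Dz Dz) sym_cofactor = scalez 56 sym_pairs.
Proof. by apply/eqP; vm_compute. Qed.

Lemma index_pairs_split : perm_eq index_pairs
  ([seq (nth 0 K 0, nth 0 K 1) | K <- idx 8 2] ++ [seq (nth 0 K 1, nth 0 K 0) | K <- idx 8 2]
   ++ [seq (i, i) | i <- iota 0 8])%N.
Proof. by vm_compute. Qed.

Definition wedge3z : zmat := op_mat 3 7 lc_wedge.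
Lemma mulzT_wedge3 : mulzT (trz 56 wedge3z) (trz 56 wedge3z) = P3_8.
Proof. by apply/eqP; vm_compute. Qed.
Lemma wedge3_gram : mulzT wedge3z wedge3z = tabz 8 8 (fun i j => Z.mul 7 (deltaz i j)).
Proof. by apply/eqP; vm_compute. Qed.
Lemma P3_8E : P3_8 = mulzT (trz 56 Az) (trz 56 Az).
Proof. by []. Qed.
Lemma P3_48E : P3_48 = affz 56 (-1) P3_8 7.
Proof. by apply/eqP; vm_compute. Qed.
Lemma P4_1E : P4_1 = mulzT (trz 70 fz) (trz 70 fz).
Proof. by []. Qed.
Lemma fz_gram : mulzT fz fz = [:: [:: 14%ZZ]].
Proof. by apply/eqP; vm_compute. Qed.
Lemma P4_7E : scalez 4 P4_7 = mulzT (trz 70 D2z) (trz 70 D2z).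
Proof. by apply/eqP; vm_compute. Qed.
Lemma D2_P4_7 : mulzT D2z P4_7 = scalez 8 D2z.
Proof. by apply/eqP; vm_compute. Qed.

Lemma trz_P4_7 : trz (size (idx 8 4)) P4_7 = P4_7.
Proof. by apply/eqP; vm_compute. Qed.
Lemma fz_Sz : mulzT fz Sz = fz.
Proof. by apply/eqP; vm_compute. Qed.
Lemma D2z_Sz : mulzT D2z Sz = D2z.
Proof. by apply/eqP; vm_compute. Qed.
Lemma P4_27_Sz : mulzT P4_27 Sz = P4_27.
Proof. by apply/eqP; vm_compute. Qed.
Lemma P4_27_fz : all nullz (mulzT P4_27 fz).
Proof. by vm_compute. Qed.
Lemma P4_27_D2z : all nullz (mulzT P4_27 D2z).
Proof. by vm_compute. Qed.

Lemma splits_idx n k q : q \in splits k (iota 0 n) -> q.1.2 \in idx n k.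
Proof. by move=> qs; rewrite /idx -combs_splits; apply: (map_f (fun q => q.1.2)). Qed.

Definition split2 : seq (Z * zmat) := [:: (4%ZZ, P2_7); (4%ZZ, P2_21)].
Definition split3 : seq (Z * zmat) := [:: (7%ZZ, P3_8); (7%ZZ, P3_48)].
Definition split4 : seq (Z * zmat) :=
  [:: (14%ZZ, P4_1); (8%ZZ, P4_7); (56%ZZ, P4_27); (2%ZZ, P4_35)].

Lemma split2_check : splitting_check (size (idx 8 2)) split2 4.
Proof. by vm_compute. Qed.
Lemma split3_check : splitting_check (size (idx 8 3)) split3 7.
Proof. by vm_compute. Qed.
Lemma split4_check : splitting_check (size (idx 8 4)) split4 56.
Proof. by vm_compute. Qed.

Lemma dim_checks : [&& 
  tracez (size (idx 8 2)) P2_7 == Z.mul 4 7, tracez (size (idx 8 2)) P2_21 == Z.mul 4 21,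
  tracez (size (idx 8 3)) P3_8 == Z.mul 7 8, tracez (size (idx 8 3)) P3_48 == Z.mul 7 48,
  tracez (size (idx 8 4)) P4_1 == Z.mul 14 1, tracez (size (idx 8 4)) P4_7 == Z.mul 8 7,
  tracez (size (idx 8 4)) P4_27 == Z.mul 56 27 & tracez (size (idx 8 4)) P4_35 == Z.mul 2 35].
Proof. by vm_compute. Qed.

Lemma split2_ok i : (i < 2)%N -> prj_ok (size (idx 8 2)) (nth (0%ZZ, [::]) split2 i).
Proof. by move=> ltm; have /and4P[/allP ok _ _ _] := split2_check; apply/ok/mem_nth. Qed.
Lemma split3_ok i : (i < 2)%N -> prj_ok (size (idx 8 3)) (nth (0%ZZ, [::]) split3 i).
Proof. by move=> ltm; have /and4P[/allP ok _ _ _] := split3_check; apply/ok/mem_nth. Qed.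
Lemma split4_ok i : (i < 4)%N -> prj_ok (size (idx 8 4)) (nth (0%ZZ, [::]) split4 i).
Proof. by move=> ltm; have /and4P[/allP ok _ _ _] := split4_check; apply/ok/mem_nth. Qed.

Lemma irr_check2_7 : irr_check 2 (4%ZZ, P2_7) [:: 0; 1]%N [::].
Proof. by vm_compute. Qed.
Lemma irr_check2_21 : irr_check 2 (4%ZZ, P2_21) [:: 0; 1]%N [:: gen 3].
Proof. by vm_compute. Qed.
Lemma irr_check3_8 : irr_check 3 (7%ZZ, P3_8) [:: 1; 2; 3]%N [::].
Proof. by vm_compute. Qed.
Lemma irr_check3_48 : irr_check 3 (7%ZZ, P3_48) [:: 1; 2; 3]%N [:: gen 0; gen 1].
Proof. by vm_compute. Qed.
Lemma irr_check4_7 : irr_check 4 (8%ZZ, P4_7) [:: 0; 1; 2; 4]%N [::].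
Proof. by vm_compute. Qed.
Lemma irr_check4_27 : irr_check 4 (56%ZZ, P4_27) [:: 0; 1; 2; 4]%N [:: gen 2].
Proof. by vm_compute. Qed.
Lemma irr_check4_35 : irr_check 4 (2%ZZ, P4_35) [:: 0; 1; 2; 4]%N [:: gen 2].
Proof. by vm_compute. Qed.

Lemma uniq_splits4 : uniq [seq q.2 | q <- splits 4 (iota 0 8)].
Proof. by vm_compute. Qed.
Lemma splits4_idx : all (fun q => q.2 \in idx 8 4) (splits 4 (iota 0 8)).
Proof. by vm_compute. Qed.
Lemma idx_splits4 : all (fun J => J \in [seq q.2 | q <- splits 4 (iota 0 8)]) (idx 8 4).
Proof. by vm_compute. Qed.
Lemma uniq_splits6 : uniq [seq q.2 | q <- splits 6 (iota 0 8)].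
Proof. by vm_compute. Qed.
Lemma splits6_idx : all (fun q => q.2 \in idx 8 2) (splits 6 (iota 0 8)).
Proof. by vm_compute. Qed.

(* From here on the data are only evaluated, so that unification never unfolds them. *)
Opaque Tz Az Sz fz Dz D2z P2_7 P2_21 P3_8 P3_48 P4_1 P4_7 P4_27 P4_35 idx index_pairs lie_row wedge3z.

(** * Two-forms *)

Section MatrixFacts.
Variable R : realType.
Local Notation zr := (zr R).
Local Notation zmx := (zmx R).
Local Notation N k := (size (idx 8 k)).

Lemma zmx_affz n a A b : zmx n n (affz n a A b) = zr a *: zmx n n A + (zr b)%:M.
Proof.
apply/matrixP => i j; rewrite zmx_tabz !mxE zrD !zrM; congr (_ + _).
by rewrite /deltaz -val_eqE; case: eqP => _; rewrite ?mulr1 ?mulr0.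
Qed.

Lemma zmx_mulz m n p A B C : narrow n A -> mulzT A B = C ->
  zmx m n A *m (zmx p n B)^T = zmx m p C.
Proof. by move=> nA <-; rewrite (@zmx_mulzT R m n p). Qed.

Definition Tmx : 'M[R]_(N 2) := zmx (N 2) (N 2) Tz.
Definition Smx : 'M[R]_(N 4) := zmx (N 4) (N 4) Sz.
Definition D2mx : 'M[R]_(N 2, N 4) := zmx (N 2) (N 4) D2z.

Lemma Tmx_sym : Tmx^T = Tmx.
Proof. by rewrite zmx_trz; congr (zmx _ _ _); vm_compute. Qed.

Lemma Smx_sym : Smx^T = Smx.
Proof. by rewrite zmx_trz; congr (zmx _ _ _); vm_compute. Qed.

Lemma Tmx_sq : Tmx *m Tmx = 2 *: Tmx + 3%:M.
Proof.
rewrite -{2}Tmx_sym (@zmx_mulz _ _ _ _ _ (affz (N 2) 2 Tz 3)) ?zmx_affz //; by vm_compute.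
Qed.

Lemma P2_7_mx : zmx (N 2) (N 2) P2_7 = Tmx + 1%:M.
Proof.
have -> : P2_7 = affz (N 2) 1 Tz 1 by vm_compute.
by rewrite zmx_affz scale1r.
Qed.

Lemma P2_21_mx : zmx (N 2) (N 2) P2_21 = 3%:M - Tmx.
Proof.
have -> : P2_21 = affz (N 2) (-1) Tz 3 by vm_compute.
by rewrite zmx_affz scaleN1r addrC.
Qed.

Lemma P4_35_mx : zmx (N 4) (N 4) P4_35 = 1%:M - Smx.
Proof.
have -> : P4_35 = affz (N 4) (-1) Sz 1 by vm_compute.
by rewrite zmx_affz scaleN1r addrC.
Qed.

Lemma D2_gram : D2mx *m D2mx^T = 8 *: (Tmx + 1%:M).
Proof.
rewrite (@zmx_mulz _ _ _ _ _ (affz (N 2) 8 Tz 8)); [|by vm_compute|by vm_compute].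
by rewrite zmx_affz scalerDr scale_scalar_mx mulr1.
Qed.

Lemma P2_21_D2 : (3%:M - Tmx) *m D2mx = 0.
Proof.
rewrite -P2_21_mx -[D2mx]trmxK [D2mx^T]zmx_trz -zmx_mulzT; last by vm_compute.
by apply: zmx_null; vm_compute.
Qed.

End MatrixFacts.

Section CayleySplitting.
Variables (R : realType) (W : vectType R) (ip : {dot W for idfun}) (e : seq W).
Hypothesis eO : onb ip e.
Hypothesis e8 : size e = 8%N.
Variable Phi : altform W 4.
Hypothesis PhiE : forall J, J \in idx 8 4 -> fc e Phi J = zr R (cayley_coef J).
Variable vol : altform W 8.
Hypothesis vol1 : ev vol e = 1.
Local Notation zr := (zr R).
Local Notation zmx := (zmx R).
Local Notation N k := (size (idx 8 k)).
Local Notation kap := (kappa e 8).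
Local Notation T := (Tmx R).
Local Notation D2 := (D2mx R).
Local Notation S := (Smx R).

Let inj k (f g : altform W k) : kap f = kap g -> f = g.
Proof. exact: (kappa_inj eO e8). Qed.

Lemma kappaD k (f g : altform W k) : kap (f + g) = kap f + kap g.
Proof. exact: linearD. Qed.
Lemma kappaN k (f : altform W k) : kap (- f) = - kap f.
Proof. exact: linearN. Qed.
Lemma kappaZ k a (f : altform W k) : kap (a *: f) = a *: kap f.
Proof. exact: linearZ. Qed.

Definition star2 (w : altform W 2) : altform W 2 := hodge ip 6 2 vol (Phi ∧ w).

Lemma kappa_star2 w : kap (star2 w) = kap w *m T.
Proof.
have -> : T = (zmx (N 2) (N 2) (op_mat 2 2 (lc_comp (lc_star 6) lc_wedge)))^T.
  by rewrite -[LHS]Tmx_sym; congr (zmx _ _ _)^T; vm_compute.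
apply: kappa_op => [|J JI]; first by vm_compute.
have chk : all (fun J => J \in [seq q.2 | q <- splits 6 (iota 0 8)]) (idx 8 2) by vm_compute.
rewrite (@fc_star _ _ _ _ eO e8 6 2 vol _ J erefl vol1 uniq_splits6 splits6_idx (allP chk J JI)).
rewrite /lc_comp big_flatten big_map; apply: eq_big_seq => q ql.
have q6 : all (fun J => all (fun q => q.2 \in idx 8 6) (lc_star 6 J)) (idx 8 2) by vm_compute.
rewrite (@fc_wedge_Phi _ _ _ _ PhiE 2); last by apply: (allP (allP q6 J JI)).
by rewrite big_map mulr_sumr; apply: eq_bigr => p _; rewrite zrM mulrA.
Qed.

Lemma form_ip_star2 f g : form_ip ip (star2 f) g = form_ip ip f (star2 g).
Proof.
by rewrite !(form_ip_mx eO e8) !kappa_star2 trmx_mul Tmx_sym mulmxA.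
Qed.

Lemma star2D f g : star2 (f + g) = star2 f + star2 g.
Proof. by apply: inj; rewrite kappaD !kappa_star2 kappaD mulmxDl. Qed.

Lemma star2_sq f : star2 (star2 f) = 2 *: star2 f + 3 *: f.
Proof.
apply: inj; rewrite kappaD !kappaZ !kappa_star2 -mulmxA Tmx_sq mulmxDr.
by rewrite -scalemxAr mul_mx_scalar.
Qed.

Definition L2_7 : {vspace altform W 2} := prj_space e 8 2 (4%ZZ, P2_7).
Definition L2_21 : {vspace altform W 2} := prj_space e 8 2 (4%ZZ, P2_21).

Lemma mem_L2_7 w : w \in L2_7 <-> star2 w = 3 *: w.
Proof.
rewrite mem_prj_space // P2_7_mx mulmxDr mulmx1 -kappa_star2.
rewrite (_ : zr 4 *: kap w = kap (3 *: w) + kap w); last first.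
  by rewrite kappaZ -[X in _ + X]scale1r -scalerDl natr1.
by split=> [/addIr/inj|->].
Qed.

Lemma mem_L2_21 w : w \in L2_21 <-> star2 w = - w.
Proof.
rewrite mem_prj_space // P2_21_mx mulmxBr mul_mx_scalar -kappa_star2.
rewrite (_ : zr 4 *: kap w = 3 *: kap w - kap (- w)); last first.
  by rewrite kappaN opprK -[X in _ + X]scale1r -scalerDl natr1.
by split=> [/addrI/oppr_inj/inj|->].
Qed.

Definition wedge2 (u v : W) : altform W 2 := covector ip u ∧ covector ip v.

Lemma ev_wedge2 u v x y : ev (wedge2 u v) [:: x; y] = ip u x * ip v y - ip u y * ip v x.
Proof.
rewrite [LHS](@ev_wedge R W 1 1) // /shuffle_sum /= !big_cons big_nil /= !ev_covector.
by rewrite addr0 mul1r mulN1r.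
Qed.

Lemma sum_frame (h : W -> R) u : (forall a x y, h (a *: x + y) = a * h x + h y) ->
  \sum_(x <- e) ip u x * h x = h u.
Proof.
move=> hl; rewrite [in RHS](onb_expand u eO).
have h0 : h 0 = 0 by have := hl (-1) 0 0; rewrite scaler0 addr0 mulN1r addNr.
elim: e => [|x s IH]; first by rewrite !big_nil h0.
by rewrite !big_cons hl IH ipC.
Qed.

Lemma ev2_linr (h : altform W 2) x a y z :
  ev h [:: x; a *: y + z] = a * ev h [:: x; y] + ev h [:: x; z].
Proof. exact: (@ev_slot _ _ _ h [:: x]). Qed.
Lemma ev2_linl (h : altform W 2) x a y z :
  ev h [:: a *: y + z; x] = a * ev h [:: y; x] + ev h [:: z; x].
Proof. exact: (@ev_slot _ _ _ h [::]). Qed.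
Lemma ev2_skew (h : altform W 2) x y : ev h [:: x; y] = - ev h [:: y; x].
Proof. exact: (@ev_swap _ _ _ h [::]). Qed.

Lemma form_ip_wedge2 h u v : form_ip ip h (wedge2 u v) = ev h [:: u; v].
Proof.
apply: (@mulfI _ 2); first by rewrite pnatr_eq0.
rewrite (form_ipE _ _ eO) -[2]/(2`!%:R) -word_sum_combs /word_sum /= big_allpairs_dep /=.
transitivity (\sum_(x <- e) \sum_(y <- e) (ip u x * (ip v y * ev h [:: x; y]) - ip v x * (ip u y * ev h [:: x; y]))).
  apply: eq_bigr => x _; rewrite big_flatten big_map; apply: eq_bigr => y _.
  by rewrite big_seq1 ev_wedge2; ring.
transitivity (ev h [:: u; v] - ev h [:: v; u]); last first.
  by rewrite (ev2_skew h v u) opprK [RHS]mulr_natl [RHS]mulr2n.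
transitivity (\sum_(x <- e) (ip u x * ev h [:: x; v] - ip v x * ev h [:: x; u])).
  apply: eq_bigr => x _; rewrite sumrB -!mulr_sumr.
  have lin a y z := ev2_linr h x a y z.
  by rewrite !(sum_frame (h := fun y => ev h [:: x; y])).
rewrite sumrB; congr (_ - _); [apply: (sum_frame (h := fun x => ev h [:: x; v]))|
  apply: (sum_frame (h := fun x => ev h [:: x; u]))]; by move=> *; apply: ev2_linl.
Qed.

Definition interior2 (u v : W) : altform W 2 := interior_product u (interior_product v Phi).

(** Both sides pair [u^* ∧ v^*] with coefficients of [Phi], which are the entries of
    the matrix of [star2]. *)
Lemma star2_wedge2 u v : star2 (wedge2 u v) = - interior2 u v.
Proof.
apply: inj; apply/rowP => j; rewrite kappa_star2 kappaN [RHS]mxE.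
have Jj : nth [::] (idx 8 2) j \in idx 8 2 by rewrite mem_nth.
have [J JE] : {J | J = nth [::] (idx 8 2) j} by eexists.
have := Jj; rewrite mem_idx -JE => /and3P[_ lt /eqP sz].
rewrite [kap (interior2 u v) _ _]mxE -JE /fc /interior2 !ev_interior.
case: J sz lt JE => [|a [|b []]] //= _ /and3P[a8 b8 _] JE.
have -> : ev Phi [:: v; u; e`_a; e`_b] = - ev (interior_product e`_b (interior_product e`_a Phi)) [:: u; v].
  rewrite !ev_interior (@ev_front _ _ _ Phi [:: v; u]) //= (@ev_front _ _ _ Phi [:: e`_a; v; u]) //=.
  rewrite (@ev_swap _ _ _ Phi [:: e`_b; e`_a]) // (@ev_swap _ _ _ Phi [::]) //.
  by rewrite !exprS expr0; ring.
rewrite opprK -form_ip_wedge2 (form_ip_kappa eO e8) mxE; apply: eq_bigr => i _.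
rewrite mulrC; congr (_ * _); rewrite [RHS]mxE /fc !ev_interior.
have Ii : nth [::] (idx 8 2) i \in idx 8 2 by rewrite mem_nth.
have := Ii; rewrite mem_idx => /and3P[_ lti /eqP szi].
rewrite -Tmx_sym 2!mxE Tz_entry // -JE.
rewrite -[ev Phi _]/(fc e Phi (a :: b :: _)) (fc_Phi PhiE) //= ?szi //.
by rewrite a8 b8.
Qed.

(** Write [a = u^* ∧ v^*], so that [a - ι(u)ι(v)Phi = (1 + star2) a] lies in the
    eigenspace for 3. Conversely, given [w], take [u = e_0] and [v] dual to [w(e_0,
    .)]: then [a] is the part [w M] of [w] that involves [e_0], and [(1 + T) M (1 +
    T) = 1 + T] recovers [w]. *)
Lemma L2_7_wedge w : w \in L2_7 <-> exists u v, w = wedge2 u v - interior2 u v.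
Proof.
split=> [/mem_L2_7 w3|[u [v ->]]]; last first.
  rewrite -star2_wedge2; apply/mem_L2_7; rewrite star2D star2_sq.
  by rewrite -{1}[star2 _]scale1r addrA -scalerDl [1 + 2]addrC natr1 addrC scalerDr.
exists e`_0, (\sum_(b <- iota 0 8) ev w [:: e`_0; e`_b] *: e`_b).
set v := \sum_(b <- _) _; rewrite -star2_wedge2; apply: inj.
rewrite kappaD kappa_star2.
pose M : zmat := [seq [seq (if J == K then (if nth 0%N J 0 == 0%N then 1%ZZ else 0%ZZ) else 0%ZZ) | K <- idx 8 2] | J <- idx 8 2].
have ipe a b : (a < 8)%N -> (b < 8)%N -> ip e`_a e`_b = (a == b)%:R.
  by move=> a8 b8; rewrite (proj2 eO) ?e8.
have vE b : (b < 8)%N -> ip v e`_b = ev w [:: e`_0; e`_b].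
  move=> b8; rewrite /v ip_suml (bigD1_seq b) ?mem_iota ?iota_uniq //= big_seq_cond big1 ?addr0.
    by rewrite ipZl ipe // eqxx mulr1.
  by move=> i /andP[]; rewrite (mem_iota 0 8) => i8 /negPf ib; rewrite ipZl ipe // ib mulr0.
have -> : kap (wedge2 e`_0 v) = kap w *m zmx (N 2) (N 2) M.
  apply/rowP => j; rewrite !mxE.
  have Jj : nth [::] (idx 8 2) j \in idx 8 2 by rewrite mem_nth.
  set J := nth _ _ _ in Jj *; have := Jj; rewrite mem_idx => /and3P[srt lt /eqP sz].
  have -> : fc e (wedge2 e`_0 v) J = if nth 0%N J 0 == 0%N then fc e w J else 0.
    case: J sz lt srt {Jj} => [|a [|b []]] //= _ /and3P[a8 b8 _] /andP[ab _].
    rewrite /fc ev_wedge2 !ipe // !vE // [(0 == b)%N]eq_sym (gtn_eqF (leq_ltn_trans (leq0n a) ab)) mul0r subr0.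
    by case: a {a8 ab} => [|a]; rewrite ?mul1r ?mul0r.
  rewrite (bigD1 j) //= big1 ?addr0 => [|i ij].
    rewrite !mxE /entz !(nth_map [::]) // -/J eqxx.
    by case: ifP => _; rewrite ?mulr1 ?mulr0.
  rewrite !mxE /entz !(nth_map [::]) // nth_uniq ?combs_uniq ?iota_uniq //.
  by rewrite -val_eqE /= in ij; rewrite (negPf ij) mulr0.
have TM : (T + 1%:M) *m zmx (N 2) (N 2) M *m (T + 1%:M) = T + 1%:M.
  have sT : (T + 1%:M)^T = T + 1%:M by rewrite linearD /= Tmx_sym trmx1.
  have sM : zmx (N 2) (N 2) M = (zmx (N 2) (N 2) M)^T.
    by rewrite zmx_trz; congr (zmx _ _ _); vm_compute.
  have n1 : narrow (N 2) P2_7 by vm_compute.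
  have n2 : narrow (N 2) (mulzT P2_7 M) by vm_compute.
  have PMP : mulzT (mulzT P2_7 M) P2_7 = P2_7 by vm_compute.
  rewrite -[X in _ *m X]sT sM -P2_7_mx -(zmx_mulzT _ _ _ _ n1).
  by rewrite -(zmx_mulzT _ _ _ _ n2) PMP.
have w4 : kap w *m (T + 1%:M) = 4 *: kap w.
  by rewrite mulmxDr mulmx1 -kappa_star2 w3 kappaZ -[X in _ + X]scale1r -scalerDl natr1.
have w4' : kap w = 4^-1 *: (kap w *m (T + 1%:M)).
  by rewrite w4 scalerK // pnatr_eq0.
set r := kap w *m _; rewrite -[X in X + _]mulmx1 -mulmxDr [1%:M + T]addrC.
by rewrite /r w4' -[in LHS]TM -!scalemxAl !mulmxA.
Qed.

Lemma form_ip_interior2 w u v : form_ip ip w (interior2 u v) = - ev (star2 w) [:: u; v].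
Proof.
rewrite -form_ip_wedge2 form_ip_star2 star2_wedge2 !(form_ip_mx eO e8).
by rewrite kappaN [(- _)^T]linearN mulmxN [in RHS]mxE opprK.
Qed.

Lemma ev_tuple2 (h : altform W 2) u v : h [tuple u; v] = ev h [:: u; v].
Proof. by rewrite -ev_tuple. Qed.

(** The left-hand side is [- (star2 w)(u, v)]. *)
Lemma L2_21_interior w :
  w \in L2_21 <-> forall u v, form_ip ip w (interior2 u v) = w [tuple u; v].
Proof.
split=> [/mem_L2_21 sw u v|H]; first by rewrite form_ip_interior2 sw evN opprK ev_tuple2.
apply/mem_L2_21/ev_eqP => -[|u [|v []]] // _.
by rewrite evN -(ev_tuple2 w) -H form_ip_interior2 opprK.
Qed.

End CayleySplitting.

(** * The Lie algebra of the stabilizer *)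

Section LieDerivatives.
Variables (R : realType) (W : vectType R) (ip : {dot W for idfun}) (e : seq W).
Hypothesis eO : onb ip e.
Hypothesis e8 : size e = 8%N.
Variable Phi : altform W 4.
Hypothesis PhiE : forall J, J \in idx 8 4 -> fc e Phi J = zr R (cayley_coef J).
Variable vol : altform W 8.
Hypothesis vol1 : ev vol e = 1.
Local Notation zr := (zr R).
Local Notation zmx := (zmx R).
Local Notation N k := (size (idx 8 k)).
Local Notation kap := (kappa e 8).
Local Notation T := (Tmx R).
Local Notation D2 := (D2mx R).
Local Notation S := (Smx R).

Let inj k (f g : altform W k) : kap f = kap g -> f = g.
Proof. exact: (kappa_inj eO e8). Qed.

Let ipe a b : (a < 8)%N -> (b < 8)%N -> ip e`_a e`_b = (a == b)%:R.
Proof. by move=> a8 b8; rewrite (proj2 eO) ?e8. Qed.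

Lemma lie_derivative_sum k (I : Type) (r : seq I) (c : I -> R) (g : I -> 'End(W)) (f : altform W k) :
  lie_derivative (\sum_(i <- r) c i *: g i) f = \sum_(i <- r) c i *: lie_derivative (g i) f.
Proof.
apply: ev_eqP => s sz; rewrite (ev_lie_derivative eO) //.
have -> : ev (\sum_(i <- r) c i *: lie_derivative (g i) f) s =
    \sum_(i <- r) c i * ev (lie_derivative (g i) f) s.
  by elim: r => [|i r IH]; rewrite ?big_nil // !big_cons evD evZ IH.
under [RHS]eq_bigr => i _ do rewrite (ev_lie_derivative eO) // /lie_ev mulr_sumr.
rewrite exchange_big /=; apply: eq_big_seq => j; rewrite mem_iota add0n => /= ltj.
rewrite sum_lfunE; under [X in _ ++ X :: _]eq_bigr do rewrite scale_lfunE.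
rewrite (ev_slot_sum f (drop j.+1 s) r c (fun i => g i s`_j)) //.
by rewrite -sz size_takel // ltnW.
Qed.

Lemma kappa_unit_lfun a b : wf_gen 4 [:: (a, b, 1%ZZ)] ->
  kap (lie_derivative (unit_lfun ip e`_a e`_b) Phi) = zrow R (N 4) (lie_row a b).
Proof.
move=> wf; have -> : unit_lfun ip e`_a e`_b = skew_end ip e [:: (a, b, 1%ZZ)].
  by rewrite /skew_end big_seq1 zr1 scale1r.
apply/rowP => j; have Jj : nth [::] (idx 8 4) j \in idx 8 4 by rewrite mem_nth.
rewrite mxE [RHS]mxE lie_row_entry //; set J := nth _ _ _ in Jj *.
have := Jj; rewrite mem_idx => /and3P[_ lt /eqP sz]; have /andP[X8 /allP wfJ] := wf.
rewrite (fc_lie eO e8) // zr_sumz big_map; apply: eq_big_seq => q ql.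
have /andP[/eqP szq ltq] := allP (wfJ J Jj) q ql.
by rewrite (fc_Phi PhiE) // zrM.
Qed.

Lemma kappa_lie_unit p : p \in index_pairs ->
  kap (lie_derivative (unit_lfun ip e`_p.1 e`_p.2) Phi) = zrow R (N 4) (lie_row p.1 p.2).
Proof.
move=> pI; apply: kappa_unit_lfun.
have : all (fun p => wf_gen 4 [:: (p.1, p.2, 1%ZZ)]) index_pairs by vm_compute.
by move/allP; apply.
Qed.

Lemma end_frame (g : 'End(W)) :
  g = \sum_(p <- index_pairs) ip e`_p.1 (g e`_p.2) *: unit_lfun ip e`_p.1 e`_p.2.
Proof. by rewrite {1}(lfun_frame eO g) /pairs e8. Qed.

Lemma kappa_lie_sum xi : kap (lie_derivative xi Phi) =
  \sum_(p <- index_pairs) ip e`_p.1 (xi e`_p.2) *: zrow R (N 4) (lie_row p.1 p.2).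
Proof.
rewrite {1}[xi]end_frame lie_derivative_sum linear_sum.
by apply: eq_big_seq => p /kappa_lie_unit <-; apply: kappaZ.
Qed.

(** The Gram matrix of the map from [xi] to [L_xi Phi] is invertible on symmetric
    endomorphisms and does not mix them with skew ones, so the kernel is skew. *)
Lemma lie0_so xi : lie_derivative xi Phi = 0 -> so ip xi.
Proof.
move=> L0; pose x : 'rV[R]_(size index_pairs) :=
  \row_j (let p := nth (0, 0)%N index_pairs j in ip e`_p.1 (xi e`_p.2)).
have xD : x *m zmx _ (N 4) Dz = 0.
  have <- : kap (lie_derivative xi Phi) = 0 by rewrite L0 linear0.
  rewrite kappa_lie_sum mulmx_sum_row (big_nth (0, 0)%N) big_mkord; apply: eq_bigr => j _.
  by rewrite row_zmx mxE Dz_entry.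
have n1 : narrow (N 4) Dz by vm_compute.
have n2 : narrow (size index_pairs) (mulzT Dz Dz) by vm_compute.
have xS : x *m zmx _ (size index_pairs) sym_pairs = 0.
  apply: (@scalerI _ _ (zr 56)); first by rewrite zr_eq0.
  rewrite scaler0 scalemxAr -zmx_scalez -Dz_symmetrizes (zmx_mulzT _ _ _ _ n2) (zmx_mulzT _ _ _ _ n1).
  by rewrite !mulmxA xD !mul0mx.
have sk a b : (a < 8)%N -> (b < 8)%N -> ip e`_a (xi e`_b) = - ip e`_b (xi e`_a).
  move=> a8 b8.
  have pI (c d : nat) : (c < 8)%N -> (d < 8)%N -> (c, d) \in index_pairs.
    by move=> c8 d8; apply/allpairsP; exists (c, d); rewrite !(mem_iota 0 8).
  have up : uniq index_pairs by vm_compute.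
  have entr c d : (c < 8)%N -> (d < 8)%N ->
     \sum_(p <- index_pairs) ip e`_p.1 (xi e`_p.2) * ((p.1 == c) && (p.2 == d))%:R =
     ip e`_c (xi e`_d).
    move=> c8 d8; rewrite (bigD1_seq (c, d)) ?pI //= !eqxx mulr1 big1 ?addr0 // => p pcd.
    by rewrite -xpair_eqE -surjective_pairing (negPf pcd) mulr0.
  have := xS => /rowP; have ltp : (index (a, b) index_pairs < size index_pairs)%N by rewrite index_mem pI.
  move=> /(_ (Ordinal ltp)); rewrite !mxE.
  under eq_bigr => p _.
    rewrite !mxE /entz /sym_pairs (nth_map (0, 0)%N) // (nth_map (0, 0)%N) // nth_index ?pI //= zrD !zrM.
    over.
  have zd (i j : nat) : zr (deltaz i j) = (i == j)%:R by rewrite /deltaz; case: eqP.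
  under eq_bigr do rewrite !zd mulrDr -!natrM !mulnb.
  rewrite -(big_mkord xpredT (fun i => let p := nth (0, 0)%N index_pairs i in ip e`_p.1 (xi e`_p.2) * ((p.1 == a) && (p.2 == b))%:R + ip e`_p.1 (xi e`_p.2) * ((p.1 == b) && (p.2 == a))%:R)).
  rewrite -(big_nth (0, 0)%N xpredT (fun p => ip e`_p.1 (xi e`_p.2) * ((p.1 == a) && (p.2 == b))%:R + ip e`_p.1 (xi e`_p.2) * ((p.1 == b) && (p.2 == a))%:R)) big_split /=.
  by rewrite !entr // => /eqP; rewrite addr_eq0 => /eqP.
move=> u v; rewrite ipC (frame_expand eO e8 u) (frame_expand eO e8 v).
rewrite !(linear_sum xi) !ip_suml; under [in RHS]eq_bigr do rewrite ip_sumr.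
rewrite [in RHS]exchange_big /= -sumrN; apply: eq_big_seq => a; rewrite (mem_iota 0 8) => /= a8.
rewrite ip_sumr -sumrN; apply: eq_big_seq => b; rewrite (mem_iota 0 8) => /= b8.
by rewrite !ipZl !(linearZZ xi) !ipZr sk //; ring.
Qed.

Section OmegaForm.
Variables (xi : 'End(W)) (xi_so : so ip xi).

Fact omega_multilinear : multilinear (omega ip xi).
Proof.
move=> i t a x y; rewrite /omega !tnth_tset; case: (unliftP ord0 i) => [j ->|->].
  by rewrite (ord1 j) /= linearP ipDr ipZr.
by rewrite /= ipDl ipZl.
Qed.

Fact omega_alternating : Defs.alternating (omega ip xi).
Proof.
move=> i j t ij tij; have : tnth t ord0 = tnth t ord_max.
  move: ij tij; case: (unliftP ord0 i) => [i' ->|->]; case: (unliftP ord0 j) => [j' ->|->] //.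
  - by rewrite (ord1 i') (ord1 j') eqxx.
  - by rewrite (ord1 i') => _ <-; congr tnth; apply: val_inj.
  - by rewrite (ord1 j') => _ ->; congr tnth; apply: val_inj.
rewrite /omega => ->; set u := tnth _ _; have := xi_so u u; rewrite ipC => /eqP.
by rewrite -addr_eq0 -mulr2n mulrn_eq0 => /eqP.
Qed.

Definition omega_form : altform W 2 := Form omega_multilinear omega_alternating.

Lemma ev_omega_form x y : ev omega_form [:: x; y] = ip x (xi y).
Proof. by rewrite -ev_tuple2. Qed.

Lemma kappa_lie_so : kap (lie_derivative xi Phi) = kap omega_form *m D2.
Proof.
rewrite kappa_lie_sum (perm_big _ index_pairs_split) !big_cat !big_map /=.
rewrite [X in _ + (_ + X)]big1 ?addr0 => [|i _]; last first.
  have := xi_so e`_i e`_i; rewrite ipC => /eqP; rewrite -addr_eq0 -mulr2n mulrn_eq0 => /eqP ->.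
  by rewrite scale0r.
rewrite -big_split mulmx_sum_row (big_nth [::]) big_mkord; apply: eq_bigr => j _ /=.
rewrite row_zmx D2z_entry /= scalerBr -!scaleNr !mxE; set K := nth [::] _ j.
have := mem_nth [::] (ltn_ord j); rewrite mem_idx -/K => /and3P[_ _ /eqP szK].
have -> : fc e omega_form K = ip e`_(nth 0%N K 0) (xi e`_(nth 0%N K 1)).
  by case: K szK => [|a [|b []]] //= _; rewrite /fc ev_omega_form.
by rewrite -[ip _ (xi e`_(nth 0%N K 0))]ipC xi_so.
Qed.

End OmegaForm.

(** The skew endomorphism [xi] with [omega_xi = w]. *)
Definition end_of (w : altform W 2) : 'End(W) :=
  \sum_(p <- index_pairs) ev w [:: e`_p.1; e`_p.2] *: unit_lfun ip e`_p.1 e`_p.2.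

Lemma ip_end_of w x y : ip x (end_of w y) = ev w [:: x; y].
Proof.
rewrite [in RHS](frame_expand eO e8 x) (@ev_slot_sum _ _ _ w [::]) //.
rewrite /end_of sum_lfunE ip_sumr big_allpairs_dep /=; apply: eq_bigr => a _.
rewrite [in RHS](frame_expand eO e8 y) (@ev_slot_sum _ _ _ w [:: e`_a]) // mulr_sumr; apply: eq_bigr => b _.
by rewrite scale_lfunE unit_lfunE !ipZr [ip x _]ipC /=; ring.
Qed.

Lemma end_of_so w : so ip (end_of w).
Proof. by move=> u v; rewrite ipC !ip_end_of ev2_skew. Qed.

Lemma omega_form_end_of w : omega_form (end_of_so w) = w.
Proof. by apply: ev_eqP => -[|x [|y []]] // _; rewrite ev_omega_form ip_end_of. Qed.

Lemma omega_lie_algebra xi : lie_algebra (stabilizer Phi) xi <-> lie_derivative xi Phi = 0.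
Proof. exact: (lie_algebraP eO _ (Phi_nondegenerate eO e8 PhiE)). Qed.

(** On skew endomorphisms the map is [D2], with [D2 D2^T = 8 (T + 1)] and [(3 - T)
    D2 = 0]; its kernel is therefore the eigenspace of [T] for [-1]. *)
Lemma lie_omega_L2_21 xi (xi_so : so ip xi) :
  lie_derivative xi Phi = 0 <-> omega_form xi_so \in L2_21 e.
Proof.
rewrite (mem_L2_21 eO e8 PhiE vol1); split=> [L0|].
  have : kap (omega_form xi_so) *m (D2 *m D2^T) = 0.
    by rewrite mulmxA -kappa_lie_so L0 linear0 mul0mx.
  rewrite D2_gram -scalemxAr => /eqP; rewrite scaler_eq0 pnatr_eq0 /= mulmxDr mulmx1.
  by rewrite addr_eq0 -(kappa_star2 eO e8 PhiE vol1) -kappaN => /eqP/inj.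
move/(congr1 (kappa e 8 (k := 2))); rewrite (kappa_star2 eO e8 PhiE vol1) kappaN => wT.
apply: inj; rewrite kappa_lie_so linear0.
have : 4 *: (kap (omega_form xi_so) *m D2) = kap (omega_form xi_so) *m ((3%:M - T) *m D2).
  rewrite mulmxA mulmxBr mul_mx_scalar wT opprK -[X in _ + X]scale1r -scalerDl natr1.
  by rewrite scalemxAl.
rewrite P2_21_D2 mulmx0 => /eqP; rewrite scaler_eq0 pnatr_eq0 /= => /eqP.
by [].
Qed.

End LieDerivatives.

(** * Three-forms and four-forms *)

Section ThreeAndFourForms.
Variables (R : realType) (W : vectType R) (ip : {dot W for idfun}) (e : seq W).
Hypothesis eO : onb ip e.
Hypothesis e8 : size e = 8%N.
Variable Phi : altform W 4.
Hypothesis PhiE : forall J, J \in idx 8 4 -> fc e Phi J = zr R (cayley_coef J).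
Variable vol : altform W 8.
Hypothesis vol1 : ev vol e = 1.
Local Notation zr := (zr R).
Local Notation zmx := (zmx R).
Local Notation N k := (size (idx 8 k)).
Local Notation kap := (kappa e 8).
Local Notation D2 := (D2mx R).
Local Notation S := (Smx R).
Local Notation A := (zmx 8 (N 3) Az).
Local Notation f := (zmx 1 (N 4) fz).

Let inj k (f g : altform W k) : kap f = kap g -> f = g.
Proof. exact: (kappa_inj eO e8). Qed.

Definition L3_8 : {vspace altform W 3} := prj_space e 8 3 (7%ZZ, P3_8).
Definition L3_48 : {vspace altform W 3} := prj_space e 8 3 (7%ZZ, P3_48).
Definition L4_1 : {vspace altform W 4} := prj_space e 8 4 (14%ZZ, P4_1).
Definition L4_7 : {vspace altform W 4} := prj_space e 8 4 (8%ZZ, P4_7).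
Definition L4_27 : {vspace altform W 4} := prj_space e 8 4 (56%ZZ, P4_27).
Definition L4_35 : {vspace altform W 4} := prj_space e 8 4 (2%ZZ, P4_35).

Lemma P3_8_mx : zmx (N 3) (N 3) P3_8 = A^T *m A.
Proof.
have n1 : narrow 8 (trz (N 3) Az) by vm_compute.
by rewrite P3_8E -[56%N]/(N 3) (zmx_mulzT _ _ _ _ n1) -!zmx_trz trmxK.
Qed.

Lemma P3_48_mx : zmx (N 3) (N 3) P3_48 = 7%:M - zmx (N 3) (N 3) P3_8.
Proof. by rewrite P3_48E (zmx_affz R (N 3)) scaleN1r addrC. Qed.

Lemma mem_L3_8 w : w \in L3_8 <-> exists u, interior_product u Phi = w.
Proof.
rewrite mem_prj_space // P3_8_mx; split=> [w7|[u <-]]; last first.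
  by rewrite (kappa_interior_Phi eO e8 PhiE) -!mulmxA [A *m (_ *m _)]mulmxA A_orth mul_scalar_mx -scalemxAr.
pose r := 7^-1 *: (kap w *m A^T).
exists (\sum_(i <- iota 0 8) r 0 (inord i) *: e`_i); apply: inj.
rewrite (kappa_interior_Phi eO e8 PhiE).
have -> : \row_(i < 8) ip e`_i (\sum_(j <- iota 0 8) r 0 (inord j) *: e`_j) = r.
  apply/rowP => i; rewrite mxE ip_sumr (bigD1_seq (val i)) ?mem_iota ?iota_uniq //=.
  rewrite big_seq_cond big1 => [|j /andP[]]; last first.
    rewrite (mem_iota 0 8) => /= j8 ji; rewrite ipZr (proj2 eO) ?e8 ?ltn_ord //.
    by rewrite eq_sym (negPf ji) mulr0.
  by rewrite ipZr (proj2 eO) ?e8 ?ltn_ord // eqxx mulr1 addr0 inord_val.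
by rewrite /r -scalemxAl -mulmxA w7 scalerK // pnatr_eq0.
Qed.

Lemma kappa_wedge3 w : kap (Phi ∧ w : altform W 7) = kap w *m (zmx (N 7) (N 3) wedge3z)^T.
Proof.
apply: (kappa_op (k := 3) (k' := 7) (lc := lc_wedge)) => [|J JI]; first by vm_compute.
exact: (@fc_wedge_Phi _ _ _ _ PhiE 3).
Qed.

(** [Phi ∧ .] on 3-forms and the contraction with [Phi] have the same Gram matrix
    [P3_8], hence the same kernel. *)
Lemma mem_L3_48 w : w \in L3_48 <-> Phi ∧ w = 0.
Proof.
rewrite mem_prj_space // P3_48_mx mulmxBr mul_mx_scalar.
have n1 : narrow (N 7) (trz (N 3) wedge3z) by vm_compute.
have n2 : narrow (N 3) wedge3z by vm_compute.
have B8 : zmx (N 3) (N 3) P3_8 = (zmx (N 7) (N 3) wedge3z)^T *m zmx (N 7) (N 3) wedge3z.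
  by rewrite -mulzT_wedge3 -[56%N]/(N 3) (zmx_mulzT _ _ _ _ n1) -!zmx_trz trmxK.
have B7 : zmx (N 7) (N 3) wedge3z *m (zmx (N 7) (N 3) wedge3z)^T = 7%:M.
  rewrite -(zmx_mulzT _ _ _ _ n2) wedge3_gram (zmx_tabz R (N 7) (N 7)).
  apply/matrixP => i j; rewrite !mxE zrM /deltaz -val_eqE /=.
  by case: eqP => _; rewrite ?mulr1 ?mulr0.
have -> : (7 *: kap w - kap w *m zmx (N 3) (N 3) P3_8 = zr (7%ZZ, P3_48).1 *: kap w) <->
    kap w *m zmx (N 3) (N 3) P3_8 = 0.
  split=> [/eqP|->]; last by rewrite subr0.
  by rewrite -[X in _ == X]subr0 => /eqP/addrI/oppr_inj.
split=> [w0|w0]; last first.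
  rewrite B8 mulmxA -kappa_wedge3 -[X in kap X]/(Phi ∧ w) w0.
  by rewrite (linear0 (kappa e 8 (k := 7))) mul0mx.
have kw0 : kap (Phi ∧ w : altform W 7) = 0.
  rewrite kappa_wedge3; have : kap w *m zmx (N 3) (N 3) P3_8 *m (zmx (N 7) (N 3) wedge3z)^T = 0.
    by rewrite w0 mul0mx.
  rewrite B8 -!mulmxA B7 mul_mx_scalar -scalemxAr => /eqP.
  by rewrite scaler_eq0 pnatr_eq0 /= => /eqP.
by apply: (@inj 7); rewrite kw0 (linear0 (kappa e 8 (k := 7))).
Qed.

Lemma kappa_star4 w : kap (hodge ip 4 4 vol w) = kap w *m S.
Proof.
rewrite -Smx_sym; have wf : wf_lc 4 4 (lc_star 4) by vm_compute.
apply: (kappa_op (k := 4) (k' := 4) wf) => J JI.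
exact: (@fc_star _ _ _ _ eO e8 4 4 vol _ J erefl vol1 uniq_splits4 splits4_idx (allP idx_splits4 J JI)).
Qed.

Lemma wedge_hodge4 (g w : altform W 4) : g ∧ hodge ip 4 4 vol w = form_ip ip g w *: vol.
Proof.
apply: (@wedge_star _ _ _ _ eO 8 e8 4 4 erefl vol) => // q qs.
exact: (@fc_hodge _ _ _ _ eO 8 e8 4 4 erefl uniq_splits4 splits4_idx vol).
Qed.

Lemma mem_L4_35 w : w \in L4_35 <-> hodge ip 4 4 vol w = - w.
Proof.
rewrite mem_prj_space // P4_35_mx mulmxBr mulmx1 -kappa_star4.
rewrite (_ : zr 2 *: kap w = kap w - kap (- w)); last first.
  by rewrite kappaN opprK -mulr2n -scaler_nat.
by split=> [/addrI/oppr_inj/inj|->].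
Qed.

Lemma f_gram : f *m f^T = 14%:M.
Proof.
have n1 : narrow (N 4) fz by vm_compute.
rewrite -(zmx_mulzT _ _ _ _ n1) fz_gram [LHS]mx11_scalar; congr (_%:M).
by rewrite mxE.
Qed.

Lemma P4_1_mx : zmx (N 4) (N 4) P4_1 = f^T *m f.
Proof.
have n1 : narrow 1 (trz (N 4) fz) by vm_compute.
by rewrite P4_1E -[70%N]/(N 4) (zmx_mulzT _ _ _ _ n1) -!zmx_trz trmxK.
Qed.

Lemma L4_1E : L4_1 = <[Phi]>%VS.
Proof.
apply/vspaceP => w; apply/idP/vlineP => [|[c ->]].
  rewrite mem_prj_space // P4_1_mx mulmxA [kap w *m _]mx11_scalar mul_scalar_mx => w14.
  exists (14^-1 * (kap w *m f^T) 0 0); apply: inj; rewrite kappaZ (kappa_Phi PhiE) -scalerA w14.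
  by rewrite scalerK // pnatr_eq0.
rewrite mem_prj_space // P4_1_mx kappaZ (kappa_Phi PhiE) -scalemxAl mulmxA f_gram mul_scalar_mx.
by rewrite !scalerA mulrC.
Qed.

Lemma P4_7_mx : 4 *: zmx (N 4) (N 4) P4_7 = D2^T *m D2.
Proof.
have n1 : narrow (N 2) (trz (N 4) D2z) by vm_compute.
rewrite -[4]/(zr 4) -zmx_scalez P4_7E -[70%N]/(N 4) (zmx_mulzT _ _ _ _ n1).
by rewrite -!zmx_trz trmxK.
Qed.

(** [D2^T D2 = 4 P4_7] and [D2 P4_7 = 8 D2], so the eigenspace is the image of [D2];
    and every 2-form is some [omega_xi]. *)
Lemma mem_L4_7 w : w \in L4_7 <-> exists2 xi, so ip xi & lie_derivative xi Phi = w.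
Proof.
rewrite mem_prj_space //; split=> [w8|[xi xi_so <-]]; last first.
  rewrite (kappa_lie_so eO e8 PhiE xi_so) scalemxAr -mulmxA; congr (_ *m _).
  have n1 : narrow (N 4) D2z by vm_compute.
  have sP : zmx (N 4) (N 4) P4_7 = (zmx (N 4) (N 4) P4_7)^T.
    by rewrite zmx_trz trz_P4_7.
  by rewrite sP -(zmx_mulzT _ _ _ _ n1) D2_P4_7 zmx_scalez.
pose r := 32^-1 *: (kap w *m D2^T).
exists (end_of ip e (kinv ip e r)); first exact: end_of_so.
apply: inj; rewrite (kappa_lie_so eO e8 PhiE (end_of_so eO e8 _)) omega_form_end_of.
rewrite (kinvK eO e8) /r -scalemxAl -mulmxA -P4_7_mx -scalemxAr w8 !scalerA.
rewrite -[RHS]scale1r; congr (_ *: _); rewrite -[zr _]/(8 : R).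
by field.
Qed.

Lemma P4_27_mx : zmx (N 4) (N 4) P4_27 =
  28 *: (1%:M + S) - (4 *: zmx (N 4) (N 4) P4_1 + 7 *: zmx (N 4) (N 4) P4_7).
Proof.
have -> : P4_27 = tabz 70 70 (fun i j =>
  Z.sub (Z.mul 28 (Z.add (deltaz i j) (entz Sz i j)))
        (Z.add (Z.mul 4 (entz P4_1 i j)) (Z.mul 7 (entz P4_7 i j)))) by apply/eqP; vm_compute.
rewrite (zmx_tabz R (N 4) (N 4)); apply/matrixP => i j.
have zrB a b : zr (Z.sub a b) = zr a - zr b by rewrite -zrN -zrD.
by rewrite !mxE zrB !zrD !zrM zrD /deltaz -val_eqE; case: eqP.
Qed.

(** [Phi] and all [L_xi Phi] are self-dual, so exterior products with them are inner
    products: the right-hand side describes the self-dual forms orthogonal to the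
    first two summands. *)
Lemma mem_L4_27 w : w \in L4_27 <->
  [/\ hodge ip 4 4 vol w = w, w ∧ Phi = 0 &
      forall xi, so ip xi -> w ∧ lie_derivative xi Phi = 0].
Proof.
have sS : hodge ip 4 4 vol w = w <-> kap w *m S = kap w.
  by rewrite -kappa_star4; split=> [->|/inj].
have vol0 : vol != 0 by apply: contraTneq isT => v0; have := vol1; rewrite v0 => /esym/eqP; rewrite oner_eq0.
have ortho g : hodge ip 4 4 vol g = g -> w ∧ g = 0 <-> kap w *m (kap g)^T = 0.
  move=> gg; rewrite -{1}gg wedge_hodge4 (form_ip_mx eO e8); split=> [/eqP|->].
    by rewrite scaler_eq0 (negPf vol0) orbF => /eqP w0; rewrite [LHS]mx11_scalar w0 raddf0.
  by rewrite mxE scale0r.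
have starPhi : hodge ip 4 4 vol Phi = Phi.
  apply: inj; rewrite kappa_star4 (kappa_Phi PhiE).
  have n1 : narrow (N 4) fz by vm_compute.
  by rewrite -Smx_sym -(zmx_mulzT _ _ _ _ n1) fz_Sz.
have n2 : narrow (N 4) D2z by vm_compute.
have D2S : D2 *m S = D2.
  by rewrite -Smx_sym -(zmx_mulzT _ _ _ _ n2) D2z_Sz.
have starL xi : so ip xi -> hodge ip 4 4 vol (lie_derivative xi Phi) = lie_derivative xi Phi.
  by move=> xs; apply: inj; rewrite kappa_star4 (kappa_lie_so eO e8 PhiE xs) -mulmxA D2S.
rewrite mem_prj_space //; split=> [w56|[/sS wS /(ortho _ starPhi) w1 w7]]; last first.
  have w7' : kap w *m D2^T = 0.
    apply: trmx_inj; apply/row_matrixP => j; rewrite trmx0 row0.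
    rewrite trmx_mul trmxK rowE -[delta_mx 0 j](kinvK eO e8).
    rewrite mulmxA -(omega_form_end_of eO e8 (kinv ip e _)).
    rewrite -(kappa_lie_so eO e8 PhiE (end_of_so eO e8 _)); apply: trmx_inj.
    rewrite trmx_mul trmxK trmx0; apply/ortho; first exact/starL/end_of_so.
    exact/w7/end_of_so.
  rewrite P4_27_mx mulmxBr mulmxDr -!scalemxAr P4_1_mx -(kappa_Phi PhiE) mulmxA w1 mul0mx scaler0 add0r.
  have -> : kap w *m zmx (N 4) (N 4) P4_7 = 0.
    apply: (@scalerI _ _ 4); first by rewrite pnatr_eq0.
    by rewrite scaler0 scalemxAr P4_7_mx mulmxA w7' mul0mx.
  rewrite scaler0 subr0 mulmxDr mulmx1 wS -mulr2n -[kap w *+ 2]scaler_nat scalerA; congr (_ *: _).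
  by rewrite -natrM.
have n3 : narrow (N 4) P4_27 by vm_compute.
have kill m (B : 'M[R]_(N 4, m)) : zmx (N 4) (N 4) P4_27 *m B = 0 -> kap w *m B = 0.
  move=> PB; apply: (@scalerI _ _ (zr 56)); first by rewrite zr_eq0.
  by rewrite scaler0 scalemxAl -w56 -mulmxA PB mulmx0.
split.
- apply/sS/eqP; rewrite -subr_eq0 -[X in _ - X]mulmx1 -mulmxBr; apply/eqP/kill.
  rewrite mulmxBr mulmx1 -Smx_sym -(zmx_mulzT _ _ _ _ n3) P4_27_Sz.
  by rewrite subrr.
- apply/(ortho _ starPhi)/kill; rewrite (kappa_Phi PhiE) -(zmx_mulzT _ _ _ _ n3).
  exact/zmx_null/P4_27_fz.
- move=> xi xs; apply/(ortho _ (starL xi xs)).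
  rewrite (kappa_lie_so eO e8 PhiE xs) trmx_mul mulmxA kill ?mul0mx //.
  by rewrite -(zmx_mulzT _ _ _ _ n3); apply/zmx_null/P4_27_D2z.
Qed.

End ThreeAndFourForms.

(** * The stabilizer acts by isometries *)

Section PullbackAlgebra.
Variables (R : realType) (W : vectType R) (g : 'End(W)).

Lemma pullback_wedge k m (f : altform W k) (h : altform W m) :
  pullback g (f ∧ h) = pullback g f ∧ pullback g h.
Proof.
apply: ev_eqP => s sz; rewrite ev_pullback !ev_wedge ?size_map // /shuffle_sum splits_map big_map.
by apply: eq_bigr => q _; rewrite !ev_pullback.
Qed.

Lemma pullback_interior k u (f : altform W k.+1) :
  pullback g (interior_product (g u) f) = interior_product u (pullback g f).
Proof. by apply: ev_eqP => s _; rewrite ev_pullback !ev_interior ev_pullback. Qed.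

Lemma pullbackD k (f h : altform W k) : pullback g (f + h) = pullback g f + pullback g h.
Proof. exact/formP. Qed.
Lemma pullbackZ k a (f : altform W k) : pullback g (a *: f) = a *: pullback g f.
Proof. exact/formP. Qed.
Lemma pullbackN k (f : altform W k) : pullback g (- f) = - pullback g f.
Proof. by rewrite -scaleN1r pullbackZ scaleN1r. Qed.

Lemma lker0_surj : lker g = 0%VS -> forall u, exists v, g v = u.
Proof.
move=> g0 u; exists ((g^-1)%VF u); apply: limg_lfunVK.
suff -> : limg g = fullv by apply: memvf.
apply/eqP; rewrite eqEdim subvf /= limg_dim_eq // g0.
by apply/eqP; rewrite capv0.
Qed.

End PullbackAlgebra.

Section StabilizerIsometry.
Variables (R : realType) (W : vectType R) (ip : {dot W for idfun}) (e : seq W).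
Hypothesis eO : onb ip e.
Hypothesis e8 : size e = 8%N.
Variable Phi : altform W 4.
Hypothesis PhiE : forall J, J \in idx 8 4 -> fc e Phi J = zr R (cayley_coef J).
Variable vol : altform W 8.
Hypothesis vol1 : ev vol e = 1.
Local Notation kap := (kappa e 8).

Lemma wedge_hodge6 (h : altform W 6) (q : altform W 2) :
  h ∧ q = form_ip ip (hodge ip 6 2 vol h) q *: vol.
Proof.
have pe : perm_eq (idx 8 2) [seq q.2 | q <- splits 6 (iota 0 8)] by vm_compute.
apply: (top_form_eq eO e8); rewrite evZ vol1 mulr1 (form_ip_idx eO e8) (perm_big _ pe) big_map.
rewrite -{1}(map_nth_iota0 e8) -[LHS]/(fc e _ _) (@ev_wedge_frame R W e 6 2) ?size_iota //.
apply: eq_big_seq => p ps.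
by rewrite (@fc_hodge _ _ _ _ eO 8 e8 6 2 erefl uniq_splits6 splits6_idx vol h p vol1 ps) mulrA.
Qed.

Lemma vol_Phi : vol = 14^-1 *: (Phi ∧ Phi : altform W 8).
Proof.
apply: (top_form_eq eO e8); rewrite evZ vol1.
have -> : ev (Phi ∧ Phi : altform W 8) e = 14%:R := ev_Phi_Phi e8 PhiE.
by rewrite mulVf // pnatr_eq0.
Qed.

Local Notation star := (star2 ip Phi vol).

(** Put [a = u^* ∧ v^*], so that [w = - star a]. The left-hand side is [<star^3 a,
    a> vol] with [star^3 = 7 star + 6], and [<star a, a> = - Phi(v, u, u, v) = 0]. *)
Lemma gram_interior2 u v (w := interior2 Phi u v) :
  (Phi ∧ w) ∧ w = (6 * (ip u u * ip v v - ip u v ^+ 2)) *: vol.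
Proof.
rewrite [LHS](wedge_hodge6 (Phi ∧ w) w) -/(star w); congr (_ *: _).
have K := kappa_star2 eO e8 PhiE vol1.
have sN f : star (- f) = - star f by apply: (kappa_inj eO e8); rewrite kappaN !K kappaN mulNmx.
have sZ a f : star (a *: f) = a *: star f.
  by apply: (kappa_inj eO e8); rewrite kappaZ !K kappaZ scalemxAl.
have sD f h : star (f + h) = star f + star h by exact: (star2D eO e8 PhiE vol1).
have ipNN f h : form_ip ip (- f) (- h) = form_ip ip f h :> R.
  rewrite !(form_ip_mx eO e8) !kappaN mulNmx.
  by rewrite [(- _)^T]linearN mulmxN opprK.
have -> : w = - star (wedge2 ip u v) by rewrite (star2_wedge2 eO e8 PhiE vol1) opprK.
rewrite sN ipNN -(form_ip_star2 eO e8 PhiE vol1) (form_ip_wedge2 eO).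
have sq := star2_sq eO e8 PhiE vol1.
rewrite !sq !evD !evZ !evD !evZ.
have -> : ev (star (wedge2 ip u v)) [:: u; v] = 0.
  rewrite (star2_wedge2 eO e8 PhiE vol1) evN /interior2 !ev_interior.
  by rewrite (@ev_repeat _ _ _ Phi [::] [:: u; u] [::]) // oppr0.
rewrite ev_wedge2 [ip v u]ipC; ring.
Qed.

Variable g : 'End(W).
Hypothesis gG : stabilizer Phi g.
Let gPhi : pullback g Phi = Phi := proj2 gG.

Lemma pullback_vol : pullback g vol = vol.
Proof. by rewrite vol_Phi pullbackZ [pullback g _](pullback_wedge g Phi Phi) gPhi. Qed.

Lemma pullback_interior2 u v : pullback g (interior2 Phi (g u) (g v)) = interior2 Phi u v.
Proof. by rewrite /interior2 !pullback_interior gPhi. Qed.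

Let vol0 : vol != 0.
Proof. by apply: contraTneq isT => v0; have := vol1; rewrite v0 => /esym/eqP; rewrite oner_eq0. Qed.

Lemma gram_preserved u v :
  ip (g u) (g u) * ip (g v) (g v) - ip (g u) (g v) ^+ 2 = ip u u * ip v v - ip u v ^+ 2.
Proof.
have := congr1 (pullback g) (gram_interior2 (g u) (g v)).
rewrite !pullback_wedge pullback_interior2 gPhi [LHS]gram_interior2 pullbackZ pullback_vol.
move/eqP; rewrite -subr_eq0 -scalerBl scaler_eq0 (negPf vol0) orbF subr_eq0.
by move=> /eqP/(mulfI _) ->; rewrite ?pnatr_eq0.
Qed.

Lemma gram_preserved_polar u v w :
  ip (g u) (g u) * ip (g v) (g w) - ip (g u) (g v) * ip (g u) (g w) =
  ip u u * ip v w - ip u v * ip u w.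
Proof.
have := gram_preserved u (v + w); rewrite linearD /= !ipDl !ipDr.
have := gram_preserved u v; have := gram_preserved u w.
rewrite [ip (g w) (g v)]ipC [ip w v]ipC => E1 E2 E3.
apply: (@mulfI _ 2); first by rewrite pnatr_eq0.
rewrite -[LHS](addrK (ip (g u) (g u) * ip (g v) (g v) - ip (g u) (g v) ^+ 2
  + (ip (g u) (g u) * ip (g w) (g w) - ip (g u) (g w) ^+ 2))).
rewrite {2}E1 {2}E2; move: E3; set a := ip (g u) _; lra.
Qed.

(** The 2 by 2 minors of the Gram matrix of the images of three orthonormal vectors
    say that its adjugate is the identity. So it is a multiple [c] of the identity
    with [c^2 = 1], and [c = 1] by positivity. *)
Lemma orthonormal_preserved i j l : (i < 8)%N -> (j < 8)%N -> (l < 8)%N -> uniq [:: i; j; l] ->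
  ip (g e`_i) (g e`_j) = 0 /\ ip (g e`_i) (g e`_i) = 1.
Proof.
move=> i8 j8 l8; rewrite /= !inE negb_or andbT => /andP[/andP[ij il] jl].
have E a b : (a < 8)%N -> (b < 8)%N -> ip e`_a e`_b = (a == b)%:R.
  by move=> a8 b8; rewrite (proj2 eO) ?e8.
have := gram_preserved_polar e`_i e`_j e`_j; have := gram_preserved_polar e`_i e`_l e`_l.
have := gram_preserved_polar e`_j e`_l e`_l; have := gram_preserved_polar e`_i e`_j e`_l.
have := gram_preserved_polar e`_j e`_i e`_l; have := gram_preserved_polar e`_l e`_i e`_j.
rewrite !E // !eqxx [j == i]eq_sym [l == i]eq_sym [l == j]eq_sym (negPf ij) (negPf il) (negPf jl).
rewrite [ip (g e`_j) (g e`_i)]ipC [ip (g e`_l) (g e`_i)]ipC [ip (g e`_l) (g e`_j)]ipC.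
have := ip_ge0 ip (g e`_i); have := ip_ge0 ip (g e`_j); have := ip_ge0 ip (g e`_l).
move: (ip (g e`_i) (g e`_i)) (ip (g e`_j) (g e`_j)) (ip (g e`_l) (g e`_l)).
move: (ip (g e`_i) (g e`_j)) (ip (g e`_i) (g e`_l)) (ip (g e`_j) (g e`_l)).
rewrite /= !(mulr0n, mulr1n, mulr0, mul0r, mulr1, subr0) => x y z p q r r0 q0 p0 E1 E2 E3 E4 E5 E6.
have x0 : x = 0.
  have : x * (p * r - y * y) - p * (r * x - y * z) - y * (p * z - x * y) = 0 by ring.
  by rewrite E5 E1 E3 mulr1 !mulr0 !subr0.
have y0 : y = 0.
  have : y * (p * q - x * x) - p * (q * y - x * z) - x * (p * z - x * y) = 0 by ring.
  by rewrite E6 E2 E3 mulr1 !mulr0 !subr0.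
have z0 : z = 0.
  have : z * (p * q - x * x) - q * (p * z - x * y) - x * (q * y - x * z) = 0 by ring.
  by rewrite E6 E2 E3 mulr1 !mulr0 !subr0.
split=> //; move: E4 E5 E6; rewrite x0 y0 z0 !mul0r !subr0 => qr pr pq.
have pp : p ^+ 2 = 1 by rewrite -[RHS]mulr1 -{1}pq -pr -[LHS]mulr1 -qr; ring.
by apply/eqP; rewrite -(@eqrXn2 _ 2) ?expr1n ?pp.
Qed.

Lemma stabilizer_isometry u v : ip (g u) (g v) = ip u v.
Proof.
have other (i j : nat) : exists l : 'I_8, (i != l) && (j != l).
  suff /existsP[l l1] : [exists l : 'I_8, (i != l) && (j != l)] by exists l.
  apply: contraT; rewrite negb_exists => /forallP H.
  have := H (inord 0); have := H (inord 1); have := H (inord 2).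
  by rewrite /= !inordK //; lia.
have E i j : (i < 8)%N -> (j < 8)%N -> ip (g e`_i) (g e`_j) = ip e`_i e`_j.
  move=> i8 j8; rewrite (proj2 eO) ?e8 //; have [->|ij] := eqVneq i j.
    have [l /andP[lj _]] := other j j; have [m /andP[mj ml]] := other j l.
    have [] // := @orthonormal_preserved j l m; rewrite ?ltn_ord //= !inE negb_or.
    by rewrite lj mj ml.
  have [l /andP[li lj]] := other i j.
  have [] // := @orthonormal_preserved i j l; rewrite ?ltn_ord //= !inE negb_or ij.
  by rewrite li lj.
rewrite (frame_expand eO e8 u) (frame_expand eO e8 v) !(linear_sum g) !ip_suml.
apply: eq_big_seq => i; rewrite (mem_iota 0 8) => /= i8.
rewrite !ip_sumr; apply: eq_big_seq => j; rewrite (mem_iota 0 8) => /= j8.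
by rewrite !(linearZZ g) !ipZl !ipZr E.
Qed.

Lemma onb_image : onb ip (map g e).
Proof.
have [sz E] := eO; split; first by rewrite size_map.
move=> i j; rewrite size_map => li lj.
by rewrite !(nth_map 0) // stabilizer_isometry E.
Qed.

Lemma form_ip_pullback k (f h : altform W k) :
  form_ip ip (pullback g f) (pullback g h) = form_ip ip f h.
Proof.
rewrite (form_ipE _ _ eO) (form_ipE _ _ onb_image) combs_map big_map.
by apply: eq_bigr => w _; rewrite !ev_pullback.
Qed.

(** The image of the frame is again a positive orthonormal frame, and the Hodge
    operator permutes coefficients with the same signs in all of these. *)
Lemma hodge_pullback (w : altform W 4) :
  hodge ip 4 4 vol (pullback g w) = pullback g (hodge ip 4 4 vol w).
Proof.
have ge8 : size (map g e) = 8%N by rewrite size_map.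
have gvol1 : ev vol (map g e) = 1 by rewrite -ev_pullback pullback_vol.
have fcg (f : altform W 4) J : all (ltn^~ 8%N) J -> fc e (pullback g f) J = fc (map g e) f J.
  move=> /allP J8; rewrite /fc ev_pullback -map_comp; congr (ev f _); apply/eq_in_map => i /J8 i8.
  by rewrite /= (nth_map 0) // e8.
apply: (kappa_inj eO e8); apply/rowP => j; rewrite !mxE.
have Jj : nth [::] (idx 8 4) j \in idx 8 4 by rewrite mem_nth.
have /mapP[q qs JE] := allP idx_splits4 _ Jj; have := Jj; rewrite JE mem_idx => /and3P[_ lt _].
have lt1 : all (ltn^~ 8%N) q.1.2.
  by have := splits_idx qs; rewrite mem_idx => /and3P[].
rewrite fcg // (@fc_hodge _ _ _ _ eO 8 e8 4 4 erefl uniq_splits4 splits4_idx vol _ q vol1 qs) fcg //.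
by rewrite (@fc_hodge _ _ _ _ onb_image 8 ge8 4 4 erefl uniq_splits4 splits4_idx vol _ q gvol1 qs).
Qed.

(** [g^* L_xi Phi = L_eta Phi] for [eta = g^-1 xi g], as [g] preserves [Phi]; and
    [eta] is skew because [g] is an isometry. *)
Lemma pullback_lie xi (xi_so : so ip xi) :
  exists2 eta, so ip eta & pullback g (lie_derivative xi Phi) = lie_derivative eta Phi.
Proof.
have surj := lker0_surj (proj1 gG).
have gK x : g ((g^-1)%VF x) = x.
  by have [y <-] := surj x; rewrite limg_lfunVK // memv_img ?memvf.
pose eta := ((g^-1) \o xi \o g)%VF; exists eta.
  by move=> u v; rewrite -stabilizer_isometry -[in RHS]stabilizer_isometry !comp_lfunE !gK xi_so.
apply: ev_eqP => s sz; rewrite ev_pullback.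
have szg : size (map g s) = 4%N by rewrite size_map.
apply: (etrans (@ev_lie_derivative _ _ _ _ eO xi 4 Phi (map g s) szg)).
apply: (etrans _ (esym (@ev_lie_derivative _ _ _ _ eO eta 4 Phi s sz))).
rewrite /lie_ev size_map; apply: eq_big_seq => i; rewrite mem_iota add0n => /= lti.
rewrite -[in RHS]gPhi ev_pullback map_cat map_take /= map_drop (nth_map 0) //.
by rewrite !comp_lfunE gK.
Qed.

End StabilizerIsometry.

(** * Invariance, dimensions and irreducibility *)

Section Irreducibility.
Variables (R : realType) (W : vectType R) (ip : {dot W for idfun}) (e : seq W).
Hypothesis eO : onb ip e.
Hypothesis e8 : size e = 8%N.
Variable Phi : altform W 4.
Hypothesis PhiE : forall J, J \in idx 8 4 -> fc e Phi J = zr R (cayley_coef J).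
Variable vol : altform W 8.
Hypothesis vol1 : ev vol e = 1.
Local Notation G := (stabilizer Phi).

Lemma dim_L2_7 : \dim (L2_7 e) = 7%N.
Proof.
have /andP[/eqP t _] := dim_checks.
exact: (@dim_prj_space _ _ _ _ eO _ _ e8 (4%ZZ, P2_7) 7 (split2_ok (i := 0) isT) t).
Qed.
Lemma dim_L2_21 : \dim (L2_21 e) = 21%N.
Proof.
have /and3P[_ /eqP t _] := dim_checks.
exact: (@dim_prj_space _ _ _ _ eO _ _ e8 (4%ZZ, P2_21) 21 (split2_ok (i := 1) isT) t).
Qed.
Lemma dim_L3_8 : \dim (L3_8 e) = 8%N.
Proof.
have /and4P[_ _ /eqP t _] := dim_checks.
exact: (@dim_prj_space _ _ _ _ eO _ _ e8 (7%ZZ, P3_8) 8 (split3_ok (i := 0) isT) t).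
Qed.
Lemma dim_L3_48 : \dim (L3_48 e) = 48%N.
Proof.
have /and5P[_ _ _ /eqP t _] := dim_checks.
exact: (@dim_prj_space _ _ _ _ eO _ _ e8 (7%ZZ, P3_48) 48 (split3_ok (i := 1) isT) t).
Qed.
Lemma dim_L4_1 : \dim (L4_1 e) = 1%N.
Proof.
have /and5P[_ _ _ _ /and4P[/eqP t _ _ _]] := dim_checks.
exact: (@dim_prj_space _ _ _ _ eO _ _ e8 (14%ZZ, P4_1) 1 (split4_ok (i := 0) isT) t).
Qed.
Lemma dim_L4_7 : \dim (L4_7 e) = 7%N.
Proof.
have /and5P[_ _ _ _ /and4P[_ /eqP t _ _]] := dim_checks.
exact: (@dim_prj_space _ _ _ _ eO _ _ e8 (8%ZZ, P4_7) 7 (split4_ok (i := 1) isT) t).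
Qed.
Lemma dim_L4_27 : \dim (L4_27 e) = 27%N.
Proof.
have /and5P[_ _ _ _ /and4P[_ _ /eqP t _]] := dim_checks.
exact: (@dim_prj_space _ _ _ _ eO _ _ e8 (56%ZZ, P4_27) 27 (split4_ok (i := 2) isT) t).
Qed.
Lemma dim_L4_35 : \dim (L4_35 e) = 35%N.
Proof.
have /and5P[_ _ _ _ /and4P[_ _ _ /eqP t]] := dim_checks.
exact: (@dim_prj_space _ _ _ _ eO _ _ e8 (2%ZZ, P4_35) 35 (split4_ok (i := 3) isT) t).
Qed.

Lemma splitting2 : orthogonal_splitting ip [tuple L2_7 e; L2_21 e].
Proof. by apply: (splitting_by_check eO e8 split2_check) => -[[|[|i]] lti]. Qed.
Lemma splitting3 : orthogonal_splitting ip [tuple L3_8 e; L3_48 e].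
Proof. by apply: (splitting_by_check eO e8 split3_check) => -[[|[|i]] lti]. Qed.
Lemma splitting4 : orthogonal_splitting ip [tuple L4_1 e; L4_7 e; L4_27 e; L4_35 e].
Proof. by apply: (splitting_by_check eO e8 split4_check) => -[[|[|[|[|i]]]] lti]. Qed.

Lemma invariant_L2_7 : invariant_subspace G (L2_7 e).
Proof.
move=> g f gG /(L2_7_wedge eO e8 PhiE vol1)[u [v ->]]; apply/(L2_7_wedge eO e8 PhiE vol1).
have surj := lker0_surj (proj1 gG); have iso := stabilizer_isometry eO e8 PhiE vol1 gG.
have [u' uE] := surj u; have [v' vE] := surj v; exists u', v'.
rewrite pullbackD pullbackN -uE -vE (pullback_interior2 gG); congr (_ - _).
apply: ev_eqP => -[|x [|y []]] // _.
by rewrite ev_pullback /= !ev_wedge2 !iso.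
Qed.

Lemma invariant_L2_21 : invariant_subspace G (L2_21 e).
Proof.
move=> g f gG /(L2_21_interior eO e8 PhiE vol1) fL; apply/(L2_21_interior eO e8 PhiE vol1) => u v.
rewrite -(pullback_interior2 gG) (form_ip_pullback eO e8 PhiE vol1 gG) fL.
by rewrite !ev_tuple2 ev_pullback.
Qed.

Lemma invariant_L3_8 : invariant_subspace G (L3_8 e).
Proof.
move=> g f gG /(mem_L3_8 eO e8 PhiE)[u <-]; apply/(mem_L3_8 eO e8 PhiE).
have [v <-] := lker0_surj (proj1 gG) u; exists v.
by rewrite pullback_interior (proj2 gG).
Qed.

Lemma invariant_L3_48 : invariant_subspace G (L3_48 e).
Proof.
move=> g f gG /(mem_L3_48 eO e8 PhiE) f0; apply/(mem_L3_48 eO e8 PhiE).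
rewrite -{1}(proj2 gG) -pullback_wedge f0.
by apply: ev_eqP => s _; rewrite ev_pullback.
Qed.

Lemma invariant_L4_1 : invariant_subspace G (L4_1 e).
Proof.
move=> g f gG; rewrite (L4_1E eO e8 PhiE) => /vlineP[c ->].
by rewrite pullbackZ (proj2 gG) rpredZ ?memv_line.
Qed.

Lemma invariant_L4_7 : invariant_subspace G (L4_7 e).
Proof.
move=> g f gG /(mem_L4_7 eO e8 PhiE)[xi xs <-]; apply/(mem_L4_7 eO e8 PhiE).
by have [eta es ->] := pullback_lie eO e8 PhiE vol1 gG xs; exists eta.
Qed.

Lemma invariant_L4_35 : invariant_subspace G (L4_35 e).
Proof.
move=> g f gG /(mem_L4_35 eO e8 vol1) fL; apply/(mem_L4_35 eO e8 vol1).
by rewrite (hodge_pullback eO e8 PhiE vol1 gG) fL pullbackN.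
Qed.

Lemma pullback_form0 g k : pullback g (0 : altform W k) = 0.
Proof. exact/formP. Qed.

Lemma pullbackK g k (f : altform W k) : lker g = 0%VS -> pullback g (pullback (g^-1)%VF f) = f.
Proof.
move=> g0; apply: ev_eqP => s _; rewrite !ev_pullback -map_comp map_id_in // => x _ /=.
by rewrite lker0_lfunK // g0.
Qed.

Lemma invariant_L4_27 : invariant_subspace G (L4_27 e).
Proof.
move=> g f gG /(mem_L4_27 eO e8 PhiE vol1)[fS f1 f7]; apply/(mem_L4_27 eO e8 PhiE vol1).
split.
- by rewrite (hodge_pullback eO e8 PhiE vol1 gG) fS.
- by rewrite -{1}(proj2 gG) -pullback_wedge f1 pullback_form0.
- move=> xi xs.
  have giG : G (g^-1)%VF.
    split; last first.
      apply: ev_eqP => s _; rewrite -{1}(proj2 gG) !ev_pullback -map_comp map_id_in // => x _ /=.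
      have [y <-] := lker0_surj (proj1 gG) x.
      by rewrite limg_lfunVK // memv_img ?memvf.
    apply/eqP; rewrite -subv0; apply/subvP => x; rewrite memv_ker memv0 => /eqP x0.
    have [y yx] := lker0_surj (proj1 gG) x.
    by rewrite -yx -(limg_lfunVK (memv_img g (memvf y))) yx x0 linear0.
  have [eta es etaE] := pullback_lie eO e8 PhiE vol1 giG xs.
  have -> : lie_derivative xi Phi = pullback g (lie_derivative eta Phi).
    exact: (etrans (esym (pullbackK (lie_derivative xi Phi) (proj1 gG))) (congr1 (pullback g) etaE)).
  by rewrite -pullback_wedge f7 // pullback_form0.
Qed.

Lemma irreducible_line (f : altform W 4) : f != 0 -> invariant_subspace G <[f]>%VS ->
  irreducible_representation G <[f]>%VS.
Proof.
move=> f0 inv; split=> // [|U Uf _]; first by rewrite -dimv_eq0 dim_vline f0.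
have [->|U0] := eqVneq U 0%VS; [by left|right].
by apply/eqP; rewrite eqEdim Uf dim_vline f0 lt0n dimv_eq0.
Qed.

Lemma irreducible_L4_1 : irreducible_representation G (L4_1 e).
Proof.
have := invariant_L4_1; rewrite (L4_1E eO e8 PhiE); apply: irreducible_line.
have := dim_L4_1; rewrite (L4_1E eO e8 PhiE) dim_vline.
by case: (Phi != 0).
Qed.

Lemma irreducible_L2_7 : irreducible_representation G (L2_7 e).
Proof. exact: (irreducible_by_check eO e8 PhiE (split2_ok (i := 0) isT) irr_check2_7 dim_L2_7 invariant_L2_7). Qed.
Lemma irreducible_L2_21 : irreducible_representation G (L2_21 e).
Proof. exact: (irreducible_by_check eO e8 PhiE (split2_ok (i := 1) isT) irr_check2_21 dim_L2_21 invariant_L2_21). Qed.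
Lemma irreducible_L3_8 : irreducible_representation G (L3_8 e).
Proof. exact: (irreducible_by_check eO e8 PhiE (split3_ok (i := 0) isT) irr_check3_8 dim_L3_8 invariant_L3_8). Qed.
Lemma irreducible_L3_48 : irreducible_representation G (L3_48 e).
Proof. exact: (irreducible_by_check eO e8 PhiE (split3_ok (i := 1) isT) irr_check3_48 dim_L3_48 invariant_L3_48). Qed.
Lemma irreducible_L4_7 : irreducible_representation G (L4_7 e).
Proof. exact: (irreducible_by_check eO e8 PhiE (split4_ok (i := 1) isT) irr_check4_7 dim_L4_7 invariant_L4_7). Qed.
Lemma irreducible_L4_27 : irreducible_representation G (L4_27 e).
Proof. exact: (irreducible_by_check eO e8 PhiE (split4_ok (i := 2) isT) irr_check4_27 dim_L4_27 invariant_L4_27). Qed.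
Lemma irreducible_L4_35 : irreducible_representation G (L4_35 e).
Proof. exact: (irreducible_by_check eO e8 PhiE (split4_ok (i := 3) isT) irr_check4_35 dim_L4_35 invariant_L4_35). Qed.

End Irreducibility.

Theorem theorem9p8 (R : realType) (W : vectType R) (ip : {dot W for idfun})
    (P : 3.-tuple W -> W) (Phi : altform W 4)
    (dimW : \dim {:W} = 8%N)
    (tripleP : triple_cross_product ip P)
    (posP : positive_product ip P)
    (PhiP : cayley_calibration ip P Phi) :
  let vol : altform W 8 := volume ip (Phi ∧ Phi) in
  let G := stabilizer Phi in
  let g := lie_algebra G in
  exists (L2_7 L2_21 : {vspace altform W 2}) (L3_8 L3_48 : {vspace altform W 3})
         (L4_1 L4_7 L4_27 L4_35 : {vspace altform W 4}),
    [/\ (* Λ^2 *)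
        [/\ orthogonal_splitting ip [tuple L2_7; L2_21],
            \dim L2_7 = 7%N & \dim L2_21 = 21%N] /\
        [/\ [set` L2_7] = [set w | hodge ip 6 2 vol (Phi ∧ w) = 3 *: w],
            [set` L2_7] =
              [set w | exists u v,
                 w = covector ip u ∧ covector ip v - interior_product u (interior_product v Phi)],
            [set (w : 2.-tuple W -> R) | w in [set` L2_21]] = omega ip @` g,
            [set` L2_21] = [set w | hodge ip 6 2 vol (Phi ∧ w) = - w] &
            [set` L2_21] =
              [set w : altform W 2 | forall u v : W,
                 form_ip ip w (interior_product u (interior_product v Phi)) = w [tuple u; v]]],
        (* Λ^3 *)
        [/\ orthogonal_splitting ip [tuple L3_8; L3_48],
            \dim L3_8 = 8%N & \dim L3_48 = 48%N] /\
        [/\ [set` L3_8] = [set interior_product u Phi | u in [set: W]] &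
            [set` L3_48] = [set w : altform W 3 | Phi ∧ w = 0]],
        (* Λ^4 *)
        [/\ orthogonal_splitting ip [tuple L4_1; L4_7; L4_27; L4_35],
            \dim L4_1 = 1%N, \dim L4_7 = 7%N, \dim L4_27 = 27%N &
            \dim L4_35 = 35%N] /\
        [/\ L4_1 = <[Phi]>%VS,
            [set` L4_7] = [set lie_derivative xi Phi | xi in so ip],
            [set` L4_27] =
              [set w | [/\ hodge ip 4 4 vol w = w, w ∧ Phi = 0 &
                 forall xi, so ip xi -> w ∧ lie_derivative xi Phi = 0]] &
            [set` L4_35] = [set w | hodge ip 4 4 vol w = - w]] &
        [/\ irreducible_representation G L2_7,
            irreducible_representation G L2_21,
            irreducible_representation G L3_8 &
            irreducible_representation G L3_48] /\
        [/\ irreducible_representation G L4_1,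
            irreducible_representation G L4_7,
            irreducible_representation G L4_27 &
            irreducible_representation G L4_35]].
Proof.
move=> vol G g; have [e [eO e8 PhiE]] := cayley_frame tripleP posP PhiP dimW.
have vol1 : ev vol e = 1 := ev_volume eO e8 PhiE.
exists (L2_7 e), (L2_21 e), (L3_8 e), (L3_48 e), (L4_1 e), (L4_7 e), (L4_27 e), (L4_35 e).
have ext k (L : {vspace altform W k}) (S : set (altform W k)) :
    (forall w, w \in L <-> S w) -> [set` L] = S.
  by move=> H; apply/seteqP; split=> w /H.
split; split.
- split; [exact: (splitting2 eO e8)|exact: (dim_L2_7 eO e8)|exact: (dim_L2_21 eO e8)].
- split.
  + exact/ext/(mem_L2_7 eO e8 PhiE vol1).
  + exact/ext/(L2_7_wedge eO e8 PhiE vol1).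
  + apply/seteqP; split=> [_ /= [w wL <-]|_ /= [xi /(omega_lie_algebra eO e8 PhiE) L0 <-]].
      exists (end_of ip e w); last by rewrite -[in RHS](omega_form_end_of eO e8 w).
      apply/(omega_lie_algebra eO e8 PhiE)/(lie_omega_L2_21 eO e8 PhiE vol1 (end_of_so eO e8 w)).
      by rewrite omega_form_end_of.
    have xs := lie0_so eO e8 PhiE L0; exists (omega_form xs) => //.
    exact/(lie_omega_L2_21 eO e8 PhiE vol1 xs).
  + exact/ext/(mem_L2_21 eO e8 PhiE vol1).
  + exact/ext/(L2_21_interior eO e8 PhiE vol1).
- split; [exact: (splitting3 eO e8)|exact: (dim_L3_8 eO e8)|exact: (dim_L3_48 eO e8)].
- split; last exact/ext/(mem_L3_48 eO e8 PhiE).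
  apply: ext => w; rewrite (mem_L3_8 eO e8 PhiE).
  by split=> [[u <-]|[u _ <-]]; exists u.
- split; [exact: (splitting4 eO e8)|exact: (dim_L4_1 eO e8)|exact: (dim_L4_7 eO e8)|
    exact: (dim_L4_27 eO e8)|exact: (dim_L4_35 eO e8)].
- split; first exact: (L4_1E eO e8 PhiE).
  + exact/ext/(mem_L4_7 eO e8 PhiE).
  + exact/ext/(mem_L4_27 eO e8 PhiE vol1).
  + exact/ext/(mem_L4_35 eO e8 vol1).
- split; [exact: (irreducible_L2_7 eO e8 PhiE vol1)|exact: (irreducible_L2_21 eO e8 PhiE vol1)|
    exact: (irreducible_L3_8 eO e8 PhiE)|exact: (irreducible_L3_48 eO e8 PhiE)].
- split; [exact: (irreducible_L4_1 eO e8 PhiE)|exact: (irreducible_L4_7 eO e8 PhiE vol1)|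
    exact: (irreducible_L4_27 eO e8 PhiE vol1)|exact: (irreducible_L4_35 eO e8 PhiE vol1)].
Qed.
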